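(* Let $f:\mathbb{C}^2\to\mathbb{C}$, $f(0)=0$, be a $u$-semiholomorphic polynomial. Let $P_i=(p_{i,1},p_{i,2})$, $i=1,\dots,N$, be the weight vectors associated with the 1-faces of the Newton boundary of $f$. Suppose that \begin{itemize} \item[(S-i)] the mixed polynomial $f_u$ is inner non-degenerate (IND); \item[(S-ii)] for every $i\in\{1,\dots,N\}$ and every parametrization $(u(t),t)$ (by $t$) of the roots of $((f_u)_{P_i})_i$: if $t_*$ is a local extremum (minimum or maximum) of the function $t\mapsto((s_{3,f})_{P_i})_i(u(t),t)$, then $((s_{3,f})_{P_i})_i(u(t_* ),t_* )\neq0$. \end{itemize} Then $f$ has an isolated singularity at the origin (in the sense that, if the origin is a singular point of $f$, it is an isolated singularity) if and only if $f$ is strongly partially non-degenerate (SPND).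
   Context: A mixed polynomial is a (not identically zero) finite sum $f(z,\bar z)=\sum_{\nu,\mu}c_{\nu,\mu}z^\nu\bar z^\mu$ with $z=(u,v)\in\mathbb{C}^2$, $\bar z=(\bar u,\bar v)$, $z^\nu=u^{\nu_1}v^{\nu_2}$, $\bar z^\mu=\bar u^{\mu_1}\bar v^{\mu_2}$. It is $u$-semiholomorphic if it does not depend on $\bar u$. Its support is $\mathrm{supp}(f)=\{\nu+\mu: c_{\nu,\mu}\neq 0\}\subset\mathbb{N}^2$. $f_u,f_{\bar u},f_v,f_{\bar v}$ denote the (Wirtinger) partial derivatives. $V_f=f^{-1}(0)$. Singular set: put $s_{1,f}=f_u\overline{f_{\bar v}}-\overline{f_{\bar u}}f_v$, $s_{2,f}=|f_u|^2-|f_{\bar u}|^2$, $s_{3,f}=|f_v|^2-|f_{\bar v}|^2$ (these are mixed polynomials). The set of critical (singular) points of $f$ is $\Sigma_f=\{s_{1,f}=s_{2,f}=s_{3,f}=0\}$; it is the set of points where the real Jacobian matrix of $f$ does not have maximal rank. The origin is an isolated singularity if it has an open neighbourhood $U$ with $U\cap\Sigma_f=\{0\}$. Face functions: a positive weight vector is $P=(p_1,p_2)$ with $p_1,p_2$ positive integers. The radial degree of a monomial $c_{\nu,\mu}z^\nu\bar z^\mu$ is $p_1(\nu_1+\mu_1)+p_2(\nu_2+\mu_2)$; for a mixed polynomial $h$, $d(P;h)$ is the minimal radial degree among the monomials of $h$, and the face function $h_P$ is the sum of the monomials of $h$ of radial degree $d(P;h)$ (for the zero polynomial, the $P$-part is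 $0$). The Newton boundary $\Gamma_h$ is the union of the compact faces (vertices and 1-dimensional faces, ''1-faces'') of the convex hull of $\bigcup_{\nu+\mu\in\mathrm{supp}(h)}\left(\nu+\mu+\mathbb{R}_{\ge0}^2\right)$. For a compact face $\Delta$, $h_\Delta$ is the sum of the monomials $c_{\nu,\mu}z^\nu\bar z^\mu$ of $h$ with $\nu+\mu\in\Delta$, and $h_\Gamma$ is the sum of those with $\nu+\mu\in\Gamma_h$. The weight vectors associated with the 1-faces of $\Gamma_h$ are the vectors $Q_1,\dots,Q_M$ (one for each 1-face) such that $h_{Q_i}$ is the face function of a compact 1-face, where $Q_i=(q_{i,1},q_{i,2})$ and they are ordered so that $q_{1,1}/q_{1,2}>\dots>q_{M,1}/q_{M,2}$. If $\Gamma_h$ has no 1-face, the convention is that the list consists of the single vector $(1,1)$. A vertex of $\Gamma_h$ is called extreme if it bounds a unique 1-face, and non-extreme if it bounds two. Notation $(h_{P_i})_i$: for a mixed polynomial $h$ and $k_i=p_{i,1}/p_{i,2}$, $(h_{P_i})_i:\mathbb{C}\times\mathbb{R}/2\pi\mathbb{Z}\to\mathbb{C}$ is $$(h_{P_i})_i(u,t)=r^{-d(P_i;h)/p_{i,2}}\,h_{P_i}\left(r^{k_i}u,r^{k_i}\bar u,re^{\mathrm{i}t},re^{-\mathrm{i}t}\right),\qquad r>0,$$ which is independent of $r$ by radial weighted homogeneity of $h_{P_i}$. (Parametrizations of the roots of $((f_u)_{P_i})_i$ by $t$ exist when $f_u$ is IND.) IND (for a mixed polynomial $h$ with 1-face weight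 vectors $Q_1,\dots,Q_M$): (i) $h_{Q_1}$ has no critical points in $V_{h_{Q_1}}\cap(\mathbb{C}^2\setminus\{v=0\})$ and $h_{Q_M}$ has no critical points in $V_{h_{Q_M}}\cap(\mathbb{C}^2\setminus\{u=0\})$; (ii) for each 1-face and each non-extreme vertex $\Delta$ of $\Gamma_h$, $h_\Delta$ has no critical points in $V_{h_\Delta}\cap(\mathbb{C}^* )^2$. If $\Gamma_h$ is a single vertex, $h$ is called IND if $h_\Gamma$ has no critical points in $V_{h_\Gamma}\cap(\mathbb{C}^2\setminus\{(0,0)\})$. SPND: for every positive weight vector $P$: (i) the system $(s_{1,f}(0,v))_P=(s_{2,f}(0,v))_P=(s_{3,f}(0,v))_P=0$ has no solution in $(\mathbb{C}^* )^2$, and the system $(s_{1,f}(u,0))_P=(s_{2,f}(u,0))_P=(s_{3,f}(u,0))_P=0$ has no solution in $(\mathbb{C}^* )^2$; (ii) the system $(s_{1,f})_P=(s_{2,f})_P=(s_{3,f})_P=0$ has no solution in $(\mathbb{C}^* )^2$. Here $h(0,v)$ and $h(u,0)$ denote the mixed polynomials obtained from $h$ by setting $u=\bar u=0$, respectively $v=\bar v=0$. *)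

(* Defs.v *)
From HB Require Import structures.
From mathcomp Require Import all_boot all_order all_algebra.
From mathcomp Require Import complex ring.
(* The notations of mpoly.v clash with those of MathComp-Analysis. *)
From mathcomp Require Import(canonicals, coercions) mpoly.
From mathcomp Require Import all_classical all_reals all_analysis.

Set Implicit Arguments.
Unset Strict Implicit.
Unset Printing Implicit Defensive.

Import Order.TTheory GRing.Theory Num.Theory.
Import numFieldNormedType.Exports.
Local Open Scope classical_set_scope.
Local Open Scope ring_scope.
Local Open Scope complex_scope.

(* A mixed polynomial in (u, v) is a polynomial in the four formal variables
   u, ubar, v, vbar; the formal partial derivatives are then the Wirtinger
   derivatives. The regular algebra R[i]^o carries the usual topology of the
   complex plane. *)
Notation mixed R := (mpoly.mpoly 4 (complex R)).

Definition iu : 'I_4 := @Ordinal 4 0 isT.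
Definition iub : 'I_4 := @Ordinal 4 1 isT.
Definition iv : 'I_4 := @Ordinal 4 2 isT.
Definition ivb : 'I_4 := @Ordinal 4 3 isT.

Definition mixed_var (R : realType) (i : 'I_4) : mixed R :=
  mpoly.mpolyX _ (mpoly.mnm1 i).

Definition mixed_eval (R : realType) (h : mixed R) (u v : R[i]) : R[i] :=
  mpoly.meval (tnth [tuple u; u^*; v; v^*]) h.

Definition mixed_conj (R : realType) (h : mixed R) : mixed R :=
  mpoly.map_mpoly (fun c : R[i] => c^*)
    (mpoly.comp_mpoly [tuple mixed_var R iub; mixed_var R iu;
                             mixed_var R ivb; mixed_var R iv] h).

(* h(0, v) and h(u, 0) *)
Definition set_u0 (R : realType) (h : mixed R) : mixed R :=
  mpoly.comp_mpoly [tuple 0; 0; mixed_var R iv; mixed_var R ivb] h.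
Definition set_v0 (R : realType) (h : mixed R) : mixed R :=
  mpoly.comp_mpoly [tuple mixed_var R iu; mixed_var R iub; 0; 0] h.

Definition u_semiholomorphic (R : realType) (h : mixed R) : Prop :=
  forall m, m \in mpoly.msupp h -> m iub = 0%N.

Definition d_u (R : realType) (h : mixed R) : mixed R := mpoly.mderiv iu h.
Definition d_ub (R : realType) (h : mixed R) : mixed R := mpoly.mderiv iub h.
Definition d_v (R : realType) (h : mixed R) : mixed R := mpoly.mderiv iv h.
Definition d_vb (R : realType) (h : mixed R) : mixed R := mpoly.mderiv ivb h.

Definition s1 (R : realType) (h : mixed R) : mixed R :=
  d_u h * mixed_conj (d_vb h) - mixed_conj (d_ub h) * d_v h.
Definition s2 (R : realType) (h : mixed R) : mixed R :=
  d_u h * mixed_conj (d_u h) - d_ub h * mixed_conj (d_ub h).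
Definition s3 (R : realType) (h : mixed R) : mixed R :=
  d_v h * mixed_conj (d_v h) - d_vb h * mixed_conj (d_vb h).

Definition zero_set (R : realType) (h : mixed R) : set (R[i]^o * R[i]^o) :=
  [set z | mixed_eval h z.1 z.2 = 0].

Definition singular_set (R : realType) (h : mixed R) :
    set (R[i]^o * R[i]^o) :=
  [set z | [/\ mixed_eval (s1 h) z.1 z.2 = 0,
               mixed_eval (s2 h) z.1 z.2 = 0 &
               mixed_eval (s3 h) z.1 z.2 = 0]].

Definition isolated_at_origin (R : realType)
    (S : set (R[i]^o * R[i]^o)) : Prop :=
  exists U : set (R[i]^o * R[i]^o),
    [/\ open U, U (0, 0) & U `&` S = [set (0, 0)]].

Definition torus {R : realType} : set (R[i]^o * R[i]^o) :=
  [set z | z.1 != 0 /\ z.2 != 0].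

(* nu + mu, for the monomial with exponents (nu, mu) *)
Definition mexp (m : mpoly.multinom 4) : nat * nat :=
  ((m iu + m iub)%N, (m iv + m ivb)%N).

Definition subsum (R : realType) (h : mixed R)
    (S : pred (mpoly.multinom 4)) : mixed R :=
  \sum_(m <- mpoly.msupp h | S m) mpoly.mcoeff m h *: mpoly.mpolyX _ m.

Definition positive_weight (P : nat * nat) : bool := (0 < P.1)%N && (0 < P.2)%N.

Definition rdeg (P : nat * nat) (m : mpoly.multinom 4) : nat :=
  (P.1 * (mexp m).1 + P.2 * (mexp m).2)%N.

(* d(P; h), for h != 0 *)
Definition min_rdeg (R : realType) (P : nat * nat) (h : mixed R) : nat :=
  head 0%N (sort leq [seq rdeg P m | m <- mpoly.msupp h]).

(* h_P; equal to 0 when h = 0 *)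
Definition weight_face (R : realType) (P : nat * nat) (h : mixed R) : mixed R :=
  subsum h (fun m => rdeg P m == min_rdeg P h).

(* Newton boundary. The plane is R^o * R^o, a module over R. *)

Definition exp_point (R : realType) (m : mpoly.multinom 4) : R^o * R^o :=
  ((mexp m).1%:R, (mexp m).2%:R).

Definition newton_polyhedron (R : realType) (h : mixed R) : set (R^o * R^o) :=
  smallest (@convex_set R (R^o * R^o)%type)
    [set x | exists2 m, m \in mpoly.msupp h &
               (exp_point R m).1 <= x.1 /\ (exp_point R m).2 <= x.2].

(* Compact faces, cut out by a supporting line; since w is nonzero, they have
   dimension at most 1. *)
Definition compact_face (R : realType) (h : mixed R)
    (F : set (R^o * R^o)) : Prop :=
  [/\ F !=set0, compact F &
      exists2 w : R * R, w != (0, 0) &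
        F = [set x | newton_polyhedron h x /\
               forall y, newton_polyhedron h y ->
                 w.1 * x.1 + w.2 * x.2 <= w.1 * y.1 + w.2 * y.2]].

Definition vertex (R : realType) (h : mixed R) (x : R^o * R^o) : Prop :=
  compact_face h [set x].

Definition one_face (R : realType) (h : mixed R)
    (F : set (R^o * R^o)) : Prop :=
  compact_face h F /\ exists x y, [/\ F x, F y & x != y].

Definition newton_boundary (R : realType) (h : mixed R) : set (R^o * R^o) :=
  \bigcup_(F in compact_face h) F.

Definition non_extreme_vertex (R : realType) (h : mixed R)
    (x : R^o * R^o) : Prop :=
  vertex h x /\
  exists F G, [/\ one_face h F, one_face h G, F <> G, F x & G x].

(* h_Delta and h_Gamma *)
Definition set_face (R : realType) (h : mixed R)
    (D : set (R^o * R^o)) : mixed R :=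
  subsum h (fun m => exp_point R m \in D).

(* The weight vectors Q_1, ..., Q_M as the elements of a set. They are taken
   with coprime entries, so that there is exactly one for each 1-face. *)
Definition newton_weight (R : realType) (h : mixed R) (Q : nat * nat) : Prop :=
  [/\ positive_weight Q, coprime Q.1 Q.2 &
      exists2 F, one_face h F & weight_face Q h = set_face h F] \/
  (~ (exists F, one_face h F)) /\ Q = (1%N, 1%N).

Definition ratio (Q : nat * nat) : rat := Q.1%:R / Q.2%:R.

(* Q_1 *)
Definition first_weight (R : realType) (h : mixed R) (Q : nat * nat) : Prop :=
  newton_weight h Q /\
  forall Q', newton_weight h Q' -> ratio Q' <= ratio Q.

(* Q_M *)
Definition last_weight (R : realType) (h : mixed R) (Q : nat * nat) : Prop :=
  newton_weight h Q /\
  forall Q', newton_weight h Q' -> ratio Q <= ratio Q'.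

Definition no_critical_zero (R : realType) (h : mixed R)
    (D : set (R[i]^o * R[i]^o)) : Prop :=
  singular_set h `&` (zero_set h `&` D) = set0.

Definition inner_nondegenerate (R : realType) (h : mixed R) : Prop :=
  [/\ h != 0,
      (exists x, newton_boundary h = [set x]) ->
        no_critical_zero (set_face h (newton_boundary h)) (~` [set (0, 0)]) &
      ~ (exists x, newton_boundary h = [set x]) ->
        [/\ forall Q, first_weight h Q ->
              no_critical_zero (weight_face Q h) [set z | z.2 != 0],
            forall Q, last_weight h Q ->
              no_critical_zero (weight_face Q h) [set z | z.1 != 0],
            forall F, one_face h F ->
              no_critical_zero (set_face h F) torus &
            forall x, non_extreme_vertex h x ->
              no_critical_zero (set_face h [set x]) torus]].

Definition no_common_zero (R : realType) (g1 g2 g3 : mixed R)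
    (D : set (R[i]^o * R[i]^o)) : Prop :=
  zero_set g1 `&` zero_set g2 `&` zero_set g3 `&` D = set0.

Definition strongly_partially_nondegenerate (R : realType)
    (f : mixed R) : Prop :=
  forall P, positive_weight P ->
    [/\ no_common_zero (weight_face P (set_u0 (s1 f)))
          (weight_face P (set_u0 (s2 f))) (weight_face P (set_u0 (s3 f)))
          torus,
        no_common_zero (weight_face P (set_v0 (s1 f)))
          (weight_face P (set_v0 (s2 f))) (weight_face P (set_v0 (s3 f)))
          torus &
        no_common_zero (weight_face P (s1 f)) (weight_face P (s2 f))
          (weight_face P (s3 f)) torus].

Definition expi (R : realType) (t : R) : R[i] := cos t +i* sin t.

(* (h_P)_i, with i indicated by P: the rescaled restriction
     r^(-d(P;h)/p2) h_P(r^k u, r^k ubar, r e^(it), r e^(-it)),  k = p1/p2,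
   is independent of r > 0 (lemma face_sliceE below), and is taken at r = 1. *)
Definition face_slice (R : realType) (h : mixed R) (P : nat * nat)
    (u : R[i]) (t : R) : R[i] :=
  mixed_eval (weight_face P h) u (expi t).

(* Roots form curves in C x R/2piZ; a parametrization by t of such a curve is
   defined on the universal cover R of the circle, and need not be
   2pi-periodic. *)
Definition root_parametrization (R : realType) (g : R[i] -> R -> R[i])
    (u : R -> R[i]^o) : Prop :=
  continuous u /\ forall t, g (u t) t = 0.

Definition local_extremum (R : realType) (g : R -> R) (t0 : R) : Prop :=
  (\forall t \near t0, g t0 <= g t) \/ (\forall t \near t0, g t <= g t0).

(* The real part is used only to type g as a real function: s3 f, hence also
   its face functions, takes real values. *)
Definition nonzero_at_extrema (R : realType) (f : mixed R) (P : nat * nat) :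
    Prop :=
  forall u : R -> R[i]^o,
    root_parametrization (face_slice (d_u f) P) u ->
    forall t0 : R,
      local_extremum (fun t => complex.Re (face_slice (s3 f) P (u t) t)) t0 ->
      face_slice (s3 f) P (u t0) t0 != 0.

Lemma prod_mixed_vars (S : comNzRingType) (x : 'I_4 -> S)
    (m : mpoly.multinom 4) :
  \prod_i x i ^+ m i =
    x iu ^+ m iu * x iub ^+ m iub * (x iv ^+ m iv * x ivb ^+ m ivb).
Proof.
rewrite !big_ord_recl big_ord0 mulr1 !mulrA.
by do !congr (_ * _); congr (x _ ^+ mpoly.fun_of_multinom m _); apply: val_inj.
Qed.

Lemma mixed_evalE (R : realType) (h : mixed R) (u v : R[i]) :
  mixed_eval h u v = \sum_(m <- mpoly.msupp h)
    mpoly.mcoeff m h * (u ^+ m iu * u^* ^+ m iub * (v ^+ m iv * v^* ^+ m ivb)).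
Proof.
rewrite /mixed_eval mpoly.mevalE; apply: eq_bigr => m _.
by rewrite prod_mixed_vars.
Qed.

Lemma mixed_eval_conj (R : realType) (h : mixed R) (u v : R[i]) :
  mixed_eval (mixed_conj h) u v = (mixed_eval h u v)^*.
Proof.
rewrite [in RHS]mixed_evalE rmorph_sum /= /mixed_conj mpoly.comp_mpolyEX.
rewrite raddf_sum /= /mixed_eval raddf_sum /=; apply: eq_bigr => m _.
rewrite -mpoly.mul_mpolyC rmorphM /= mpoly.map_mpolyC mpoly.mevalM mpoly.mevalC.
rewrite rmorphM /=; congr (_ * _).
rewrite mpoly.comp_mpolyX rmorph_prod rmorph_prod /=.
under eq_bigr do rewrite !rmorphXn /=.
rewrite prod_mixed_vars /tnth /= /mixed_var !mpoly.map_mpolyX !mpoly.mevalXU.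
rewrite /tnth /= !rmorphM !rmorphXn /= !conjcK.
by rewrite (mulrC (u^* ^+ _)) (mulrC (v^* ^+ _)).
Qed.

Lemma min_rdeg_le (R : realType) (P : nat * nat) (h : mixed R) m :
  m \in mpoly.msupp h -> (min_rdeg P h <= rdeg P m)%N.
Proof.
move=> mh; rewrite /min_rdeg.
have : rdeg P m \in sort leq [seq rdeg P m | m <- mpoly.msupp h].
  by rewrite mem_sort map_f.
have := sort_sorted leq_total [seq rdeg P m | m <- mpoly.msupp h].
case: (sort _ _) => [//|a s] /= /(order_path_min leq_trans)/allP les.
by rewrite inE => /predU1P[->//|/les].
Qed.

Lemma min_rdeg_attained (R : realType) (P : nat * nat) (h : mixed R) :
  h != 0 -> exists2 m, m \in mpoly.msupp h & rdeg P m = min_rdeg P h.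
Proof.
rewrite -mpoly.msupp_eq0 /min_rdeg => h0.
suff /mapP[m mh ->] : head 0%N (sort leq [seq rdeg P m | m <- mpoly.msupp h])
    \in [seq rdeg P m | m <- mpoly.msupp h] by exists m.
rewrite -(mem_sort leq); case E: (sort _ _) => [|a s]; last exact: mem_head.
by case: (mpoly.msupp h) h0 (congr1 size E) => // m s _; rewrite size_sort.
Qed.

Lemma face_sliceE (R : realType) (h : mixed R) (P : nat * nat)
    (u : R[i]) (t r : R) :
  positive_weight P -> 0 < r ->
  face_slice h P u t =
  (r `^ (- ((min_rdeg P h)%:R / P.2%:R)))%:C *
  mixed_eval (weight_face P h)
    ((r `^ (P.1%:R / P.2%:R))%:C * u) (r%:C * expi t).
Proof.
move=> /andP[_ P2] r0; rewrite /face_slice; move: (expi t) => w.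
have conjM (a : R) (z : R[i]) : (a%:C * z)^* = a%:C * z^*.
  by rewrite rmorphM /=; congr (_ * _); apply/eqP; rewrite eq_complex /= oppr0 !eqxx.
rewrite /mixed_eval !conjM /weight_face /subsum !raddf_sum /= mulr_sumr.
apply: eq_bigr => m /eqP Em.
rewrite !mpoly.mevalZ mulrCA; congr (_ * _).
rewrite !mpoly.mevalX !prod_mixed_vars /tnth.
set k := r `^ (P.1%:R / _).
rewrite /= !exprMn.
have key : (r `^ (- ((min_rdeg P h)%:R / P.2%:R)))%:C *
   (k%:C ^+ m iu * k%:C ^+ m iub * (r%:C ^+ m iv * r%:C ^+ m ivb)) = 1 :> R[i].
  rewrite -!exprD -!rmorphXn -!rmorphM /=.
  rewrite -[RHS]/((1 : R)%:C); congr (_ %:C).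
  rewrite -Em /rdeg /mexp /= /k -!powR_mulrn ?powR_ge0 ?(ltW r0)//.
  rewrite -powRrM -!powRD ?(gt_eqF r0) ?implybT //.
  rewrite (_ : _ + _ = 0) ?powRr0 //.
  have P2' : P.2%:R != 0 :> R by rewrite pnatr_eq0 -lt0n.
  rewrite !natrD !natrM !natrD; field.
  exact: P2'.
rewrite -[LHS]mul1r -key; move: (_%:C) => c.
by do !(move: (_ ^+ _) => ?); ring.
Qed.

(* Main.v *)
Require Import Defs.
From HB Require Import structures.
From mathcomp Require Import all_boot all_order all_algebra.
From mathcomp Require Import complex.
From mathcomp Require Import(canonicals, coercions) mpoly.
From mathcomp Require Import all_classical all_reals all_analysis.
From mathcomp Require Import zify ring lra.

(** Write [g] for [f_u] and [k] for the real-valued function [s3 f]. Since [f] is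
    semiholomorphic, [s2] is [|g| ^ 2] and [g] divides [s1], so the singular set is
    [g = k = 0], and its faces behave likewise. Call the pair [(g, k)] degenerate if, for some
    weight, the two face functions of [g] and [k], or of their restrictions to one of the axes,
    have a common zero in the torus: this is the failure of strong partial non-degeneracy. The
    theorem says that common zeros of [g] and [k] cluster at the origin if and only if
    [(g, k)] is degenerate.

    Clustering implies degeneracy, whatever [g] and [k] ([zeros_cluster_degenerate]). Along an
    ultrafilter of common zeros [(u, v)] that tends to the origin, either some weight
    balances [|u|] and [|v|], and rescaling by it leads in the limit to a common zero of the
    faces in the torus ([balanced_face]), or none does, and then a suitable weight has a
    single exponent in each face, that of the dominant monomials ([separating_weight],
    [unbalanced_face]). Zeros on an axis are treated as balanced.

    Conversely, suppose that the faces of [g] and [k] for a weight [P] vanish at a point. Inner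
    non-degeneracy of [g] makes the zeros of the face functions of edges simple in [u]
    ([edge_simple], [first_edge_simple]), and by Euler's identity the coefficients of
    vertices that involve [u] have no zeros ([vertex_coef_neq0]). The roots of the face function
    of an edge therefore form a covering of the circle of the arguments of [v], so that each
    of them lies on a branch [U (t)] defined for all [t] ([edge_branch], [global_branch]).
    If the weight is one of [f], the hypothesis on extrema says that the face function of [k]
    along [U], which vanishes at some [t0], has no local extremum there; so it changes sign.
    Simple roots persist for the rescaled polynomials, which gives a two-parameter family of
    zeros of [g] shrinking to the origin, on which [k] changes sign: the intermediate value
    theorem yields common zeros ([cluster_branch], [cluster_box]).

    It remains to find a weight of [f]. The Newton boundary of [g] is that of [f] shifted, up
    to the monomials of [f] free of [u]. A zero of a vertex of [g], or a weight of [g] that is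
    not one of [f], is moved to the next edge below, where the branch to use is [u = 0]
    ([core], [case_vertex]). If there is no such edge, [f] starts with a linear term in [v],
    [v^c], with coefficients of equal modulus. Then [k] is computed explicitly on the axis
    [v = 0], on which [g] vanishes; there the condition on the lowest vertex of [g]
    ([bottom_coefs]) makes it change sign on small circles ([v_axis_zeros_cluster]). *)

Import Order.TTheory GRing.Theory Num.Theory.
Import numFieldNormedType.Exports.
Local Open Scope classical_set_scope.
Local Open Scope ring_scope.
Local Open Scope complex_scope.

Set Implicit Arguments.
Unset Strict Implicit.
Unset Printing Implicit Defensive.

(* One notation for conjugation, whatever the scope it is written in. *)
Local Notation "z ^c" := (conjc z).

Local Notation supp := mpoly.msupp.
Local Notation coef := mpoly.mcoeff.

(** * Coefficients and values of mixed polynomials *)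

Section MixedPolynomials.
Variable R : realType.
Local Notation C := R[i].
Implicit Types (h g : mixed R) (m : mpoly.multinom 4) (u v : C).

Definition mon u v m : C :=
  u ^+ m iu * u^c ^+ m iub * (v ^+ m iv * v^c ^+ m ivb).

Lemma mon_u0 v m : (mexp m).1 != 0%N -> mon 0 v m = 0.
Proof. by rewrite /mon conjc0 -exprD expr0n => /negbTE ->; rewrite mul0r. Qed.

Lemma mon_v0 u m : (mexp m).2 != 0%N -> mon u 0 m = 0.
Proof. by rewrite /mon conjc0 -[X in _ * X]exprD expr0n => /negbTE ->; rewrite mulr0. Qed.

Lemma ord4P (Q : 'I_4 -> Prop) : Q iu -> Q iub -> Q iv -> Q ivb -> forall i, Q i.
Proof.
move=> Qu Qub Qv Qvb i.
have : i \in [:: iu; iub; iv; ivb] by case: i => [[|[|[|[|]]]]].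
by rewrite !inE => /or4P[]/eqP ->.
Qed.

Lemma meqP m m' : [/\ m iu = m' iu, m iub = m' iub, m iv = m' iv &
  m ivb = m' ivb] -> m = m'.
Proof. by case=> ? ? ? ?; apply/mpoly.mnmP; apply: ord4P. Qed.

Lemma mevalXE u v m :
  mixed_eval (mpoly.mpolyX _ m) u v = mon u v m.
Proof. by rewrite /mixed_eval mpoly.mevalX prod_mixed_vars. Qed.

Lemma evE h u v : mixed_eval h u v = \sum_(m <- supp h) coef m h * mon u v m.
Proof. exact: mixed_evalE. Qed.

Lemma evD h g u v : mixed_eval (h + g) u v = mixed_eval h u v + mixed_eval g u v.
Proof. exact: mpoly.mevalD. Qed.
Lemma evB h g u v : mixed_eval (h - g) u v = mixed_eval h u v - mixed_eval g u v.
Proof. exact: mpoly.mevalB. Qed.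
Lemma evM h g u v : mixed_eval (h * g) u v = mixed_eval h u v * mixed_eval g u v.
Proof. exact: mpoly.mevalM. Qed.
Lemma evZ c h u v : mixed_eval (c *: h) u v = c * mixed_eval h u v.
Proof. exact: mpoly.mevalZ. Qed.
Lemma ev0 u v : mixed_eval (0 : mixed R) u v = 0.
Proof. exact: mpoly.meval0. Qed.

Lemma coef_subsum h (S : pred _) m :
  coef m (subsum h S) = if S m then coef m h else 0.
Proof.
rewrite /subsum raddf_sum /=.
under eq_bigr do rewrite mpoly.mcoeffZ mpoly.mcoeffX.
have [mh|mh] := boolP (m \in supp h); last first.
  rewrite (mpoly.memN_msupp_eq0 mh) if_same big1_seq // => m' /andP[_ m'h].
  by case: eqP => [E|]; rewrite ?mulr0 //; rewrite -E m'h in mh.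
case: ifP => Sm; last first.
  apply: big1 => m' Sm'; case: eqP => [E|]; rewrite ?mulr0 //.
  by rewrite -E Sm' in Sm.
have fu : uniq [seq m <- supp h | S m] by rewrite filter_uniq ?mpoly.msupp_uniq.
rewrite -big_filter (bigD1_seq m) /= ?mem_filter ?Sm ?mh //.
rewrite eqxx mulr1 big1 ?addr0 // => m' /negbTE.
by move=> ->; rewrite mulr0.
Qed.

Lemma mem_supp_subsum h (S : pred _) m :
  (m \in supp (subsum h S)) = (m \in supp h) && S m.
Proof.
rewrite !mpoly.mcoeff_msupp coef_subsum andbC.
by case: (S m) => //=; rewrite eqxx.
Qed.

Lemma big_supp_subsum h (S T : pred (mpoly.multinom 4)) (F : mpoly.multinom 4 -> C) :
  \sum_(m <- supp (subsum h S) | T m) coef m (subsum h S) * F m =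
  \sum_(m <- supp h | S m && T m) coef m h * F m.
Proof.
rewrite (perm_big [seq m <- supp h | S m]) /=; last first.
  apply: uniq_perm; rewrite ?filter_uniq ?mpoly.msupp_uniq // => m.
  by rewrite mem_filter mem_supp_subsum andbC.
rewrite big_filter_cond; apply: eq_bigr => m /andP[Sm _].
by rewrite coef_subsum Sm.
Qed.

Lemma ev_subsum h (S : pred _) u v :
  mixed_eval (subsum h S) u v = \sum_(m <- supp h | S m) coef m h * mon u v m.
Proof.
rewrite /subsum /mixed_eval raddf_sum /=; apply: eq_bigr => m _.
by rewrite mpoly.mevalZ -/(mixed_eval _ _ _) mevalXE.
Qed.

(** Substitutions become restrictions of the support, on which faces are computed. *)
Lemma set_u0E h : set_u0 h = subsum h (fun m => (mexp m).1 == 0)%N.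
Proof.
rewrite /set_u0 mpoly.comp_mpolyEX /subsum [RHS]big_mkcond /=.
apply: eq_bigr => m _.
rewrite mpoly.comp_mpolyX prod_mixed_vars /tnth /=.
rewrite addn_eq0 !expr0n; case: (eqVneq (m iu) 0%N) => [m0|]; last first.
  by rewrite !mul0r scaler0.
case: (eqVneq (m iub) 0%N) => [m1|]; last by rewrite mulr0 mul0r scaler0.
rewrite !mul1r /= /mixed_var !mpoly.mpolyXn -mpoly.mpolyXD.
congr (_ *: mpoly.mpolyX _ _); apply: meqP; rewrite m0 m1.
by split; rewrite mpoly.mnmDE !mpoly.mulmnE !mpoly.mnm1E /= ?mul1n ?addn0.
Qed.

Lemma set_v0E h : set_v0 h = subsum h (fun m => (mexp m).2 == 0)%N.
Proof.
rewrite /set_v0 mpoly.comp_mpolyEX /subsum [RHS]big_mkcond /=.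
apply: eq_bigr => m _.
rewrite mpoly.comp_mpolyX prod_mixed_vars /tnth /=.
rewrite addn_eq0 !expr0n; case: (eqVneq (m iv) 0%N) => [m0|]; last first.
  by rewrite mul0r mulr0 scaler0.
case: (eqVneq (m ivb) 0%N) => [m1|]; last by rewrite !mulr0 scaler0.
rewrite !mulr1 /= /mixed_var !mpoly.mpolyXn -mpoly.mpolyXD.
congr (_ *: mpoly.mpolyX _ _); apply: meqP; rewrite m0 m1.
by split; rewrite mpoly.mnmDE !mpoly.mulmnE !mpoly.mnm1E /= ?mul1n ?addn0.
Qed.

Lemma mixed_eval_tuple (t : 4.-tuple (mixed R)) h u v :
  mixed_eval (mpoly.comp_mpoly t h) u v =
  mpoly.meval (fun i => mixed_eval (tnth t i) u v) h.
Proof. exact: mpoly.comp_mpoly_meval. Qed.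

Lemma ev_set_u0 h u v : mixed_eval (set_u0 h) u v = mixed_eval h 0 v.
Proof.
rewrite /set_u0 mixed_eval_tuple; apply: mpoly.meval_eq; apply: ord4P;
  first [exact: ev0 | exact: etrans (ev0 _ _) (esym (conjc0 _))
        | exact: mpoly.mevalXU].
Qed.

Lemma ev_set_v0 h u v : mixed_eval (set_v0 h) u v = mixed_eval h u 0.
Proof.
rewrite /set_v0 mixed_eval_tuple; apply: mpoly.meval_eq; apply: ord4P;
  first [exact: ev0 | exact: etrans (ev0 _ _) (esym (conjc0 _))
        | exact: mpoly.mevalXU].
Qed.

(** Complex conjugation exchanges the exponents of [u, v] with those of
    their conjugates. *)
Definition mswap m : mpoly.multinom 4 :=
  mpoly.Multinom [tuple m iub; m iu; m ivb; m iv].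

Lemma mswapE m : [/\ mswap m iu = m iub, mswap m iub = m iu,
  mswap m iv = m ivb & mswap m ivb = m iv].
Proof. by split; rewrite /mpoly.fun_of_multinom. Qed.

Lemma mswapK : involutive mswap.
Proof.
move=> m; have [a b c d] := mswapE m; have [a' b' c' d'] := mswapE (mswap m).
by apply: meqP; rewrite a' b' c' d'.
Qed.

Lemma mexp_mswap m : mexp (mswap m) = mexp m.
Proof. by rewrite /mexp; have [-> -> -> ->] := mswapE m; rewrite addnC [X in (_, X)]addnC. Qed.

Lemma coef_conj h m : coef m (mixed_conj h) = (coef (mswap m) h)^c.
Proof.
rewrite /mixed_conj mpoly.mcoeff_map_mpoly mpoly.comp_mpolyEX raddf_sum /=.
congr (_^c).
have -> : \sum_(i <- supp h) coef m (coef i h *: mpoly.comp_mpoly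
     [tuple mixed_var R iub; mixed_var R iu; mixed_var R ivb; mixed_var R iv]
     (mpoly.mpolyX _ i)) = \sum_(i <- supp h) coef i h * (mswap m == i)%:R.
  apply: eq_bigr => i _; rewrite mpoly.mcoeffZ; congr (_ * _).
  rewrite mpoly.comp_mpolyX prod_mixed_vars /tnth /= /mixed_var.
  rewrite !mpoly.mpolyXn -!mpoly.mpolyXD mpoly.mcoeffX; congr (_%:R).
  have [a b c d] := mswapE i.
  rewrite (_ : mpoly.mnm_add _ _ = mswap i).
    by rewrite -(inj_eq (inv_inj mswapK)) mswapK eq_sym.
  by apply: meqP; rewrite a b c d; split;
    rewrite !(mpoly.mnmDE, mpoly.mulmnE, mpoly.mnm1E) /= ?mul1n ?addn0.
have [mh|mh] := boolP (mswap m \in supp h); last first.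
  rewrite (mpoly.memN_msupp_eq0 mh) big1_seq // => i /andP[_ ih].
  by case: eqP => [E|]; rewrite ?mulr0 // E ih in mh *.
rewrite (bigD1_seq _ mh) /= ?mpoly.msupp_uniq // eqxx mulr1 big1 ?addr0 //.
by move=> i /negbTE; rewrite eq_sym => ->; rewrite mulr0.
Qed.

Lemma mem_supp_conj h m : (m \in supp (mixed_conj h)) = (mswap m \in supp h).
Proof. by rewrite !mpoly.mcoeff_msupp coef_conj conjc_eq0. Qed.

Lemma mixed_conj_eq0 h : (mixed_conj h == 0) = (h == 0).
Proof.
apply/eqP/eqP => [H|->].
  apply/mpoly.mpolyP => m; apply/eqP; rewrite mpoly.mcoeff0.
  by rewrite -[m]mswapK -conjc_eq0 -coef_conj H mpoly.mcoeff0.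
by apply/mpoly.mpolyP => m; rewrite coef_conj !mpoly.mcoeff0 conjc0.
Qed.

(** ** Singular points *)

Lemma semihol_subsum h S : u_semiholomorphic h -> u_semiholomorphic (subsum h S).
Proof. by move=> hh m; rewrite mem_supp_subsum => /andP[/hh]. Qed.

Lemma supp_deriv i h m : m \in supp (mpoly.mderiv i h) ->
  mpoly.mnm_add m (mpoly.mnm1 i) \in supp h.
Proof.
rewrite !mpoly.mcoeff_msupp mpoly.mcoeff_deriv; apply: contra => /eqP ->.
by rewrite mul0rn.
Qed.

Lemma supp_deriv_char i h m : m \in supp h -> m i != 0%N ->
  exists2 m', m' \in supp (mpoly.mderiv i h) &
              m = mpoly.mnm_add m' (mpoly.mnm1 i).
Proof.
move=> mh mi; exists (mpoly.mnm_sub m (mpoly.mnm1 i)); last first.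
  by rewrite mpoly.submK ?mpoly.lep1mP.
rewrite mpoly.mcoeff_msupp mpoly.mcoeff_deriv mpoly.submK ?mpoly.lep1mP //.
by rewrite -mulr_natr mulf_neq0 ?pnatr_eq0 // -mpoly.mcoeff_msupp.
Qed.

Lemma semihol_deriv i h : u_semiholomorphic h ->
  u_semiholomorphic (mpoly.mderiv i h).
Proof.
move=> hh m /supp_deriv/hh; rewrite mpoly.mnmDE => /eqP.
by rewrite addn_eq0 => /andP[/eqP].
Qed.

Lemma d_ub_semihol h : u_semiholomorphic h -> d_ub h = 0.
Proof.
move=> hh; apply/mpoly.mpolyP => m; apply/eqP; rewrite mpoly.mcoeff0.
apply: contraT; rewrite -mpoly.mcoeff_msupp => /supp_deriv/hh.
by rewrite mpoly.mnmDE mpoly.mnm1E eqxx addn1.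
Qed.

Lemma conjc_mul (z : C) : z * z^c = ((complex.Re z) ^+ 2 + (complex.Im z) ^+ 2)%:C.
Proof. by rewrite -sqr_normc add_Re2_Im2. Qed.

Lemma mul_conj_eq0 (z : C) : (z * z^c == 0) = (z == 0).
Proof. by rewrite mulf_eq0 conjc_eq0 orbb. Qed.

Lemma ev_mul_conj h g u v :
  mixed_eval (h * mixed_conj g) u v = mixed_eval h u v * (mixed_eval g u v)^c.
Proof. exact: etrans (evM _ _ _ _) (congr1 _ (mixed_eval_conj _ _ _)). Qed.

Lemma s2_semihol h : u_semiholomorphic h -> s2 h = d_u h * mixed_conj (d_u h).
Proof. by move=> hh; rewrite /s2 d_ub_semihol // mul0r subr0. Qed.

Lemma s1_semihol h : u_semiholomorphic h -> s1 h = d_u h * mixed_conj (d_vb h).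
Proof.
move=> hh; rewrite /s1 d_ub_semihol //.
have -> : mixed_conj (0 : mixed R) = 0 by apply/eqP; rewrite mixed_conj_eq0.
by rewrite mul0r subr0.
Qed.

Lemma ev_s3 h u v : mixed_eval (s3 h) u v =
  mixed_eval (d_v h) u v * (mixed_eval (d_v h) u v)^c
  - mixed_eval (d_vb h) u v * (mixed_eval (d_vb h) u v)^c.
Proof.
exact: etrans (evB _ _ _ _) (congr2 (fun x y => x - y) (ev_mul_conj _ _ _ _)
  (ev_mul_conj _ _ _ _)).
Qed.

Lemma Im_ev_s3 h u v : complex.Im (mixed_eval (s3 h) u v) = 0.
Proof. by rewrite ev_s3 !conjc_mul -rmorphB. Qed.

(** As [f_ub = 0], the function [s2] is [|f_u| ^ 2], and [f_u] divides [s1]. *)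
Lemma singular_setP h u v : u_semiholomorphic h ->
  singular_set h (u, v) <->
  mixed_eval (d_u h) u v = 0 /\ mixed_eval (s3 h) u v = 0.
Proof.
move=> hh.
have E1 : mixed_eval (s1 h) u v = _ := etrans (congr1 (fun g => mixed_eval g u v)
  (s1_semihol hh)) (ev_mul_conj _ _ _ _).
have E2 : mixed_eval (s2 h) u v = _ := etrans (congr1 (fun g => mixed_eval g u v)
  (s2_semihol hh)) (ev_mul_conj _ _ _ _).
have sqr0 (z w : C) : w = z * z^c -> w = 0 -> z = 0.
  by move=> -> /eqP; rewrite mul_conj_eq0 => /eqP.
have mul0 (z y w : C) : w = z * y -> z = 0 -> w = 0 by move=> -> ->; rewrite mul0r.
split=> [[_ H2 H3]|[H1 H3]]; first by refine (conj (sqr0 _ _ E2 H2) H3).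
by refine (And3 (mul0 _ _ _ E1 H1) (mul0 _ _ _ E2 H1) H3).
Qed.

(** ** Derivatives *)

(** For each of the four variables [x_i], [x_i * d_i] multiplies a monomial by
    its exponent; Euler's identity is a combination of these. *)
Lemma euler i h u v :
  tnth [tuple u; u^c; v; v^c] i * mixed_eval (mpoly.mderiv i h) u v =
  \sum_(m <- supp h) coef m h * (m i)%:R * mon u v m.
Proof.
rewrite {1}[h]mpoly.mpolyE raddf_sum /= /mixed_eval raddf_sum /= mulr_sumr.
apply: eq_bigr => m _; rewrite mpoly.mderivZ mpoly.mderivX !mpoly.mevalZ.
rewrite mulrCA -mulrA; congr (_ * _); rewrite mulrCA.
have [->|mi] := eqVneq (m i) 0%N; first by rewrite !mul0r.
congr (_ * _); rewrite -mevalXE /mixed_eval.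
rewrite -{2}[m](@mpoly.submK _ (mpoly.mnm1 i)) ?mpoly.lep1mP //.
by rewrite mpoly.mpolyXD mpoly.mevalM mpoly.mevalXU mulrC.
Qed.

(** A semiholomorphic polynomial as a polynomial in [u], at fixed [v]. *)
Definition upoly h v : {poly C} := mpoly.mmap polyC
  (tnth [tuple 'X; 0; v%:P; (v^c)%:P]) h.

Lemma horner_upoly h u v : u_semiholomorphic h ->
  (upoly h v).[u] = mixed_eval h u v.
Proof.
move=> hh; rewrite evE /upoly /mpoly.mmap horner_sum; apply: eq_big_seq => m mh.
rewrite /mpoly.mmap1 prod_mixed_vars /tnth /mon /= (hh _ mh) !expr0.
by rewrite !hornerE; ring.
Qed.

Lemma deriv_upoly h v : u_semiholomorphic h -> (upoly h v)^`() = upoly (d_u h) v.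
Proof.
move=> hh.
have -> : d_u h = \sum_(m <- supp h) coef m h *: mpoly.mderiv iu (mpoly.mpolyX _ m).
  rewrite /d_u {1}[h]mpoly.mpolyE raddf_sum; apply: eq_bigr => m _.
  exact: mpoly.mderivZ.
rewrite /upoly !raddf_sum /=; apply: eq_big_seq => m mh.
rewrite mpoly.mderivX scalerA mpoly.mmapZ mpoly.mmapX /mpoly.mmap1.
rewrite !prod_mixed_vars /tnth /= !mpoly.mnmBE !mpoly.mnm1E /= (hh _ mh).
rewrite !subn0 !subn1 !expr0 !mulr1 polyCM polyC_natr.
rewrite derivM derivC mul0r add0r -!polyC_exp -polyCM derivM derivC mulr0 addr0.
by rewrite derivXn -mulr_natr; ring.
Qed.

End MixedPolynomials.

(** * Weighted homogeneous parts *)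

Section Weights.
Variable R : realType.
Local Notation C := R[i].
Implicit Types (h g : mixed R) (m : mpoly.multinom 4) (u v : C) (P Q : nat * nat).

Definition on_face P h m :=
  m \in supp h /\ forall m', m' \in supp h -> (rdeg P m <= rdeg P m')%N.

Lemma mem_supp_face P h m : (m \in supp (weight_face P h)) =
  (m \in supp h) && (rdeg P m == min_rdeg P h).
Proof. exact: mem_supp_subsum. Qed.

Lemma on_faceP P h m : on_face P h m <-> m \in supp (weight_face P h).
Proof.
rewrite mem_supp_face; split=> [[mh Hm]|/andP[mh /eqP E]]; last first.
  by split=> // m' m'h; rewrite E min_rdeg_le.
rewrite mh eqn_leq min_rdeg_le // andbT.
have /(min_rdeg_attained P)[m' m'h <-] : h != 0 by apply: contraTneq mh => ->; rewrite mpoly.msupp0.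
exact: Hm.
Qed.

Lemma on_face_rdeg P h m : on_face P h m -> rdeg P m = min_rdeg P h.
Proof. by move/on_faceP; rewrite mem_supp_face => /andP[_ /eqP]. Qed.

Lemma on_face_eq P h m m' : on_face P h m -> m' \in supp h ->
  rdeg P m' = rdeg P m -> on_face P h m'.
Proof. by move=> [_ H] m'h E; split=> // m''; rewrite E; apply: H. Qed.

Lemma on_face_ex P h : h != 0 -> exists m, on_face P h m.
Proof.
move=> /(min_rdeg_attained P)[m mh E]; exists m; split=> // m' m'h.
by rewrite E min_rdeg_le.
Qed.

Lemma supp_neq0 h m : m \in supp h -> h != 0.
Proof. by apply: contraTneq => ->; rewrite mpoly.msupp0. Qed.

Lemma neq0_supp h : h != 0 -> exists m, m \in supp h.
Proof. by move=> /(on_face_ex (1, 1))[m [mh _]]; exists m. Qed.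

(** Face functions of products and conjugates are read off from a splitting into a
    nonzero homogeneous part and terms of larger degree. *)
Lemma weight_face_uniq P d h h0 h1 : h = h0 + h1 -> h0 != 0 ->
  (forall m, m \in supp h0 -> rdeg P m = d) ->
  (forall m, m \in supp h1 -> (d < rdeg P m)%N) ->
  weight_face P h = h0 /\ min_rdeg P h = d.
Proof.
move=> hE h0N H0 H1.
have dis m : m \in supp h0 -> m \notin supp h1.
  by move=> /H0 E; apply/negP => /H1; rewrite E ltnn.
have sub0 m : m \in supp h0 -> m \in supp h.
  move=> m0; rewrite mpoly.mcoeff_msupp hE mpoly.mcoeffD.
  by rewrite (mpoly.memN_msupp_eq0 (dis _ m0)) addr0 -mpoly.mcoeff_msupp.
have minE : min_rdeg P h = d.
  have [m0 m0h] := neq0_supp h0N.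
  apply/eqP; rewrite eqn_leq -{1}(H0 _ m0h) min_rdeg_le ?sub0 //=.
  have [m mh <-] := min_rdeg_attained P (supp_neq0 (sub0 _ m0h)).
  have := mpoly.msuppD_le (eq_ind _ (fun h => m \in supp h) mh _ hE).
  by rewrite mem_cat => /orP[/H0 ->|/H1/ltnW].
split=> //; apply/mpoly.mpolyP => m; rewrite coef_subsum minE.
case: eqP => Em.
  rewrite hE mpoly.mcoeffD [coef m h1]mpoly.memN_msupp_eq0 ?addr0 //.
  by apply/negP => /H1; rewrite Em ltnn.
by rewrite mpoly.memN_msupp_eq0 //; apply/negP => /H0.
Qed.

Lemma weight_face0 P : weight_face P (0 : mixed R) = 0.
Proof. by rewrite /weight_face /subsum mpoly.msupp0 big_nil. Qed.

Lemma weight_face_neq0 P h : h != 0 -> weight_face P h != 0.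
Proof. by move=> /(on_face_ex P)[m /on_faceP/supp_neq0]. Qed.

Lemma face_split P h : exists2 h1, h = weight_face P h + h1 &
  forall m, m \in supp h1 -> (min_rdeg P h < rdeg P m)%N.
Proof.
exists (subsum h (fun m => rdeg P m != min_rdeg P h)) => [|m].
  apply/mpoly.mpolyP => m; rewrite mpoly.mcoeffD !coef_subsum.
  by case: eqP => _; rewrite ?addr0 ?add0r.
by rewrite mem_supp_subsum ltn_neqAle eq_sym => /andP[/min_rdeg_le -> ->].
Qed.

Lemma rdegD P m m' : rdeg P (mpoly.mnm_add m m') = (rdeg P m + rdeg P m')%N.
Proof. by rewrite /rdeg /mexp /= !mpoly.mnmDE; lia. Qed.

Lemma rdeg_mswap P m : rdeg P (mswap m) = rdeg P m.
Proof. by rewrite /rdeg mexp_mswap. Qed.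

Lemma supp_mulP h g m : m \in supp (h * g) ->
  exists m1 m2, [/\ m1 \in supp h, m2 \in supp g & m = mpoly.mnm_add m1 m2].
Proof. by move=> /mpoly.msuppM_le/allpairsP[[m1 m2] /= [? ? ?]]; exists m1, m2. Qed.

(** There is no cancellation in the lowest part, since polynomials form a domain. *)
Lemma weight_faceM P h g :
  weight_face P (h * g) = weight_face P h * weight_face P g.
Proof.
have [->|h0] := eqVneq h 0; first by rewrite mul0r weight_face0 mul0r.
have [->|g0] := eqVneq g 0; first by rewrite mulr0 weight_face0 mulr0.
have [h1 hE Hh1] := face_split P h; have [g1 gE Hg1] := face_split P g.
have Hf (k : mixed R) m : m \in supp (weight_face P k) -> rdeg P m = min_rdeg P k.
  by rewrite mem_supp_face => /andP[_ /eqP].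
have [] // := @weight_face_uniq P (min_rdeg P h + min_rdeg P g)%N (h * g)
  (weight_face P h * weight_face P g)
  (weight_face P h * g1 + h1 * weight_face P g + h1 * g1).
- transitivity ((weight_face P h + h1) * (weight_face P g + g1)).
    by rewrite -hE -gE.
  move: (weight_face P h) (weight_face P g) h1 g1 {hE gE Hh1 Hg1} => a b c d.
  by rewrite mulrDl !mulrDr !addrA.
- by rewrite mulf_neq0 ?weight_face_neq0.
- by move=> m /supp_mulP[m1 [m2 [/Hf E1 /Hf E2 ->]]]; rewrite rdegD E1 E2.
move=> m /mpoly.msuppD_le; rewrite mem_cat => /orP[/mpoly.msuppD_le|].
  rewrite mem_cat => /orP[] /supp_mulP[m1 [m2 []]].
    by move=> /Hf E1 /Hg1 E2 ->; rewrite rdegD E1 ltn_add2l.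
  by move=> /Hh1 E1 /Hf E2 ->; rewrite rdegD E2 ltn_add2r.
move=> /supp_mulP[m1 [m2 [/Hh1 E1 /Hg1 E2 ->]]].
by rewrite rdegD -addSn leq_add // ltnW.
Qed.

Lemma mixed_conjD h g : mixed_conj (h + g) = mixed_conj h + mixed_conj g.
Proof. by rewrite /mixed_conj mpoly.comp_mpolyD; apply: raddfD. Qed.

Lemma weight_face_conj P h :
  weight_face P (mixed_conj h) = mixed_conj (weight_face P h).
Proof.
have [->|h0] := eqVneq h 0.
  have -> : mixed_conj (0 : mixed R) = 0 by apply/eqP; rewrite mixed_conj_eq0.
  by rewrite weight_face0; apply/esym/eqP; rewrite mixed_conj_eq0.
have [h1 hE Hh1] := face_split P h.
have [] // := @weight_face_uniq P (min_rdeg P h) (mixed_conj h)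
  (mixed_conj (weight_face P h)) (mixed_conj h1).
- by rewrite -mixed_conjD -hE.
- by rewrite mixed_conj_eq0 weight_face_neq0.
- by move=> m; rewrite mem_supp_conj mem_supp_face rdeg_mswap => /andP[_ /eqP].
- by move=> m; rewrite mem_supp_conj => /Hh1; rewrite rdeg_mswap.
Qed.

Lemma set_u0_conj h : set_u0 (mixed_conj h) = mixed_conj (set_u0 h).
Proof.
rewrite !set_u0E; apply/mpoly.mpolyP => m.
rewrite [LHS]coef_subsum [RHS]coef_conj coef_subsum mexp_mswap.
by case: ifP => _; rewrite ?conjc0 // coef_conj.
Qed.

Lemma set_v0_conj h : set_v0 (mixed_conj h) = mixed_conj (set_v0 h).
Proof.
rewrite !set_v0E; apply/mpoly.mpolyP => m.
rewrite [LHS]coef_subsum [RHS]coef_conj coef_subsum mexp_mswap.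
by case: ifP => _; rewrite ?conjc0 // coef_conj.
Qed.

Lemma set_u0M h g : set_u0 (h * g) = set_u0 h * set_u0 g.
Proof. exact: rmorphM. Qed.

Lemma set_v0M h g : set_v0 (h * g) = set_v0 h * set_v0 g.
Proof. exact: rmorphM. Qed.

Lemma face_sqr_eq0 P h g u v : g = h * mixed_conj h ->
  mixed_eval (weight_face P g) u v = 0 -> mixed_eval (weight_face P h) u v = 0.
Proof.
move=> ->; rewrite weight_faceM weight_face_conj ev_mul_conj => /eqP.
by rewrite mul_conj_eq0 => /eqP.
Qed.

(** For a semiholomorphic polynomial the conditions on the faces of [s1] and [s2] reduce to
    the condition on the face of [f_u], whose squared modulus is the face of [s2]. *)
Lemma face_s2_eq0 P h u v : u_semiholomorphic h ->
  mixed_eval (weight_face P (s2 h)) u v = 0 ->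
  mixed_eval (weight_face P (d_u h)) u v = 0.
Proof. by move=> hh; apply/face_sqr_eq0/s2_semihol. Qed.

Lemma face_set_u0_s2_eq0 P h u v : u_semiholomorphic h ->
  mixed_eval (weight_face P (set_u0 (s2 h))) u v = 0 ->
  mixed_eval (weight_face P (set_u0 (d_u h))) u v = 0.
Proof.
move=> hh; apply: face_sqr_eq0; rewrite (s2_semihol hh).
refine (etrans (set_u0M _ _) _).
exact: (congr1 (GRing.mul (set_u0 (d_u h))) (set_u0_conj (d_u h))).
Qed.

Lemma face_set_v0_s2_eq0 P h u v : u_semiholomorphic h ->
  mixed_eval (weight_face P (set_v0 (s2 h))) u v = 0 ->
  mixed_eval (weight_face P (set_v0 (d_u h))) u v = 0.
Proof.
move=> hh; apply: face_sqr_eq0; rewrite (s2_semihol hh).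
refine (etrans (set_v0M _ _) _).
exact: (congr1 (GRing.mul (set_v0 (d_u h))) (set_v0_conj (d_u h))).
Qed.

(** ** Rescaling *)

(** [h (r ^ p1 * u, r ^ p2 * v) / r ^ d(P; h)], a polynomial in [r] whose
    value at [r = 0] is the face function. *)
Definition scal P h (r : R) u v : C :=
  \sum_(m <- supp h)
    coef m h * (r%:C ^+ (rdeg P m - min_rdeg P h) * mon u v m).

Lemma mon_scale P (r : R) u v m :
  mon (r%:C ^+ P.1 * u) (r%:C ^+ P.2 * v) m = r%:C ^+ rdeg P m * mon u v m.
Proof.
have cr p (w : C) : (r%:C ^+ p * w)^c = r%:C ^+ p * w^c.
  by rewrite rmorphM -rmorphXn; congr (_ * _); apply: conjc_real.
rewrite /mon !cr /rdeg /mexp /=.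
rewrite !exprMn -!exprM !mulnDr !exprD.
by do !(move: (_ ^+ _) => ?); ring.
Qed.

Lemma scalE P h r u v :
  mixed_eval h (r%:C ^+ P.1 * u) (r%:C ^+ P.2 * v) =
  r%:C ^+ min_rdeg P h * scal P h r u v.
Proof.
rewrite evE mulr_sumr; apply: eq_big_seq => m mh.
rewrite mon_scale [RHS]mulrCA [X in _ = _ * X]mulrA -exprD subnKC //.
exact: min_rdeg_le.
Qed.

Lemma scal0 P h u v : scal P h 0 u v = mixed_eval (weight_face P h) u v.
Proof.
rewrite ev_subsum [RHS]big_mkcond /=; apply: eq_big_seq => m mh.
rewrite expr0n subn_eq0 eqn_leq min_rdeg_le // andbT.
by case: ifP => _; rewrite ?mul1r // mul0r mulr0.
Qed.

Lemma face_scale P h (r : R) u v :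
  mixed_eval (weight_face P h) (r%:C ^+ P.1 * u) (r%:C ^+ P.2 * v) =
  r%:C ^+ min_rdeg P h * mixed_eval (weight_face P h) u v.
Proof.
rewrite !ev_subsum mulr_sumr; apply: eq_bigr => m /eqP E.
by rewrite mon_scale E mulrCA.
Qed.

(** At a zero of a weighted homogeneous [h] where the [u]-derivative vanishes,
    Euler's identity reads [v * h_v = - v^c * h_vb]; so it is critical. *)
Lemma crit_homog P d h u v : u_semiholomorphic h -> (0 < P.2)%N ->
  (forall m, m \in supp h -> rdeg P m = d) -> v != 0 ->
  mixed_eval h u v = 0 -> mixed_eval (d_u h) u v = 0 ->
  singular_set h (u, v).
Proof.
move=> hh P2 Hd v0 h0 hu0; apply/singular_setP => //; split=> //.
have Eu := euler iu h u v; have Ev := euler iv h u v.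
have Evb := euler ivb h u v.
rewrite /tnth /= in Eu Ev Evb.
rewrite -/(d_v h) in Ev; rewrite -/(d_vb h) in Evb; rewrite -/(d_u h) hu0 mulr0 in Eu.
have E : (P.2%:R : C) * (v * mixed_eval (d_v h) u v + v^c * mixed_eval (d_vb h) u v) = 0.
  have : P.1%:R * 0 + P.2%:R * (v * mixed_eval (d_v h) u v + v^c * mixed_eval (d_vb h) u v)
    = d%:R * mixed_eval h u v.
    rewrite Ev Evb {1}Eu evE [in RHS]mulr_sumr.
    have -> : \sum_(m <- supp h) d%:R * (coef m h * mon u v m) =
        \sum_(m <- supp h) (P.1%:R * (coef m h * (m iu)%:R * mon u v m) +
          P.2%:R * (coef m h * (m iv)%:R * mon u v m + coef m h * (m ivb)%:R * mon u v m)).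
      apply: eq_big_seq => m mh /=; rewrite -(Hd _ mh) /rdeg /mexp /= (hh _ mh) addn0.
      by rewrite natrD !natrM natrD; ring.
    by rewrite big_split /= -!mulr_sumr big_split.
  by rewrite mulr0 add0r h0 mulr0.
move/eqP: E; rewrite mulf_eq0 pnatr_eq0 -[(P.2 == 0)%N]negbK -lt0n P2 /= addr_eq0 => /eqP E.
have {E} E := congr1 (fun z => z * z^c) E.
apply/eqP; rewrite ev_s3 subr_eq0; apply/eqP.
have vv : v * v^c != 0 by rewrite mul_conj_eq0.
apply: (mulfI vv).
move: E; rewrite rmorphN !rmorphM /= conjcK => E.
transitivity (v * mixed_eval (d_v h) u v * (v^c * (mixed_eval (d_v h) u v)^c)).
  by ring.
by rewrite E; ring.
Qed.

(** ** Vertices of the Newton boundary *)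

Definition part h (e : nat * nat) : mixed R := subsum h (fun m => mexp m == e).

(** Comparison of the ratios [Q.1 / Q.2] and [P.1 / P.2] without division. *)
Definition flatter Q P := (Q.1 * P.2 < P.1 * Q.2)%N.

Lemma ev_part0 h e u u' v : e.1 = 0%N ->
  mixed_eval (part h e) u v = mixed_eval (part h e) u' v.
Proof.
move=> e0; rewrite !ev_subsum; apply: eq_bigr => m /eqP E.
congr (_ * _); move: e0; rewrite -E /= => /eqP.
by rewrite addn_eq0 /mon => /andP[/eqP -> /eqP ->].
Qed.

Lemma face_part P h m0 : on_face P h m0 ->
  (forall m, on_face P h m -> mexp m = mexp m0) ->
  weight_face P h = part h (mexp m0).
Proof.
move=> Hm0 Hu; apply/mpoly.mpolyP => m; rewrite !coef_subsum.
have [mh|mh] := boolP (m \in supp h); last first.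
  by rewrite mpoly.memN_msupp_eq0 // !if_same.
congr (if _ then _ else _); apply/eqP/eqP => [E|E].
  by apply: Hu; apply/on_faceP; rewrite mem_supp_face mh E eqxx.
by rewrite -(on_face_rdeg Hm0) /rdeg E.
Qed.

(** Turning a supporting line about its point on the axis [e.1 = 0], so that it gets
    steeper, moves it away from all other points of the support. *)
Lemma face_axis_part Q P h m0 : positive_weight Q -> (0 < P.2)%N ->
  flatter Q P -> on_face Q h m0 -> (mexp m0).1 = 0%N ->
  weight_face P h = part h (mexp m0).
Proof.
rewrite /flatter => /andP[Q1 Q2] P2 QP [m0h Hm0] e0.
have key m : m \in supp h -> (rdeg P m0 <= rdeg P m)%N /\
    (rdeg P m0 = rdeg P m -> mexp m = mexp m0).
  move=> /Hm0; rewrite /rdeg; case: (mexp m0) e0 => a0 b0; case: (mexp m) => a b /= -> H.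
  case: Q Q1 Q2 QP H {Hm0} => q1 q2 /= q1_gt0 q2_gt0; case: P P2 => p1 p2 /= p2_gt0 QP H.
  rewrite muln0 add0n in H; rewrite muln0 add0n.
  have p1_gt0 : (0 < p1)%N by case: (p1) QP; rewrite ?mul0n.
  have [a0E|a_gt0] : a = 0%N \/ (0 < a)%N by lia.
    subst a; rewrite muln0 add0n leq_pmul2l // in H; rewrite muln0 add0n leq_pmul2l //.
    split=> //.
    move=> E; congr (_, _); apply/eqP; rewrite eqn_leq H andbT.
    by move/eqP: E; rewrite eqn_pmul2l // => /eqP ->.
  have : (p2 * b0 < p1 * a + p2 * b)%N by nia.
  by move=> Hlt; split; [exact: ltnW|move=> E'; move: Hlt; rewrite E' ltnn].
have fm0 : on_face P h m0 by split=> // m' /key[].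
apply: face_part => // m [mh Hm]; apply: (key _ mh).2.
by apply/eqP; rewrite eqn_leq (key _ mh).1 Hm.
Qed.

Lemma face_axis_ev0 Q h m0 v : (0 < Q.2)%N -> on_face Q h m0 -> (mexp m0).1 = 0%N ->
  mixed_eval (weight_face Q h) 0 v = mixed_eval (part h (mexp m0)) 0 v.
Proof.
move=> Q2 Hm0 e0; rewrite !ev_subsum !(big_mkcond (fun _ => _ == _)) /=.
apply: eq_big_seq => m mh.
have [E|NE] := eqVneq (mexp m) (mexp m0).
  by rewrite -(on_face_rdeg Hm0) /rdeg E eqxx.
case: eqP => // E; have [a0|a0] := eqVneq (mexp m).1 0%N.
  case/negP: NE; move: E; rewrite -(on_face_rdeg Hm0) /rdeg a0 e0 => /eqP.
  rewrite !muln0 eqn_pmul2l // => /eqP Eb.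
  by rewrite [mexp m]surjective_pairing [mexp m0]surjective_pairing a0 e0 Eb.
by rewrite mon_u0 ?mulr0.
Qed.

(** A monomial free of [u] that survives in the [Q]-face lies on the axis [e.1 = 0], so
    that [face_axis_part] applies. This carries nonvanishing from a weight to steeper ones. *)
Lemma face_axis Q P h v0 : positive_weight Q -> (0 < P.2)%N -> flatter Q P ->
  mixed_eval (weight_face Q h) 0 v0 != 0 ->
  forall u v, mixed_eval (weight_face P h) u v = mixed_eval (weight_face Q h) 0 v.
Proof.
move=> Qpos P2 QP N0 u v; have Q2 : (0 < Q.2)%N by case/andP: Qpos.
suff [m0 Hm0 e0] : exists2 m0, on_face Q h m0 & (mexp m0).1 = 0%N.
  rewrite (face_axis_part Qpos P2 QP Hm0 e0) (face_axis_ev0 _ Q2 Hm0 e0).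
  exact: ev_part0.
apply: contrapT => Hn; case/negP: N0; apply/eqP; rewrite evE big1_seq // => m.
move=> /andP[_ /on_faceP Hm]; have [a0|a0] := eqVneq (mexp m).1 0%N.
  by case: Hn; exists m.
by rewrite mon_u0 ?mulr0.
Qed.

End Weights.

(** * Limits of mixed polynomials *)

Section Limits.
Variable R : realType.
Local Notation C := R[i].
Local Notation Co := (R[i]^o).
Context {T : Type} {F : set_system T} {FF : Filter F}.

Lemma cvg_conj (f : T -> Co) (a : Co) : f @ F --> a -> (fun x => (f x)^c : Co) @ F --> (a^c : Co).
Proof.
move=> /cvgrPdist_lt H; apply/cvgrPdist_lt => e e0.
by near do rewrite -rmorphB normcJ; exact: H.
Unshelve. all: by end_near. Qed.

Lemma cvgC_dist (f : T -> Co) (a : Co) (e : C) : f @ F --> a -> 0 < e ->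
  \forall x \near F, `|(f x : C) - (a : C)| < e.
Proof. by move=> /cvgrPdist_lt H /H; apply: filterS => x; rewrite distrC. Qed.

Lemma distC_cvg (f : T -> Co) (a : Co) :
  (forall e : C, 0 < e -> \forall x \near F, `|(f x : C) - (a : C)| < e) -> f @ F --> a.
Proof.
by move=> H; apply/cvgrPdist_lt => e /H; apply: filterS => x; rewrite distrC.
Qed.

Lemma cvgC_norm_gt (f : T -> Co) (a : Co) (c : C) : f @ F --> a -> c < `|a : C| ->
  \forall x \near F, c < `|f x : C|.
Proof.
move=> H ca; have : 0 < `|a : C| - c by rewrite subr_gt0.
move=> /(cvgC_dist H); apply: filterS => x.
rewrite ltrBrDl -ltrBrDr => /lt_le_trans; apply.
by rewrite lerBlDr distrC -{1}[a : C](subrK (f x : C)) addrC ler_normD.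
Qed.

Lemma cvgC_neq0 (f : T -> Co) (a : Co) : f @ F --> a -> (a : C) != 0 ->
  \forall x \near F, (f x : C) != 0.
Proof.
move=> H a0; have : 0 < `|a : C| by rewrite normr_gt0.
by move=> /(cvgC_norm_gt H); apply: filterS => x; rewrite normr_gt0.
Qed.

Lemma cvg_real_complex (f : T -> R) (a : R) :
  f @ F --> a -> (fun x => (f x)%:C : Co) @ F --> (a%:C : Co).
Proof.
move=> /cvgrPdist_lt H; apply/cvgrPdist_lt => e e0.
have [e' eE e'0] : exists2 e' : R, e = e'%:C & 0 < e'.
  case: e e0 => a1 b1; rewrite ltcE /= => /andP[/eqP -> ?]; by exists a1.
near do rewrite -rmorphB normc_def /= expr0n addr0 sqrtr_sqr eE ltcR.
exact: H.
Unshelve. all: by end_near. Qed.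

Lemma cvg_Re (f : T -> Co) (a : Co) : f @ F --> a ->
  (fun x => complex.Re (f x)) @ F --> complex.Re a.
Proof.
move=> /cvgrPdist_lt H; apply/cvgrPdist_lt => e e0.
have : 0 < (e%:C : Co) by rewrite ltcR.
move=> /H; apply: filterS => x; rewrite -ltcR; apply: le_lt_trans.
by rewrite -[X in X - _]/(complex.Re _); apply: le_trans (normc_ge_Re _); case: (a) (f x) => ? ? [].
Qed.

Lemma cvg_complex (f g : T -> R) (a b : R) : f @ F --> a -> g @ F --> b ->
  (fun x => (f x +i* g x : Co)) @ F --> (a +i* b : Co).
Proof.
move=> Hf Hg; have E (x y : R) : (x +i* y : Co) = x%:C + 'i%C * y%:C.
  by rewrite {1}[x +i* y]complexE.
rewrite E; under eq_fun do rewrite E.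
apply: cvgD; first exact: cvg_real_complex.
by apply: cvgM; [exact: cvg_cst|exact: cvg_real_complex].
Qed.

Lemma cvg_exp (f : T -> Co) (a : Co) n : f @ F --> a ->
  (fun x => f x ^+ n) @ F --> a ^+ n.
Proof.
move=> H; elim: n => [|n IH]; first by under eq_fun do rewrite expr0; exact: cvg_cst.
rewrite exprS (_ : (fun x => f x ^+ n.+1) = (fun x => f x * f x ^+ n)).
  exact: (cvgM H IH).
by apply/funext => x; rewrite exprS.
Qed.

Lemma cvg_big_sum (I : eqType) (s : seq I) (f : I -> T -> Co) (a : I -> Co) :
  (forall i, i \in s -> f i @ F --> a i) ->
  (fun x => \sum_(i <- s) f i x) @ F --> \sum_(i <- s) a i.
Proof.
elim: s => [|i s IH] H.
  by rewrite big_nil; under eq_fun do rewrite big_nil; exact: cvg_cst.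
rewrite big_cons; under eq_fun do rewrite big_cons.
apply: cvgD; first by apply: H; rewrite mem_head.
by apply: IH => j js; apply: H; rewrite inE js orbT.
Qed.

Lemma cvg_mon (u v : T -> Co) (a b : Co) (m : mpoly.multinom 4) :
  u @ F --> a -> v @ F --> b ->
  (fun x => mon (u x) (v x) m : Co) @ F --> (mon a b m : Co).
Proof.
rewrite /mon => Hu Hv.
exact: (cvgM (cvgM (cvg_exp Hu) (cvg_exp (cvg_conj Hu)))
             (cvgM (cvg_exp Hv) (cvg_exp (cvg_conj Hv)))).
Qed.

(** For [r0 = 0] the limit is a value of the face function, by [scal0]. *)
Lemma cvg_scal P (h : mixed R) (r : T -> R) (u v : T -> Co) (r0 : R) (a b : Co) :
  r @ F --> r0 -> u @ F --> a -> v @ F --> b ->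
  (fun x => scal P h (r x) (u x) (v x) : Co) @ F --> (scal P h r0 a b : Co).
Proof.
move=> Hr Hu Hv; apply: (@cvg_big_sum _ _ (fun m x => coef m h *
  ((r x)%:C ^+ (rdeg P m - min_rdeg P h) * mon (u x) (v x) m))) => m _.
exact: (cvgM (cvg_cst (coef m h : Co))
  (cvgM (cvg_exp (cvg_real_complex Hr)) (cvg_mon Hu Hv))).
Qed.

Lemma cvg_ev (h : mixed R) (u v : T -> Co) (a b : Co) :
  u @ F --> a -> v @ F --> b ->
  (fun x => mixed_eval h (u x) (v x) : Co) @ F --> (mixed_eval h a b : Co).
Proof.
move=> Hu Hv; rewrite evE; under eq_fun do rewrite evE.
apply: (@cvg_big_sum _ _ (fun m x => coef m h * mon (u x) (v x) m)) => m _.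
exact: (cvgM (cvg_cst (coef m h : Co)) (cvg_mon Hu Hv)).
Qed.

End Limits.

Section ExpI.
Variable R : realType.
Local Notation Co := (R[i]^o).

Lemma continuous_expi : continuous (@expi R : R -> Co).
Proof.
by move=> t; apply: cvg_complex; [exact: continuous_cos|exact: continuous_sin].
Qed.

Lemma expi_norm (t : R) : expi t * (expi t)^c = 1.
Proof. by rewrite conjc_mul /= cos2Dsin2. Qed.

Lemma expi_neq0 (t : R) : expi t != 0.
Proof. by rewrite -mul_conj_eq0 expi_norm oner_eq0. Qed.

Lemma expiP (z : R[i]) : `|z| = 1 -> exists t, z = expi t.
Proof.
move=> z1; have : z * z^c = 1 by rewrite -sqr_normc z1 expr1n.
case: z {z1} => x y; rewrite conjc_mul /= => -[xy1].
have x1 : -1 <= x <= 1 by nra.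
have xI : x \in `[(-1), 1] by rewrite in_itv.
have sE : sin (acos x) = `|y|.
  rewrite sin_acos // (_ : 1 - x ^+ 2 = y ^+ 2) ?sqrtr_sqr //.
  by rewrite -xy1 addrC addKr.
have [y0|y0] := lerP 0 y.
  by exists (acos x); rewrite /expi sE acosK // ger0_norm.
by exists (- acos x); rewrite /expi sinN cosN sE acosK // ltr0_norm // opprK.
Qed.

End ExpI.

(** * Continuation of simple roots *)

Section RootNear.
Variable R : realType.
Local Notation C := R[i].
Local Notation Co := (R[i]^o).
Implicit Types (p : {poly C}) (w x y e : C).

(** The logarithmic derivative at [w] is the sum of the [1 / (w - z)], each of which is at
    most [1 / e] in modulus. *)
Lemma log_deriv_prod (s : seq C) w e : 0 < e ->
  (forall z, z \in s -> e <= `|w - z|) ->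
  `|(\prod_(z <- s) ('X - z%:P))^`().[w]| * e <=
  (size s)%:R * `|(\prod_(z <- s) ('X - z%:P)).[w]|.
Proof.
move=> e0; elim: s => [|z s IH] H.
  by rewrite big_nil derivC horner0 normr0 !mul0r.
rewrite big_cons; set q := \prod_(j <- s) _ in IH *.
rewrite derivM derivXsubC mul1r hornerD !hornerM !hornerXsubC /=.
have Hz : e <= `|w - z| by apply: H; rewrite mem_head.
have {}IH : `|q^`().[w]| * e <= (size s)%:R * `|q.[w]|.
  by apply: IH => y ys; apply: H; rewrite inE ys orbT.
rewrite [size _]/= -natr1 [leRHS]mulrDl mul1r normrM.
apply: le_trans (_ : (`|q.[w]| + `|w - z| * `|q^`().[w]|) * e <= _).
  by rewrite ler_wpM2r ?(ltW e0) // -normrM ler_normD.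
rewrite mulrDl addrC; apply: lerD; last by rewrite mulrC ler_wpM2r.
by rewrite -mulrA [leRHS]mulrCA ler_wpM2l.
Qed.

(** Contrapositive of [log_deriv_prod]: if no root were within [e] of [w], then
    [|p' (w) / p (w)|] would be at most [n / e]. *)
Lemma root_near p w e n : 0 < e -> (size p <= n)%N ->
  n%:R * `|p.[w]| < e * `|p^`().[w]| -> exists2 x, p.[x] = 0 & `|x - w| < e.
Proof.
move=> e0 pn H.
have p0 : p != 0.
  by apply: contraTneq H => ->; rewrite deriv0 !horner0 normr0 !mulr0 ltxx.
have [s pE] := closed_field_poly_normal p.
apply: contrapT => Hn.
have Hs z : z \in s -> e <= `|w - z|.
  move=> zs; rewrite real_leNgt ?(gtr0_real e0) ?normr_real //.
    apply/negP => zw; apply: Hn; exists z; last by rewrite distrC.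
    by apply/rootP; rewrite pE rootZ ?lead_coef_eq0 // root_prod_XsubC.
have := log_deriv_prod e0 Hs; set q := \prod_(z <- s) _ in pE *.
have lc0 : 0 < `|lead_coef p| by rewrite normr_gt0 lead_coef_eq0.
move=> /(ler_wpM2l (ltW lc0)); rewrite mulrA -normrM mulrCA -normrM.
rewrite -!hornerZ -derivZ -pE => H2.
have : n%:R * `|p.[w]| < n%:R * `|p.[w]|.
  apply: lt_le_trans H _; rewrite mulrC; apply: le_trans H2 _.
  rewrite ler_wpM2r // ler_nat (leq_trans _ pn) //.
  by rewrite {1}pE size_scale ?lead_coef_eq0 // size_prod_XsubC.
by rewrite ltxx.
Qed.

(** The divided difference of [p], written so that it makes sense, and is continuous, at
    coinciding points. *)
Definition divdiff n p x y : C :=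
  \sum_(j < n) p`_j * \sum_(i < j) x ^+ (j.-1 - i) * y ^+ i.

Lemma divdiffE n p x y : (size p <= n)%N -> p.[x] - p.[y] = (x - y) * divdiff n p x y.
Proof.
move=> pn; rewrite !(horner_coef_wide _ pn) -sumrB mulr_sumr.
by apply: eq_bigr => j _; rewrite -mulrBr subrXX mulrCA.
Qed.

Lemma divdiff_deriv n p x : (size p <= n)%N -> divdiff n p x x = p^`().[x].
Proof.
move=> pn; have pE : p = \sum_(j < n) p`_j *: 'X^j.
  by rewrite -(poly_def n); apply/polyP => i; rewrite coef_poly; case: ltnP => // /(leq_trans pn) /(nth_default 0) ->.
rewrite [in RHS]pE raddf_sum horner_sum /divdiff; apply: eq_bigr => j _ /=.
rewrite derivZ derivXn hornerZ hornerMn hornerXn.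
congr (_ * _); rewrite (eq_bigr (fun=> x ^+ j.-1)) => [|i _].
  by rewrite big_const_ord iter_addr_0.
by rewrite -exprD subnK // -ltnS prednK // (leq_ltn_trans _ (ltn_ord i)).
Qed.

Lemma cvg_divdiff (T : Type) (F : set_system T) {FF : Filter F} n
  (p : T -> {poly C}) (p0 : {poly C}) (a b : T -> Co) (a0 b0 : Co) :
  (forall j, (fun t => (p t)`_j : Co) @ F --> (p0`_j : Co)) ->
  a @ F --> a0 -> b @ F --> b0 ->
  (fun t => divdiff n (p t) (a t) (b t) : Co) @ F --> (divdiff n p0 a0 b0 : Co).
Proof.
rewrite /divdiff => Hp Ha Hb.
apply: (cvg_big_sum (f := fun (j : 'I_n) t => (p t)`_j * \sum_(i < j) a t ^+ (j.-1 - i) * b t ^+ i)) => j _.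
refine (cvgM (Hp j) _).
apply: (cvg_big_sum (f := fun (i : 'I_j) t => a t ^+ (j.-1 - i) * b t ^+ i)) => i _.
exact: (cvgM (cvg_exp Ha) (cvg_exp Hb)).
Qed.

Lemma cvg_horner (T : Type) (F : set_system T) {FF : Filter F} n
  (p : T -> {poly C}) (p0 : {poly C}) (a : T -> Co) (a0 : Co) :
  (forall t, size (p t) <= n)%N -> (size p0 <= n)%N ->
  (forall j, (fun t => (p t)`_j : Co) @ F --> (p0`_j : Co)) ->
  a @ F --> a0 -> (fun t => (p t).[a t] : Co) @ F --> (p0.[a0] : Co).
Proof.
move=> Hn H0 Hp Ha; rewrite (horner_coef_wide _ H0).
rewrite (_ : (fun t => _) = fun t => \sum_(j < n) (p t)`_j * a t ^+ j); last first.
  by apply/funext => t; rewrite (horner_coef_wide _ (Hn t)).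
apply: (cvg_big_sum (f := fun (j : 'I_n) t => (p t)`_j * a t ^+ j)) => j _.
exact: (cvgM (Hp j) (cvg_exp Ha)).
Qed.

End RootNear.

Section LocalBranch.
Variables (R : realType) (T : topologicalType) (p : T -> {poly R[i]}) (n : nat).
Local Notation C := R[i].
Local Notation Co := (R[i]^o).
Hypothesis size_p : forall t, (size (p t) <= n)%N.
Hypothesis coef_p : forall j, continuous (fun t => (p t)`_j : Co).

Lemma near_root (s : T) (w e : C) : 0 < e -> (p s).[w] = 0 -> (p s)^`().[w] != 0 ->
  \forall t \near s, exists2 x, (p t).[x] = 0 & `|x - w| < e.
Proof.
move=> e0 r0 d0.
have d1 : 0 < `|(p s)^`().[w]| by rewrite normr_gt0.
have cw : (fun _ : T => w : Co) @ s --> (w : Co) by exact: cvg_cst.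
have Hr := cvg_horner (FF := nbhs_filter s) size_p (size_p s) (fun j => @coef_p j s) cw.
have Hd := cvg_divdiff (FF := nbhs_filter s) (n := n) (fun j => @coef_p j s) cw cw.
rewrite r0 in Hr; rewrite divdiff_deriv // in Hd.
have H1 : \forall t \near s, `|(p t).[w]| < e * (`|(p s)^`().[w]| / 2) / n.+1%:R.
  have := cvgC_dist Hr (e := e * (`|(p s)^`().[w]| / 2) / n.+1%:R).
  rewrite !(divr_gt0, mulr_gt0) ?ltr0n // => /(_ _ isT).
  by apply: filterS => t; rewrite subr0.
have H2 : \forall t \near s, `|(p s)^`().[w]| / 2 < `|divdiff n (p t) w w|.
  by apply: (cvgC_norm_gt Hd); rewrite ltr_pdivrMr // mulr_natr mulr2n ltrDr.
near=> t; apply: (@root_near _ (p t) w e n) => //.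
rewrite -(divdiff_deriv w (size_p t)).
have h1 : `|(p t).[w]| < e * (`|(p s)^`().[w]| / 2) / n.+1%:R by near: t.
have h2 : `|(p s)^`().[w]| / 2 < `|divdiff n (p t) w w| by near: t.
apply: le_lt_trans (_ : n.+1%:R * `|(p t).[w]| < _).
  by rewrite ler_wpM2r // ler_nat.
apply: lt_trans (_ : e * (`|(p s)^`().[w]| / 2) < _).
  by rewrite mulrC -ltr_pdivlMr ?ltr0n.
by rewrite ltr_pM2l.
Unshelve. all: by end_near. Qed.

Lemma small_pos (a b : C) : 0 < a -> 0 < b -> exists c, [/\ 0 < c, c <= a & c <= b].
Proof.
move=> a0 b0; have [ab|/ltW ba] := real_leP (gtr0_real a0) (gtr0_real b0).
  by exists a.
by exists b.
Qed.

(** The implicit function theorem at a simple root [w] of [p s]. Existence of a nearby root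
    is [near_root]; the divided difference does not vanish near [(w, w)], whence
    uniqueness in a ball, and continuity because [near_root] applies with any radius. *)
Lemma local_branch (s : T) (w : C) : (p s).[w] = 0 -> (p s)^`().[w] != 0 ->
  exists (A : set T) (u : T -> Co) (r : C),
  [/\ [/\ open A, A s, u s = w & 0 < r],
      forall t, A t -> (p t).[u t] = 0 /\ {for t, continuous u} &
      forall t x, A t -> `|x - w| < r -> (p t).[x] = 0 -> x = u t].
Proof.
move=> r0 d0.
pose z0 : T * (Co * Co) := (s, (w, w)).
have c1 : fst @ nbhs z0 --> s by exact: cvg_fst.
have c2 : (fun z : T * (Co * Co) => z.2.1) @ nbhs z0 --> (w : Co).
  by apply: (@cvg_comp _ _ _ snd fst) cvg_snd _; exact: cvg_fst.
have c3 : (fun z : T * (Co * Co) => z.2.2) @ nbhs z0 --> (w : Co).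
  by apply: (@cvg_comp _ _ _ snd snd) cvg_snd _; exact: cvg_snd.
have cj j : (fun z : T * (Co * Co) => (p z.1)`_j : Co) @ nbhs z0 --> ((p s)`_j : Co).
  by apply: (@cvg_comp _ _ _ fst (fun t => (p t)`_j : Co)) c1 _; exact: coef_p.
have Hd := cvg_divdiff (FF := nbhs_filter z0) (n := n) cj c2 c3; rewrite divdiff_deriv // in Hd.
have /= := cvgC_neq0 Hd d0.
move=> [[A B] /= [sA [[B1 B2] /= [sB1 sB2] HB]] HAB].
have [r r1 Hr] : exists2 r : C, 0 < r & forall x, `|x - w| < r -> B1 x /\ B2 x.
  have /nbhs_ballP[r /= r1 Hr] : nbhs (w : Co) (B1 `&` B2) by exact: filterI.
  by exists r => // x xw; apply: Hr; rewrite -ball_normE /= distrC.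
have dd t x y : A t -> `|x - w| < r -> `|y - w| < r -> divdiff n (p t) x y != 0.
  by move=> At /Hr[Bx _] /Hr[_ By]; apply: (HAB (t, (x, y))); split=> //; apply: HB.
have uniq t x y : A t -> `|x - w| < r -> `|y - w| < r -> (p t).[x] = 0 ->
    (p t).[y] = 0 -> x = y.
  move=> At xr yr px py; have /eqP := divdiffE x y (size_p t).
  rewrite px py subrr eq_sym mulf_eq0 (negbTE (dd _ _ _ At xr yr)) orbF.
  by rewrite subr_eq0 => /eqP.
have [V [Vo Vs] HV] : exists2 V, open_nbhs s V &
    V `<=` A `&` [set t | exists2 x, (p t).[x] = 0 & `|x - w| < r].
  have : nbhs s (A `&` [set t | exists2 x, (p t).[x] = 0 & `|x - w| < r]).
    by apply: filterI => //; exact: near_root.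
  by rewrite nbhsE => -[V]; exists V.
pose u t : Co := xget 0 [set x | `|x - w| < r /\ (p t).[x] = 0].
have Hu t : V t -> `|u t - w| < r /\ (p t).[u t] = 0.
  by move=> /HV[_ [x px xr]]; rewrite /u; case: xgetP => [y _ []//|/(_ x)[]].
exists V, u, r; split; first split=> //.
- have [usr us] := Hu _ Vs; apply: (@uniq s) => //; first by case: (HV _ Vs).
  by rewrite subrr normr0.
- move=> t1 Vt1; have [At1 _] := HV _ Vt1; have [ur pu] := Hu _ Vt1.
  split; first exact: pu.
  apply: (@distC_cvg _ _ (nbhs t1) _ u (u t1)) => e e0.
  have rd : 0 < r - `|u t1 - w| by rewrite subr_gt0.
  have [c [c0 ce cr]] := small_pos e0 rd.
  have du : (p t1)^`().[u t1] != 0 by rewrite -(divdiff_deriv _ (size_p _)) dd.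
  near=> t.
  have Vt : V t by near: t; exact: open_nbhs_nbhs.
  have [x px xc] : exists2 x, (p t).[x] = 0 & `|x - u t1| < c.
    by near: t; exact: near_root.
  have [urt put] := Hu _ Vt; have [At _] := HV _ Vt.
  suff -> : u t = x by exact: lt_le_trans ce.
  apply: (@uniq t) => //; rewrite -[x](subrK (u t1)) -addrA.
  apply: le_lt_trans (ler_normD _ _) _; rewrite -ltrBrDr.
  exact: lt_le_trans cr.
- by move=> t x Vt xr px; have [urt put] := Hu _ Vt; have [At _] := HV _ Vt; apply: (@uniq t).
Unshelve. all: by end_near. Qed.

End LocalBranch.

Lemma uniq_simple_roots (R : realType) (s : seq R[i]) :
  (forall z, z \in s -> (\prod_(y <- s) ('X - y%:P))^`().[z] != 0) -> uniq s.
Proof.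
elim: s => [//|y s IH] H /=; set q := \prod_(x <- s) ('X - x%:P) in IH *.
have {}H z : z \in y :: s -> q.[z] + (z - y) * q^`().[z] != 0.
  by move/H; rewrite big_cons derivM derivXsubC mul1r hornerD hornerM hornerXsubC.
apply/andP; split.
  have := H y (mem_head _ _); rewrite subrr mul0r addr0.
  by apply: contra => ys; rewrite -/(root q y) root_prod_XsubC.
apply: IH => z zs; have : q.[z] = 0 by apply/rootP; rewrite root_prod_XsubC.
move=> qz; have := H z; rewrite inE zs orbT qz add0r => /(_ isT).
by rewrite mulf_eq0 negb_or => /andP[].
Qed.

Lemma near_all_seq (T : eqType) (U : Type) (F : set_system U) {FF : Filter F}
    (s : seq T) (P : T -> U -> Prop) :
  (forall z, z \in s -> \forall t \near F, P z t) ->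
  \forall t \near F, forall z, z \in s -> P z t.
Proof.
elim: s => [|y s IH] H; first by apply: filterE.
have Hy := H y (mem_head _ _).
have {}IH : \forall t \near F, forall z, z \in s -> P z t.
  by apply: IH => z zs; apply: H; rewrite inE zs orbT.
apply: filterS2 Hy IH => t py ps z; rewrite inE => /predU1P[->//|]; exact: ps.
Qed.

Section GlobalBranch.
Variables (R : realType) (p : R -> {poly R[i]}) (d : nat).
Local Notation C := R[i].
Local Notation Co := (R[i]^o).
Hypothesis size_p : forall t, size (p t) = d.+1.
Hypothesis coef_p : forall j, continuous (fun t => (p t)`_j : Co).
Hypothesis simple_p : forall t w, (p t).[w] = 0 -> (p t)^`().[w] != 0.

Let p_neq0 t : p t != 0. Proof. by rewrite -size_poly_gt0 size_p. Qed.

(** Branches over [[a, b]] are continuous on the whole line, so that they can be glued by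
    adding them. *)
Definition extends (a b : R) := forall w, (p a).[w] = 0 ->
  exists u : R -> Co, [/\ continuous u, u a = w &
    forall t, a <= t <= b -> (p t).[u t] = 0].

Lemma continuous_maxr (c : R) : continuous (fun t : R => Num.max c t).
Proof.
move=> t; apply: (@continuous_max R R (fun=> c) id); first exact: cvg_cst.
exact: cvg_id.
Qed.

Lemma continuous_minr (c : R) : continuous (fun t : R => Num.min c t).
Proof.
move=> t; apply: (@continuous_min R R (fun=> c) id); first exact: cvg_cst.
exact: cvg_id.
Qed.

Lemma extends_trans a b c : a <= b -> b <= c -> extends a b -> extends b c -> extends a c.
Proof.
move=> ab bc Eab Ebc w pw; have [u [cu ua Hu]] := Eab _ pw.
have [|v [cv vb Hv]] := Ebc (u b); first by apply: Hu; rewrite ab lexx.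
exists (fun t => u (Num.min b t) + (v (Num.max b t) - u b)); split.
- move=> t; apply: cvgD; first exact: (continuous_comp (@continuous_minr b t) (cu _)).
  apply: cvgB; last exact: cvg_cst.
  exact: (continuous_comp (@continuous_maxr b t) (cv _)).
- by rewrite min_r // max_l // vb subrr addr0.
- move=> t /andP[at_ tc]; have [tb|bt] := lerP t b.
    by rewrite vb subrr addr0; apply: Hu; rewrite at_ tb.
  by rewrite addrC subrK; apply: Hv; rewrite (ltW bt).
Qed.

(** Near [s], the branches through the [d] roots of [p s] exhaust the roots. *)
Lemma extends_local (s : R) : exists2 e : R, 0 < e &
  forall a b, s - e < a -> a <= b -> b < s + e -> extends a b.
Proof.
have [rs psE] := closed_field_poly_normal (p s).
have lc0 : lead_coef (p s) != 0 by rewrite lead_coef_eq0.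
have rsP z : z \in rs -> (p s).[z] = 0.
  by move=> zs; apply/rootP; rewrite psE rootZ // root_prod_XsubC.
have size_rs : size rs = d.
  by apply: succn_inj; rewrite -(size_p s) psE size_scale // size_prod_XsubC.
have uniq_rs : uniq rs.
  apply: uniq_simple_roots => z zs; have := simple_p (rsP _ zs).
  by rewrite psE derivZ hornerZ mulf_eq0 negb_or => /andP[].
have /boolp.choice[u Hu] : forall z : C, exists u : R -> Co, z \in rs ->
    u s = z /\ \forall t \near s, (p t).[u t] = 0 /\ {for t, continuous u}.
  move=> z; have [zs|] := boolP (z \in rs); last by exists (fun=> 0).
  have le_p t : (size (p t) <= d.+1)%N by rewrite size_p.
  have [A [u [r [[Ao As us _] Hu _]]]] :=
    local_branch le_p coef_p (rsP _ zs) (simple_p (rsP _ zs)).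
  by exists u => _; split=> //; apply: filterS Hu _; exact: open_nbhs_nbhs.
have cu z : z \in rs -> {for s, continuous (u z)}.
  by move=> /Hu[_ /nbhs_singleton[]].
have N1 : \forall t \near s, forall z, z \in rs ->
    (p t).[u z t] = 0 /\ {for t, continuous (u z)}.
  exact: (@near_all_seq _ _ (nbhs s) _ rs (fun z t => (p t).[u z t] = 0 /\
    {for t, continuous (u z)}) (fun z zs => (Hu z zs).2)).
have N2 : \forall t \near s, forall z, z \in rs -> forall y, y \in rs -> z != y ->
    (u z t : C) - u y t != 0.
  apply: (@near_all_seq _ _ (nbhs s) _ rs (fun z t => forall y, y \in rs -> z != y ->
    (u z t : C) - u y t != 0)) => z zs.
  apply: (@near_all_seq _ _ (nbhs s) _ rs (fun y t => z != y ->
    (u z t : C) - u y t != 0)) => y ys.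
  have [->|zy] := eqVneq z y; first exact: filterE.
  have : (u z s : C) - u y s != 0 by rewrite (Hu _ zs).1 (Hu _ ys).1 subr_eq0.
  by move/(cvgC_neq0 (cvgB (cu _ zs) (cu _ ys))); apply: filterS.
have [e /= e0 He] := (nbhs_ballP s _).1 (filterI N1 N2).
exists e => // a b sa ab bs w pw.
have inb t : a <= t <= b -> ball s e t.
  by move=> /andP[at_ tb]; rewrite -ball_normE /= ltr_distlC; apply/andP; split; lra.
have aab : a <= a <= b by rewrite lexx ab.
have [H1 H2] := He _ (inb a aab).
have {pw} /mapP[z zs ->] : w \in [seq (u z a : C) | z <- rs].
  apply/negPn/negP => wn.
  have := @max_poly_roots _ (p a) (w :: [seq (u z a : C) | z <- rs]) (p_neq0 a).
  rewrite /= /root pw eqxx wn /= size_map size_rs size_p ltnn => Hmax.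
  suff : false by []; apply: Hmax.
    by apply/allP => _ /mapP[z zs ->]; rewrite /root (H1 _ zs).1.
  rewrite map_inj_in_uniq // => z y zs ys E; apply/eqP/negPn/negP => zy.
  by have := H2 _ zs _ ys zy; rewrite E subrr eqxx.
(* Composition with the projection onto [[a, b]] makes the local branch global. *)
have clampP t : a <= Num.max a (Num.min b t) <= b.
  by rewrite le_max lexx /= ge_max ab ge_min lexx.
exists (fun t => u z (Num.max a (Num.min b t))); split.
- move=> t; apply: (continuous_comp (f := fun t => Num.max a (Num.min b t))).
    exact: (continuous_comp (@continuous_minr b t) (@continuous_maxr a _)).
  by have [/(_ _ zs)[]] := He _ (inb _ (clampP t)).
- by rewrite min_r // maxxx.
- move=> t tab; rewrite min_r ?max_r; try by case/andP: tab.
  by have [/(_ _ zs)[]] := He _ (inb _ tab).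
Qed.

(** Otherwise the supremum of the points reached from [a] would be passed by [extends_local]. *)
Lemma extends_le a b : a <= b -> extends a b.
Proof.
move=> ab; apply: contrapT => Nab.
have Eaa : extends a a.
  move=> w pw; exists (fun=> w); split=> //; first by move=> t; exact: cvg_cst.
  by move=> t; rewrite -eq_le => /eqP <-.
pose S := [set x | a <= x /\ extends a x].
have Sb x : S x -> x <= b.
  move=> [ax Ex]; rewrite leNgt; apply/negP => bx; apply: Nab => w /Ex[u [cu ua Hu]].
  by exists u; split=> // t /andP[at_ tb]; apply: Hu; rewrite at_ (le_trans tb (ltW bx)).
have Ssup : has_sup S by split; [exists a; split|exists b => x /Sb].
have [e e0 He] := extends_local (sup S).
have [x [ax Ex] xs] := sup_adherent e0 Ssup.
have xle : x <= sup S by apply: ub_le_sup; [exists b => y /Sb|split].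
have : S (sup S + e / 2).
  split; first by lra.
  by apply: extends_trans Ex (He _ _ _ _ _); lra.
by move=> /(ub_le_sup (ex_intro _ b Sb)); lra.
Qed.

(** Branches over [[t0, t0 + n]] are chosen so that each prolongs the preceding one; at [t]
    any of them with [t <= t0 + n] gives the same value. *)
Lemma right_branch t0 w0 : (p t0).[w0] = 0 -> exists u : R -> Co,
  [/\ continuous u, u t0 = w0 & forall t, t0 <= t -> (p t).[u t] = 0].
Proof.
move=> pw0.
pose good (nu : nat * (R -> Co)) := [/\ continuous nu.2, nu.2 t0 = w0 &
  forall t, t0 <= t <= t0 + nu.1%:R -> (p t).[nu.2 t] = 0].
pose next (x y : {nu | good nu}) := (sval y).1 = (sval x).1.+1 /\
  forall t, t <= t0 + (sval x).1%:R -> (sval y).2 t = (sval x).2 t.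
have Hnext x : exists y, next x y.
  case: x => -[n u] /= [cu ut Hu]; have t0n : t0 <= t0 + n%:R by rewrite lerDl.
  have bc : t0 + n%:R <= t0 + n.+1%:R by rewrite lerD2l ler_nat.
  have pb : (p (t0 + n%:R)).[u (t0 + n%:R)] = 0 by apply: Hu; rewrite t0n lexx.
  have [v [cv vb Hv]] := extends_le bc pb.
  pose u' t := u (Num.min (t0 + n%:R) t) + (v (Num.max (t0 + n%:R) t) - u (t0 + n%:R)).
  have u'E t : t <= t0 + n%:R -> u' t = u t.
    by move=> tb; rewrite /u' min_r // max_l // vb subrr addr0.
  have gu' : good (n.+1, u').
    refine (And3 _ (etrans (u'E _ t0n) ut) _).
      move=> t; apply: cvgD; first exact: (continuous_comp (@continuous_minr _ t) (cu _)).
      apply: cvgB; last exact: cvg_cst.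
      exact: (continuous_comp (@continuous_maxr _ t) (cv _)).
    move=> t /andP[at_ tc]; have [tb|bt] := lerP t (t0 + n%:R).
      by rewrite [X in _.[X]](u'E _ tb); apply: Hu; rewrite at_ tb.
    rewrite [X in _.[X]]/= /u' min_l ?max_r ?(ltW bt) // addrC subrK.
    by apply: Hv; rewrite (ltW bt).
  by exists (exist _ _ gu').
have g0 : good (0%N, fun=> w0).
  split=> //=; first by move=> t; exact: cvg_cst.
  by move=> t; rewrite addr0 -eq_le => /eqP <-.
have [f [f0 fS]] := dependent_choice (fun x => cid (Hnext x)) (exist _ _ g0).
have fn n : (sval (f n)).1 = n by elim: n => [|n IH]; rewrite ?f0 // (fS n).1 IH.
have fE k n t : t <= t0 + n%:R -> (sval (f (n + k)%N)).2 t = (sval (f n)).2 t.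
  elim: k => [|k IH] tn; first by rewrite addn0.
  rewrite addnS (fS _).2 ?IH // fn (le_trans tn) // lerD2l ler_nat leq_addr //.
have fE' m n t : t <= t0 + n%:R -> (n <= m)%N -> (sval (f m)).2 t = (sval (f n)).2 t.
  by move=> tn nm; rewrite -(subnKC nm) fE.
pose N t := Num.Def.archi_bound `|t - t0|.
have NP t : t <= t0 + (N t)%:R.
  by rewrite -lerBlDl (le_trans (ler_norm _)) // ltW // archi_boundP.
have fN s t : t <= s -> (sval (f (N s))).2 t = (sval (f (N t))).2 t.
  move=> ts; have [le1|/ltnW le1] := leqP (N t) (N s).
    by rewrite (fE' _ _ _ (NP t) le1).
  by apply/esym/fE' => //; exact: le_trans ts (NP s).
exists (fun t => (sval (f (N t))).2 t); split.
- move=> t; have [cu _ _] := svalP (f (N (t + 1))).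
  rewrite /continuous_at -(fN (t + 1)) ?lerDl //.
  apply: cvg_trans (cu t); apply: near_eq_cvg; near=> x.
  by rewrite fN // ltW //; near: x; apply: lt_nbhsl; rewrite ltrDl.
- by have [] := svalP (f (N t0)).
- move=> t tt; have [_ _] := svalP (f (N t)); apply; rewrite tt /= fn; exact: NP.
Unshelve. all: by end_near. Qed.

End GlobalBranch.

(** A family of polynomials of constant degree without multiple roots is a
    covering of the line, which is simply connected: each root lies on a
    global continuous branch. *)
Lemma global_branch (R : realType) (p : R -> {poly R[i]}) d :
  (forall t, size (p t) = d.+1) ->
  (forall j, continuous (fun t => (p t)`_j : R[i]^o)) ->
  (forall t w, (p t).[w] = 0 -> (p t)^`().[w] != 0) ->
  forall t0 w0, (p t0).[w0] = 0 -> exists u : R -> R[i]^o,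
  [/\ continuous u, u t0 = w0 & forall t, (p t).[u t] = 0].
Proof.
move=> size_p coef_p simple_p t0 w0 pw0.
have [u [cu ut Hu]] := right_branch size_p coef_p simple_p pw0.
pose q t := p (t0 - t).
have coef_q j : continuous (fun t => (q t)`_j : R[i]^o).
  move=> t; apply: (continuous_comp (f := fun t => t0 - t) (g := fun t => (p t)`_j : R[i]^o));
    last exact: coef_p.
  by apply: cvgB; [exact: cvg_cst|exact: cvg_id].
have qw0 : (q 0).[w0] = 0 by rewrite /q subr0.
have [v [cv vt Hv]] :=
  right_branch (fun t => size_p _) coef_q (fun t => simple_p _) qw0.
exists (fun t => u (Num.max t0 t) + (v (Num.max 0 (t0 - t)) - w0)); split.
- move=> t; apply: cvgD; first exact: (continuous_comp (@continuous_maxr _ _ t) (cu _)).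
  apply: cvgB; last exact: cvg_cst.
  apply: (continuous_comp (f := fun t => Num.max 0 (t0 - t))); last exact: cv.
  apply: (continuous_comp (f := fun t => t0 - t)); last exact: continuous_maxr.
  by apply: cvgB; [exact: cvg_cst|exact: cvg_id].
- by rewrite maxxx subrr maxxx ut vt subrr addr0.
- move=> t; have [tt|tt] := lerP t0 t.
    by rewrite (max_l (_ : t0 - t <= 0)) ?subr_le0 // vt subrr addr0 Hu.
  rewrite max_r ?subr_ge0 ?(ltW tt) // ut addrC subrK.
  by have := Hv (t0 - t); rewrite /q subr_ge0 subKr; apply; exact: ltW.
Qed.

(** * Edges and vertices of the Newton boundary *)

Lemma seq_argmax (T : eqType) (s : seq T) (F : T -> rat) x0 : x0 \in s ->
  exists2 x, x \in s & forall y, y \in s -> F y <= F x.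
Proof.
elim: s x0 => [//|a [|b s] IH] x0 _.
  by exists a => [|y]; rewrite inE // => /eqP ->.
have [x xs Hx] := IH b (mem_head _ _).
have [le|/ltW le] := lerP (F x) (F a).
  exists a; rewrite ?mem_head // => y; rewrite inE => /predU1P[->//|/Hx].
  by move/le_trans; apply.
exists x; first by rewrite inE xs orbT.
by move=> y; rewrite inE => /predU1P[->//|/Hx].
Qed.

Definition pdeg (P e : nat * nat) := (P.1 * e.1 + P.2 * e.2)%N.

(** Rotating a supporting line around one of its points [e0] towards the points
    below [e0] until it meets one of them. *)
Lemma rotate (E : seq (nat * nat)) P e0 e1 : positive_weight P ->
  (forall e, e \in E -> (pdeg P e0 <= pdeg P e)%N) -> e1 \in E -> (e1.2 < e0.2)%N ->
  exists Q e2, [/\ positive_weight Q, e2 \in E, (e2.2 < e0.2)%N,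
    pdeg Q e2 = pdeg Q e0 & (forall e, e \in E -> (pdeg Q e0 <= pdeg Q e)%N) /\
    (Q.1 * P.2 <= P.1 * Q.2)%N].
Proof.
case: P e0 => p1 p2 [a0 b0] /andP[/= p1_gt0 p2_gt0] HP e1E e1b.
pose E' := [seq e <- E | (e.2 < b0)%N].
have E'P e : e \in E' -> (e.2 < b0)%N /\ (a0 < e.1)%N.
  rewrite mem_filter => /andP[eb /HP]; case: e eb => a b /=; rewrite /pdeg /= => eb.
  by split=> //; nia.
pose F (e : nat * nat) : rat := (b0 - e.2)%:R / (e.1 - a0)%:R.
have [|[a2 b2] e2E' He2] := @seq_argmax _ E' F e1; first by rewrite mem_filter e1b.
have [/= b2b a2a] := E'P _ e2E'.
have e2E : (a2, b2) \in E by move: e2E'; rewrite mem_filter => /andP[].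
have slope e : e \in E -> (e.2 < b0)%N ->
    ((b0 - e.2) * (a2 - a0) <= (b0 - b2) * (e.1 - a0))%N.
  move=> eE eb; have eE' : e \in E' by rewrite mem_filter eb.
  have [_ ea] := E'P _ eE'; have := He2 _ eE'; rewrite /F.
  rewrite ler_pdivrMr ?ltr0n ?subn_gt0 // mulrAC ler_pdivlMr ?ltr0n ?subn_gt0 //.
  by rewrite -!natrM ler_nat.
have [y yE] : exists y, a2 = (a0 + y)%N by exists (a2 - a0)%N; lia.
have [x xE] : exists x, b0 = (b2 + x)%N by exists (b0 - b2)%N; lia.
have kP : (x * p2 <= p1 * y)%N.
  have := HP _ e2E; rewrite /pdeg /= yE xE !mulnDr (mulnC x); lia.
exists (x, y), (a2, b2); split=> //.
- by rewrite /positive_weight /=; lia.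
- by rewrite /pdeg /= yE xE !mulnDr (mulnC x y); lia.
split=> // -[a b] eE; rewrite /pdeg /=.
have [eb|eb] := ltnP b b0.
  have [/= _ ea] : (b < b0)%N /\ (a0 < a)%N by apply: (E'P (a, b)); rewrite mem_filter eb.
  have /= := slope _ eE eb.
  have -> : (a2 - a0 = y)%N by lia.
  have -> : (b0 - b2 = x)%N by lia.
  have [z ->] : exists z, a = (a0 + z)%N by exists (a - a0)%N; lia.
  have [w ->] : exists w, b0 = (b + w)%N by exists (b0 - b)%N; lia.
  by rewrite !addKn !mulnDr (mulnC w); lia.
have [w wE] : exists w, b = (b0 + w)%N by exists (b - b0)%N; lia.
have [ea|ea] := leqP a0 a.
  by rewrite wE mulnDr leq_add ?leq_mul2l ?ea ?orbT // leq_addr.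
have [z zE] : exists z, a0 = (a + z)%N by exists (a0 - a)%N; lia.
have := HP _ eE; rewrite /pdeg /= wE zE !mulnDr => H.
have H1 : (p1 * z <= p2 * w)%N by lia.
suff : (x * z <= y * w)%N by lia.
rewrite -(leq_pmul2l p2_gt0) -(leq_pmul2l p1_gt0).
have := leq_mul (leqnn (p1 * z)) kP; have := leq_mul (leqnn (p1 * y)) H1; nia.
Qed.

Section Edges.
Variable R : realType.
Implicit Types (h : mixed R) (m : mpoly.multinom 4) (P Q : nat * nat).

Definition edge h Q := exists m m', [/\ on_face Q h m, on_face Q h m' & mexp m <> mexp m'].

Lemma rotate_right P h m0 m1 : positive_weight P -> on_face P h m0 ->
  m1 \in supp h -> ((mexp m1).2 < (mexp m0).2)%N ->
  exists Q m2, [/\ positive_weight Q, on_face Q h m0, on_face Q h m2,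
    ((mexp m2).2 < (mexp m0).2)%N & (Q.1 * P.2 <= P.1 * Q.2)%N].
Proof.
move=> Ppos [m0h Hm0] m1h lt1.
have HE e : e \in [seq mexp m | m <- supp h] -> (pdeg P (mexp m0) <= pdeg P e)%N.
  by move=> /mapP[m mh ->]; exact: Hm0.
have [Q [_ [Qpos /mapP[m2 m2h ->] lt2 eqQ [HQ le]]]] := rotate Ppos HE (map_f _ m1h) lt1.
have f0 : on_face Q h m0 by split=> // m mh; apply/HQ/map_f.
by exists Q, m2; split=> //; exact: on_face_eq f0 m2h eqQ.
Qed.

Definition swap (e : nat * nat) := (e.2, e.1).

Lemma rotate_left P h m0 m1 : positive_weight P -> on_face P h m0 ->
  m1 \in supp h -> ((mexp m1).1 < (mexp m0).1)%N ->
  exists Q m2, [/\ positive_weight Q, on_face Q h m0, on_face Q h m2,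
    ((mexp m2).1 < (mexp m0).1)%N & (P.1 * Q.2 <= Q.1 * P.2)%N].
Proof.
move=> Ppos [m0h Hm0] m1h lt1.
have pdegS Q e : pdeg Q (swap e) = pdeg (swap Q) e by rewrite /pdeg /= addnC.
have posS Q : positive_weight (swap Q) = positive_weight Q by rewrite /positive_weight andbC.
have HE e : e \in [seq swap (mexp m) | m <- supp h] ->
    (pdeg (swap P) (swap (mexp m0)) <= pdeg (swap P) e)%N.
  by move=> /mapP[m mh ->]; rewrite !pdegS; exact: Hm0.
have Ppos' : positive_weight (swap P) by rewrite posS.
have [Q [_ [Qpos /mapP[m2 m2h ->] lt2 eqQ [HQ le]]]] := rotate Ppos' HE (map_f _ m1h) lt1.
have f0 : on_face (swap Q) h m0.
  by split=> // m mh; have := HQ _ (map_f _ mh); rewrite !pdegS.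
exists (swap Q), m2; split=> //; first by rewrite posS.
  by apply: on_face_eq f0 m2h _; move: eqQ; rewrite !pdegS.
by move: le => /=; rewrite mulnC [X in (_ <= X)%N]mulnC.
Qed.

(** The face of a flatter weight lies to the right of, and below, that of a steeper one. *)
Lemma flatter_ge P Q h m m' : (0 < P.2)%N -> flatter P Q -> on_face Q h m' -> on_face P h m ->
  ((mexp m').1 <= (mexp m).1)%N.
Proof.
rewrite /flatter => P2 PQ [m'h Hm'] [mh Hm].
have := Hm' _ mh; have := Hm _ m'h; rewrite /rdeg.
case: (mexp m) => a b; case: (mexp m') => a' b' /=.
case: P PQ P2 {Hm} => p1 p2 /=; case: Q {Hm'} => q1 q2 /= PQ p2_gt0 H1 H2.
rewrite leqNgt; apply/negP => aa.
have [b'b|bb'] := leqP b b'; first by nia.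
have h1 : (p2 * (b - b') <= p1 * (a' - a))%N by nia.
have h2 : (q1 * (a' - a) <= q2 * (b - b'))%N by nia.
have := leq_mul (leqnn q2) h1; have := leq_mul (leqnn p2) h2.
have : (p1 * q2 * (a' - a) < q1 * p2 * (a' - a))%N by rewrite ltn_pmul2r ?subn_gt0.
by nia.
Qed.

Lemma flatter_le P Q h m m' : (0 < P.2)%N -> (0 < Q.1)%N -> flatter P Q ->
  on_face Q h m' -> on_face P h m -> ((mexp m).2 <= (mexp m').2)%N.
Proof.
move=> P2 Q1 PQ fm' fm; have := flatter_ge P2 PQ fm' fm.
case: fm' => m'h Hm'; case: fm => mh Hm.
have := Hm _ m'h; rewrite /rdeg.
case: (mexp m) => a b; case: (mexp m') => a' b' /=.
by case: P P2 {PQ Hm} => p1 p2 /= p2_gt0 H1 H2; nia.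
Qed.

(** An edge that contains a leftmost vertex therefore has the largest ratio among all
    edges, and one that contains a lowest vertex has the smallest. *)
Lemma steeper_face P Q h m0 m : positive_weight P -> positive_weight Q -> flatter Q P ->
  on_face Q h m0 -> (forall m', m' \in supp h -> ((mexp m0).1 <= (mexp m').1)%N) ->
  on_face P h m -> mexp m = mexp m0.
Proof.
move=> /andP[P1 P2] /andP[Q1 Q2] QP f0 H fm.
have a_le := flatter_ge Q2 QP fm f0; have b_le := flatter_le Q2 P1 QP fm f0.
have := H _ (fm.1); case: fm f0 => mh Hm [m0h Hm0].
have := Hm _ m0h; rewrite /rdeg; move: a_le b_le.
case: (mexp m) => a b; case: (mexp m0) => a' b' /= ? ? ? ?.
have -> : a = a' by lia.
by have -> : b = b' by nia.
Qed.

Lemma flatter_face P Q h m0 m : positive_weight P -> positive_weight Q -> flatter P Q ->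
  on_face Q h m0 -> (forall m', m' \in supp h -> ((mexp m0).2 <= (mexp m').2)%N) ->
  on_face P h m -> mexp m = mexp m0.
Proof.
move=> /andP[P1 P2] /andP[Q1 Q2] PQ f0 H fm.
have a_le := flatter_ge P2 PQ f0 fm; have b_le := flatter_le P2 Q1 PQ f0 fm.
have := H _ (fm.1); case: fm f0 => mh Hm [m0h Hm0].
have := Hm _ m0h; rewrite /rdeg; move: a_le b_le.
case: (mexp m) => a b; case: (mexp m0) => a' b' /= ? ? ? ?.
have -> : b = b' by lia.
by have -> : a = a' by nia.
Qed.

Lemma min_seq_nat (T : eqType) (s : seq T) (F : T -> nat) x0 : x0 \in s ->
  exists2 x, x \in s & forall y, y \in s -> (F x <= F y)%N.
Proof.
move=> x0s; have [x xs Hx] := seq_argmax (fun x => - (F x)%:R) x0s.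
by exists x => // y /Hx; rewrite lerN2 ler_nat.
Qed.

Definition vertex_at h P m0 := [/\ positive_weight P, on_face P h m0 &
  forall m, on_face P h m -> mexp m = mexp m0].

(** The endpoints of a face are cut out by nearby weights: the weight below is [Q] multiplied
    by a large number and slightly flattened. *)
Lemma right_endpoint h Q m1 : positive_weight Q -> on_face Q h m1 ->
  exists m2 P, [/\ on_face Q h m2, forall m, on_face Q h m -> ((mexp m).1 <= (mexp m2).1)%N &
    vertex_at h P m2].
Proof.
move=> Qpos f1.
have [m2 m2f Hm2] := min_seq_nat (fun m => (mexp m).2) ((on_faceP _ _ _).1 f1).
have f2 := (on_faceP _ _ _).2 m2f; have [m2h Q2] := f2.
have {}Hm2 m : on_face Q h m -> ((mexp m2).2 <= (mexp m).2)%N.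
  by move=> /on_faceP; apply: Hm2.
have Hrd m : on_face Q h m -> rdeg Q m = rdeg Q m2.
  by move=> fm; rewrite (on_face_rdeg fm) (on_face_rdeg f2).
have /andP[q1 q2] := Qpos.
(* [N] exceeds the second coordinate of [m2], so that a unit of [Q]-degree outweighs it. *)
pose N := ((mexp m2).2).+1; pose P := (N * Q.1, N * Q.2 + 1)%N.
have HP m : m \in supp h -> (rdeg P m2 <= rdeg P m)%N /\
    (rdeg P m <= rdeg P m2 -> mexp m = mexp m2)%N.
  move=> mh; have rP m' : rdeg P m' = (N * rdeg Q m' + (mexp m').2)%N.
    by rewrite /rdeg /=; nia.
  rewrite !rP; have := Q2 _ mh; rewrite leq_eqVlt => /predU1P[E|lt].
    have fm : on_face Q h m by apply: on_face_eq f2 mh _.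
    rewrite E; have := Hm2 _ fm; move: E; rewrite /rdeg.
    case: (mexp m) => a b; case: (mexp m2) => a' b' /= E le_b; split; first by lia.
    move=> ?; have bE : b = b' by lia.
    by rewrite bE in E *; have -> : a = a' by nia.
  have H : (N + N * rdeg Q m2 <= N * rdeg Q m)%N by rewrite -mulnS leq_mul2l lt orbT.
  have Nb : ((mexp m2).2 < N)%N by [].
  by split; [lia|move=> ?; exfalso; lia].
exists m2, P; split=> //.
  move=> m fm; have := Hm2 _ fm; have := Hrd _ fm; rewrite /rdeg.
  by case: (mexp m) => a b; case: (mexp m2) => a' b' /=; nia.
split.
- by rewrite /positive_weight /P /= addn1 muln_gt0 q1.
- by split=> // m /HP[].
- by move=> m [mh Hm]; apply: (HP _ mh).2; exact: Hm.
Qed.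

Lemma left_endpoint h Q m1 : positive_weight Q -> on_face Q h m1 ->
  exists m2 P, [/\ on_face Q h m2, forall m, on_face Q h m -> ((mexp m2).1 <= (mexp m).1)%N &
    vertex_at h P m2].
Proof.
move=> Qpos f1.
have [m2 m2f Hm2] := min_seq_nat (fun m => (mexp m).1) ((on_faceP _ _ _).1 f1).
have f2 := (on_faceP _ _ _).2 m2f; have [m2h Q2] := f2.
have {}Hm2 m : on_face Q h m -> ((mexp m2).1 <= (mexp m).1)%N.
  by move=> /on_faceP; apply: Hm2.
have /andP[q1 q2] := Qpos.
(* [N] exceeds the first coordinate of [m2], so that a unit of [Q]-degree outweighs it. *)
pose N := ((mexp m2).1).+1; pose P := (N * Q.1 + 1, N * Q.2)%N.
have HP m : m \in supp h -> (rdeg P m2 <= rdeg P m)%N /\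
    (rdeg P m <= rdeg P m2 -> mexp m = mexp m2)%N.
  move=> mh; have rP m' : rdeg P m' = (N * rdeg Q m' + (mexp m').1)%N.
    by rewrite /rdeg /=; nia.
  rewrite !rP; have := Q2 _ mh; rewrite leq_eqVlt => /predU1P[E|lt].
    have fm : on_face Q h m by apply: on_face_eq f2 mh _.
    rewrite E; have := Hm2 _ fm; move: E; rewrite /rdeg.
    case: (mexp m) => a b; case: (mexp m2) => a' b' /= E le_b; split; first by lia.
    move=> ?; have aE : a = a' by lia.
    by rewrite aE in E *; have -> : b = b' by nia.
  have H : (N + N * rdeg Q m2 <= N * rdeg Q m)%N by rewrite -mulnS leq_mul2l lt orbT.
  have Nb : ((mexp m2).1 < N)%N by [].
  by split; [lia|move=> ?; exfalso; lia].
exists m2, P; split=> //; split.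
- by rewrite /positive_weight /P /= addn1 muln_gt0 q2.
- by split=> // m /HP[].
- by move=> m [mh Hm]; apply: (HP _ mh).2; exact: Hm.
Qed.

End Edges.

(** * The Newton polyhedron *)

Local Open Scope convex_scope.

Section NewtonPolyhedron.
Variable R : realType.
Local Notation E2 := (R^o * R^o)%type.
Implicit Types (h : mixed R) (m : mpoly.multinom 4) (P Q : nat * nat) (x y : E2) (w : R * R).

Definition lin w x : R := w.1 * x.1 + w.2 * x.2.

Lemma conv_pairE x y (l : {i01 R}) :
  ((x : convex_lmodType E2) <| l |> (y : convex_lmodType E2) : E2) =
  (l%:num * x.1 + (1 - l%:num) * y.1, l%:num * x.2 + (1 - l%:num) * y.2).
Proof. by []. Qed.

Lemma lin_pair w x y (k : R) : lin w (k * x.1 + (1 - k) * y.1, k * x.2 + (1 - k) * y.2) =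
  k * lin w x + (1 - k) * lin w y.
Proof. by rewrite /lin /=; ring. Qed.

Lemma lin_conv w x y (l : {i01 R}) :
  lin w ((x : convex_lmodType E2) <| l |> (y : convex_lmodType E2) : E2) =
  l%:num * lin w x + (1 - l%:num) * lin w y.
Proof. by rewrite conv_pairE /lin /=; ring. Qed.

Lemma newton_polyhedron_sub h (S : set E2) : @convex_set R E2 S ->
  (forall m x, m \in supp h -> (exp_point R m).1 <= x.1 -> (exp_point R m).2 <= x.2 -> S x) ->
  newton_polyhedron h `<=` S.
Proof.
by move=> Sc SG x; apply; split=> // y [m mh [H1 H2]]; exact: SG mh H1 H2.
Qed.

Lemma newton_polyhedron_gen h m x : m \in supp h ->
  (exp_point R m).1 <= x.1 -> (exp_point R m).2 <= x.2 -> newton_polyhedron h x.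
Proof. by move=> mh H1 H2 S [_]; apply; exists m. Qed.

Lemma newton_polyhedron_convex h : @convex_set R E2 (newton_polyhedron h).
Proof.
move=> x y l; rewrite !inE => Hx Hy S [Sc SG].
have := Sc x y l; rewrite !inE; apply; [exact: Hx|exact: Hy].
Qed.

Lemma newton_polyhedron_up h x y : newton_polyhedron h x -> x.1 <= y.1 -> x.2 <= y.2 ->
  newton_polyhedron h y.
Proof.
move=> Hx le1 le2.
have shift (k z t c : R) : k * (z + c) + (1 - k) * (t + c) = k * z + (1 - k) * t + c.
  by ring.
pose S := [set z : E2 | newton_polyhedron h ((z.1 + (y.1 - x.1), z.2 + (y.2 - x.2)) : E2)].
have : S x.
  apply: (@newton_polyhedron_sub h S) Hx => [z t l|m z mh H1 H2].
    rewrite !inE /S /= => Hz Ht; have := @newton_polyhedron_convex h _ _ l (mem_set Hz) (mem_set Ht).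
    by rewrite inE !conv_pairE /= !shift.
  by apply: (newton_polyhedron_gen mh); rewrite ler_wpDr ?subr_ge0.
by rewrite /S /= [x.1 + _]addrC [x.2 + _]addrC !subrK -surjective_pairing.
Qed.

Lemma exp_point_inj m m' : exp_point R m = exp_point R m' -> mexp m = mexp m'.
Proof.
by case=> /eqP + /eqP; rewrite !eqr_nat => /eqP E1 /eqP E2'; rewrite /mexp E1 E2'.
Qed.

Definition weightR P : R * R := (P.1%:R, P.2%:R).

Lemma lin_exp_point P m : lin (weightR P) (exp_point R m) = (rdeg P m)%:R.
Proof. by rewrite /lin /rdeg natrD !natrM. Qed.

Definition supporting_face h w : set E2 :=
  [set x | newton_polyhedron h x /\ forall y, newton_polyhedron h y -> lin w x <= lin w y].

Lemma half_plane_convex w (c : R) : @convex_set R E2 [set x | c <= lin w x].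
Proof.
move=> x y l; rewrite !inE /= => Hx Hy; rewrite lin_conv.
have l0 : 0 <= l%:num by []; have l1 : l%:num <= 1 by [].
by nra.
Qed.

Lemma lin_le w x y : 0 <= w.1 -> 0 <= w.2 -> x.1 <= y.1 -> x.2 <= y.2 -> lin w x <= lin w y.
Proof. by move=> *; rewrite /lin lerD // ler_wpM2l. Qed.

(** A half plane with positive weight that contains the support contains the polyhedron. *)
Lemma supporting_faceP h w m : 0 < w.1 -> 0 < w.2 -> m \in supp h ->
  supporting_face h w (exp_point R m) <->
  forall m', m' \in supp h -> lin w (exp_point R m) <= lin w (exp_point R m').
Proof.
move=> w1 w2 mh; split=> [[_ H] m' m'h|H]; first by apply: H; exact: newton_polyhedron_gen m'h _ _.
split; first exact: newton_polyhedron_gen mh _ _.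
apply: (@newton_polyhedron_sub h [set x | lin w (exp_point R m) <= lin w x]).
  exact: half_plane_convex.
move=> m' x m'h H1 H2; apply: le_trans (H _ m'h) _.
by apply: lin_le => //; exact: ltW.
Qed.

Lemma on_faceE h P m : on_face P h m <-> m \in supp h /\
  forall m', m' \in supp h -> lin (weightR P) (exp_point R m) <= lin (weightR P) (exp_point R m').
Proof.
split=> -[mh H]; split=> // m' /H; by rewrite !lin_exp_point ler_nat.
Qed.

Lemma weightR_gt0 P : positive_weight P -> 0 < (weightR P).1 /\ 0 < (weightR P).2.
Proof. by move=> /andP[? ?]; rewrite !ltr0n. Qed.

Lemma supporting_face_on_face h P m : positive_weight P -> m \in supp h ->
  supporting_face h (weightR P) (exp_point R m) <-> on_face P h m.
Proof.
move=> /weightR_gt0[P1 P2] mh; rewrite supporting_faceP // on_faceE.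
by split=> [H|[]].
Qed.

Lemma line_interpolation (w1 w2 x1 x2 a1 b1 a2 b2 : R) : w2 != 0 -> a2 - a1 != 0 ->
  w1 * x1 + w2 * x2 = w1 * a1 + w2 * b1 -> w1 * a2 + w2 * b2 = w1 * a1 + w2 * b1 ->
  (a2 - x1) / (a2 - a1) * b1 + (1 - (a2 - x1) / (a2 - a1)) * b2 = x2.
Proof.
move=> w20 a0 E1 E2'.
have -> : x2 = b1 + w1 * (a1 - x1) / w2.
  by apply: (mulfI w20); rewrite -(addrK (w1 * x1) (w2 * x2)) [_ + w1 * x1]addrC E1; field.
have -> : b2 = b1 + w1 * (a1 - a2) / w2.
  by apply: (mulfI w20); rewrite -(addrK (w1 * a2) (w2 * b2)) [_ + w1 * a2]addrC E2'; field.
by field; rewrite w20 a0.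
Qed.

(** The points above the supporting line, together with the segment between the extreme
    points [m1], [m2] of the support on it, form a convex set that contains the generators. *)
Lemma supporting_face_segment h w m1 m2 : 0 < w.1 -> 0 < w.2 ->
  m1 \in supp h -> m2 \in supp h ->
  supporting_face h w (exp_point R m1) -> supporting_face h w (exp_point R m2) ->
  (forall m, m \in supp h -> supporting_face h w (exp_point R m) ->
    (exp_point R m1).1 <= (exp_point R m).1 <= (exp_point R m2).1) ->
  supporting_face h w = [set x | lin w x = lin w (exp_point R m1) /\
     (exp_point R m1).1 <= x.1 <= (exp_point R m2).1].
Proof.
move=> w1 w2 m1h m2h F1 F2 Hm; set d := lin w (exp_point R m1).
have dle y : newton_polyhedron h y -> d <= lin w y by exact: F1.2.
have d2 : lin w (exp_point R m2) = d.
  by apply/eqP; rewrite eq_le; apply/andP; split; [exact: F2.2 F1.1|exact: dle F2.1].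
set a1 := (exp_point R m1).1 in Hm *; set a2 := (exp_point R m2).1 in Hm *.
apply/seteqP; split=> [x [Nx Hx]|x [dx /andP[x1 x2]]].
  have dx : lin w x = d by apply/eqP; rewrite eq_le dle // Hx //; exact: F1.1.
  split=> //.
  pose S := [set z : E2 | d < lin w z \/ (lin w z = d /\ a1 <= z.1 <= a2)].
  have : S x.
    apply: (@newton_polyhedron_sub h S) Nx => [z t l|m z mh H1 H2].
      rewrite !inE => Hz Ht.
      suff : S (l%:num * z.1 + (1 - l%:num) * t.1, l%:num * z.2 + (1 - l%:num) * t.2) by [].
      rewrite /S /mkset lin_pair /=.
      have l0 : 0 <= l%:num by []; have l1 : l%:num <= 1 by [].
      have [l00|l00] := eqVneq l%:num 0; first by rewrite l00 subr0 !(mul0r, mul1r, add0r).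
      have [l11|l11] := eqVneq l%:num 1; first by rewrite l11 subrr !(mul0r, mul1r, addr0).
      have {l00}l0 : 0 < l%:num by rewrite lt_neqAle eq_sym l00.
      have {l11}l1 : 0 < 1 - l%:num by rewrite subr_gt0 lt_neqAle l11.
      move: (l%:num) l0 l1 => k k0 k1.
      case: Hz => [Hz|[Hz1 /andP[Hz2 Hz3]]]; case: Ht => [Ht|[Ht1 /andP[Ht2 Ht3]]].
      - by left; nra.
      - by left; rewrite Ht1; nra.
      - by left; rewrite Hz1; nra.
      by right; rewrite Hz1 Ht1; split; [ring|apply/andP; split; nra].
    have dm : d <= lin w (exp_point R m) by apply: dle; exact: newton_polyhedron_gen mh _ _.
    have mz : lin w (exp_point R m) <= lin w z by apply: lin_le => //; exact: ltW.
    have := le_trans dm mz; rewrite le_eqVlt => /predU1P[E|]; last by left.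
    have mE : lin w (exp_point R m) = d by apply/eqP; rewrite eq_le dm E mz.
    right; split=> //; have Fm : supporting_face h w (exp_point R m).
      by split; [exact: newton_polyhedron_gen mh _ _|move=> y /dle; rewrite mE].
    have := Hm _ mh Fm; suff -> : (exp_point R m).1 = z.1 by [].
    move: E mE; rewrite /lin; move: (exp_point R m) H1 H2 => e H1 H2 E mE.
    by apply/eqP; rewrite eq_le H1 /=; nra.
  by case=> [|[_]//]; rewrite dx ltxx.
suff Nx : newton_polyhedron h x by split=> // y /dle; rewrite dx.
have [a12|a12] := eqVneq a1 a2.
  suff -> : x = exp_point R m1 by exact: F1.1.
  have xa : x.1 = a1 by apply/eqP; rewrite eq_le x1 a12 x2.
  rewrite [x]surjective_pairing [exp_point R m1]surjective_pairing -/a1 xa; congr (_, _).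
  move: dx; rewrite /d /lin -/a1 xa => /addrI /mulfI; apply; exact: lt0r_neq0.
have a12' : a1 < a2 by rewrite lt_neqAle a12 (le_trans x1 x2).
have k0 : 0 <= (a2 - x.1) / (a2 - a1) by rewrite divr_ge0 ?subr_ge0 // ltW.
have k1 : (a2 - x.1) / (a2 - a1) <= 1 by rewrite ler_pdivrMr ?subr_gt0 // mul1r lerD2l lerN2.
have := @newton_polyhedron_convex h _ _ (Itv01 k0 k1) (mem_set F1.1) (mem_set F2.1).
rewrite inE conv_pairE /= -/a1 -/a2.
congr (newton_polyhedron h _); rewrite [RHS]surjective_pairing.
have a0 : a2 - a1 != 0 by rewrite subr_eq0 eq_sym.
have E1 : (a2 - x.1) / (a2 - a1) * a1 + (1 - (a2 - x.1) / (a2 - a1)) * a2 = x.1 by field.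
congr (_, _) => //.
exact: (line_interpolation (lt0r_neq0 w2) a0 dx d2).
Qed.

End NewtonPolyhedron.

Section CompactFaces.
Variable R : realType.
Local Notation E2 := (R^o * R^o)%type.
Implicit Types (h : mixed R) (m : mpoly.multinom 4) (P Q : nat * nat) (w : R * R).

Lemma lin_exp w m : lin w (exp_point R m) = w.1 * (mexp m).1%:R + w.2 * (mexp m).2%:R.
Proof. by []. Qed.

Lemma segment_compact_line w (d a1 a2 : R) : w.2 != 0 ->
  compact [set x : E2 | lin w x = d /\ a1 <= x.1 <= a2].
Proof.
move=> w2; pose f (t : R) : E2 := (t, (d - w.1 * t) / w.2).
have -> : [set x : E2 | lin w x = d /\ a1 <= x.1 <= a2] = f @` `[a1, a2].
  apply/seteqP; split=> [x [dx Hx]|_ [t Ht <-]] /=.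
    exists x.1; first by rewrite /= in_itv.
    rewrite [RHS]surjective_pairing /f; congr (_, _); apply: (mulfI w2).
    by rewrite mulrC divfK // -dx /lin addrC addKr.
  split; last by move: Ht; rewrite /= in_itv.
  by rewrite /lin /= [w.2 * _]mulrC divfK // addrC subrK.
apply: continuous_compact; last exact: segment_compact.
apply: continuous_subspaceT => t.
have c2 : (fun t : R => (d - w.1 * t) / w.2) @ t --> (d - w.1 * t) / w.2.
  apply: cvgM; last exact: cvg_cst.
  by apply: cvgB; [exact: cvg_cst|apply: cvgM; [exact: cvg_cst|exact: cvg_id]].
exact: (cvg_pair (f := id) cvg_id c2).
Qed.

Lemma argmin_on_face h P (F : mpoly.multinom 4 -> nat) : h != 0 -> exists2 m,
  on_face P h m & forall m', on_face P h m' -> (F m <= F m')%N.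
Proof.
move=> /(on_face_ex P)[m0 /on_faceP m0f].
have [m mf Hm] := min_seq_nat F m0f.
by exists m => [|m' /on_faceP]; [apply/on_faceP|apply: Hm].
Qed.

Lemma argmax_on_face h P (F : mpoly.multinom 4 -> nat) : h != 0 -> exists2 m,
  on_face P h m & forall m', on_face P h m' -> (F m' <= F m)%N.
Proof.
move=> /(on_face_ex P)[m0 /on_faceP m0f].
have [m mf Hm] := seq_argmax (fun m => (F m)%:R) m0f.
exists m => [|m' /on_faceP/Hm]; [exact/on_faceP|by rewrite ler_nat].
Qed.

Definition face_of h P := supporting_face h (weightR R P).

Lemma exp_point_fst_le m m' : ((exp_point R m).1 <= (exp_point R m').1) = ((mexp m).1 <= (mexp m').1)%N.
Proof. by rewrite /exp_point /= ler_nat. Qed.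

(** The geometric face of a weight, and its points of the support. *)
Lemma face_of_segment h P m1 m2 : positive_weight P -> on_face P h m1 -> on_face P h m2 ->
  (forall m, on_face P h m -> ((mexp m1).1 <= (mexp m).1 <= (mexp m2).1)%N) ->
  face_of h P = [set x | lin (weightR R P) x = lin (weightR R P) (exp_point R m1) /\
     (exp_point R m1).1 <= x.1 <= (exp_point R m2).1].
Proof.
move=> Ppos f1 f2 Hm; have [w1 w2] := weightR_gt0 R Ppos.
apply: supporting_face_segment => //; [exact: f1.1|exact: f2.1| | |].
- exact/(supporting_face_on_face Ppos f1.1).
- exact/(supporting_face_on_face Ppos f2.1).
by move=> m mh /(supporting_face_on_face Ppos mh)/Hm; rewrite !exp_point_fst_le.
Qed.

Lemma compact_face_of h P : h != 0 -> positive_weight P -> compact_face h (face_of h P).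
Proof.
move=> h0 Ppos; have [w1 w2] := weightR_gt0 R Ppos.
have [m1 f1 Hm1] := argmin_on_face P (fun m => (mexp m).1) h0.
have [m2 f2 Hm2] := argmax_on_face P (fun m => (mexp m).1) h0.
have FE : face_of h P = _ := face_of_segment Ppos f1 f2 (fun m fm =>
  introT andP (conj (Hm1 m fm) (Hm2 m fm))).
split.
- exists (exp_point R m1); exact/(supporting_face_on_face Ppos f1.1).
- by rewrite FE; apply: segment_compact_line; rewrite gt_eqF.
exists (weightR R P) => //.
by apply: contraTneq w1 => ->; rewrite ltxx.
Qed.

Lemma set_face_face_of h P : positive_weight P -> set_face h (face_of h P) = weight_face P h.
Proof.
move=> Ppos; apply/mpoly.mpolyP => m; rewrite !coef_subsum.
have [mh|mh] := boolP (m \in supp h); last first.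
  by rewrite mpoly.memN_msupp_eq0 // !if_same.
congr (if _ then _ else _); apply/idP/idP => [|/eqP E].
  rewrite inE => /(supporting_face_on_face Ppos mh)/on_face_rdeg ->; exact: eqxx.
rewrite inE; apply/(supporting_face_on_face Ppos mh)/on_faceP.
by rewrite mem_supp_face mh E eqxx.
Qed.

Lemma one_face_of h Q : positive_weight Q -> edge h Q -> one_face h (face_of h Q).
Proof.
move=> Qpos [m [m' [fm fm' ne]]]; split.
  by apply: compact_face_of => //; exact: supp_neq0 (fm.1).
exists (exp_point R m), (exp_point R m'); split.
- exact/(supporting_face_on_face Qpos fm.1).
- exact/(supporting_face_on_face Qpos fm'.1).
by apply/eqP => /exp_point_inj.
Qed.

Lemma face_of_vertex h P m0 : vertex_at h P m0 -> face_of h P = [set exp_point R m0].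
Proof.
move=> [Ppos f0 Hu]; have [w1 w2] := weightR_gt0 R Ppos.
rewrite (face_of_segment Ppos f0 f0) => [|m /Hu ->]; last by rewrite leqnn.
apply/seteqP; split=> [x [dx xE]|_ ->]; last by split=> //; rewrite lexx.
have x1 : x.1 = (exp_point R m0).1 by apply/eqP; rewrite eq_le andbC.
rewrite /= [x]surjective_pairing [exp_point R m0]surjective_pairing x1; congr (_, _).
by move: dx; rewrite /lin x1 => /addrI/mulfI; apply; rewrite gt_eqF.
Qed.

Lemma set_face_point h m0 : set_face h [set exp_point R m0] = part h (mexp m0).
Proof.
apply/mpoly.mpolyP => m; rewrite !coef_subsum /=; congr (if _ then _ else _).
apply/idP/eqP => [|E]; first by rewrite inE => /exp_point_inj.
by rewrite inE /= /exp_point E.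
Qed.

(** Boundedness of a compact face forces its weights to be positive. *)
Lemma compact_face_pos h F : compact_face h F -> exists2 w, 0 < w.1 /\ 0 < w.2 &
  F = supporting_face h w.
Proof.
case=> -[x Fx] cF [w w0 FE]; exists w => //.
have [M [Mr HM]] : bounded_set F by exact: compact_bounded.
have {}HM y : F y -> `|y| <= M + 1 by apply: HM; rewrite ltrDl.
have M0 : 0 <= M + 1 by exact: le_trans (normr_ge0 x) (HM _ Fx).
have Nx : newton_polyhedron h x by move: Fx; rewrite FE => -[].
have minx y : newton_polyhedron h y -> lin w x <= lin w y by move: Fx; rewrite FE => -[_ H] /H.
have Fup y : newton_polyhedron h y -> lin w y = lin w x -> F y.
  by move=> Ny E; rewrite FE; split=> // z /minx; rewrite -E.
split.
  pose y s : E2 := (x.1 + s, x.2).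
  have Ny s : 0 <= s -> newton_polyhedron h (y s).
    by move=> s0; apply: newton_polyhedron_up Nx _ _; rewrite /= ?lerDl.
  have yE s : lin w (y s) = lin w x + w.1 * s by rewrite /lin /=; ring.
  rewrite lt_neqAle; apply/andP; split; last first.
    by have := minx _ (Ny 1 ler01); rewrite yE mulr1 lerDl.
  apply/eqP => w1; pose s := M + 2 + `|x.1 : R|.
  have s0 : 0 <= s by rewrite /s; have := normr_ge0 (x.1 : R); lra.
  have := HM _ (Fup _ (Ny s s0) _); rewrite yE -w1 mul0r addr0 => /(_ erefl).
  rewrite [`|_|]/(Num.max `|_| `|_|) ge_max => /andP[/= H _].
  have := le_trans (ler_norm _) H; rewrite /s; have := ler_norm (- x.1 : R).
  by rewrite normrN; lra.
pose y s : E2 := (x.1, x.2 + s).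
have Ny s : 0 <= s -> newton_polyhedron h (y s).
  by move=> s0; apply: newton_polyhedron_up Nx _ _; rewrite /= ?lerDl.
have yE s : lin w (y s) = lin w x + w.2 * s by rewrite /lin /=; ring.
rewrite lt_neqAle; apply/andP; split; last first.
  by have := minx _ (Ny 1 ler01); rewrite yE mulr1 lerDl.
apply/eqP => w1; pose s := M + 2 + `|x.2 : R|.
have s0 : 0 <= s by rewrite /s; have := normr_ge0 (x.2 : R); lra.
have := HM _ (Fup _ (Ny s s0) _); rewrite yE -w1 mul0r addr0 => /(_ erefl).
rewrite [`|_|]/(Num.max `|_| `|_|) ge_max => /andP[_ /= H].
have := le_trans (ler_norm _) H; rewrite /s; have := ler_norm (- x.2 : R).
by rewrite normrN; lra.
Qed.

Lemma supporting_face_unique h w m0 : 0 < w.1 -> 0 < w.2 -> m0 \in supp h ->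
  supporting_face h w (exp_point R m0) ->
  (forall m, m \in supp h -> supporting_face h w (exp_point R m) -> mexp m = mexp m0) ->
  supporting_face h w = [set exp_point R m0].
Proof.
move=> w1 w2 m0h F0 Hu.
rewrite (supporting_face_segment w1 w2 m0h m0h F0 F0) => [|m mh Fm]; last first.
  by rewrite /exp_point (Hu _ mh Fm) lexx.
apply/seteqP; split=> [x [dx xE]|_ ->]; last by split=> //; rewrite lexx.
have x1 : x.1 = (exp_point R m0).1 by apply/eqP; rewrite eq_le andbC.
rewrite /= [x]surjective_pairing [exp_point R m0]surjective_pairing x1; congr (_, _).
by move: dx; rewrite /lin x1 => /addrI/mulfI; apply; rewrite gt_eqF.
Qed.

Lemma compact_face_supp h F : h != 0 -> compact_face h F ->
  exists2 m, m \in supp h & F (exp_point R m).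
Proof.
move=> /neq0_supp[m0 m0h] /compact_face_pos[w [w1 w2] ->].
have [m mh Hm] : exists2 m, m \in supp h & forall m', m' \in supp h ->
    lin w (exp_point R m) <= lin w (exp_point R m').
  elim: (supp h) m0 m0h => [//|a [|b s] IH] m0 _.
    by exists a => [|y]; rewrite inE // => /eqP ->.
  have [x xs Hx] := IH b (mem_head _ _).
  have [le|/ltW le] := lerP (lin w (exp_point R a)) (lin w (exp_point R x)).
    exists a; rewrite ?mem_head // => y; rewrite inE => /predU1P[->//|/Hx].
    exact: le_trans.
  exists x; first by rewrite inE xs orbT.
  by move=> y; rewrite inE => /predU1P[->//|/Hx].
by exists m => //; apply/supporting_faceP.
Qed.

(** A face that contained a single point of the support would be that point. *)
Lemma one_face_two h F : h != 0 -> one_face h F -> exists m m',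
  [/\ m \in supp h, m' \in supp h, F (exp_point R m), F (exp_point R m') & mexp m <> mexp m'].
Proof.
move=> h0 [cF [x [y [Fx Fy /eqP xy]]]].
have [m0 m0h F0] := compact_face_supp h0 cF.
apply: contrapT => Hn.
have [w [w1 w2] FE] := compact_face_pos cF; rewrite FE in Fx Fy F0 Hn.
have Fu := supporting_face_unique w1 w2 m0h F0; rewrite Fu in Fx Fy.
  by apply: xy; rewrite Fx Fy.
move=> m mh Fm; apply: contrapT => ne; apply: Hn.
by exists m, m0.
Qed.

(** The real weight of the face is proportional to the integral one that is orthogonal to
    the difference of two exponents on the face. *)
Lemma one_face_edge h F : h != 0 -> one_face h F -> exists2 Q, positive_weight Q & edge h Q.
Proof.
move=> h0 oF; have [m [m' [mh m'h]]] := one_face_two h0 oF.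
have [w [w1 w2] ->] := compact_face_pos oF.1.
move=> /(supporting_faceP w1 w2 mh) H /(supporting_faceP w1 w2 m'h) H' ne.
wlog lt : m m' mh m'h H H' ne / ((mexp m).1 < (mexp m').1)%N.
  move=> W; case: (ltngtP (mexp m).1 (mexp m').1) => [lt|lt|E].
  - exact: (W m m').
  - by apply: (W m' m) => //; exact: nesym.
  case: ne; have : lin w (exp_point R m) = lin w (exp_point R m').
    by apply/eqP; rewrite eq_le H ?H'.
  rewrite !lin_exp E => /addrI/mulfI; rewrite (gt_eqF w2) => /(_ isT)/eqP.
  rewrite eqr_nat => /eqP E'.
  by rewrite [mexp m]surjective_pairing [mexp m']surjective_pairing E E'.
have eqw : lin w (exp_point R m) = lin w (exp_point R m').
  by apply/eqP; rewrite eq_le H ?H'.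
rewrite !lin_exp in eqw.
have lt2 : ((mexp m').2 < (mexp m).2)%N.
  by rewrite -(ltr_nat R); move: lt; rewrite -(ltr_nat R); nra.
pose Q := ((mexp m).2 - (mexp m').2, (mexp m').1 - (mexp m).1)%N.
have Qpos : positive_weight Q by rewrite /positive_weight /= !subn_gt0 lt2 lt.
have QE m1 : (rdeg Q m1)%:R = ((mexp m).2%:R - (mexp m').2%:R) * (mexp m1).1%:R +
    ((mexp m').1%:R - (mexp m).1%:R) * (mexp m1).2%:R :> R.
  by rewrite /rdeg natrD !natrM !natrB // ltnW.
have fm : on_face Q h m.
  split=> // m1 m1h; have := H _ m1h; rewrite !lin_exp -(ler_nat R) !QE.
  move: lt lt2; rewrite -!(ltr_nat R) => lt lt2 Hm1.
  rewrite -(ler_pM2l w2); move: eqw Hm1 lt lt2 w1 w2.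
  move: (mexp m).1%:R (mexp m).2%:R (mexp m').1%:R (mexp m').2%:R => a b a' b'.
  move: (mexp m1).1%:R (mexp m1).2%:R w.1 w.2 => p q x y E1 E2' l1 l2 x0 y0.
  have E3 : y * (b - b') = x * (a' - a) by lra.
  rewrite !mulrDr !mulrA E3 ![y * _]mulrC.
  have : 0 <= (a' - a) * (x * p + y * q - (x * a + y * b)) by rewrite mulr_ge0 //; lra.
  by lra.
exists Q => //; exists m, m'; split=> //; apply: on_face_eq fm m'h _.
apply/eqP; rewrite -(eqr_nat R) !QE; apply/eqP; ring.
Qed.

End CompactFaces.

(** * Inner non-degeneracy *)

Section Reduce.
Variable R : realType.
Implicit Types (h : mixed R) (m : mpoly.multinom 4) (P Q : nat * nat).

Lemma weight_face_ext P Q h : (forall m, on_face P h m <-> on_face Q h m) ->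
  weight_face P h = weight_face Q h.
Proof.
move=> H; apply/mpoly.mpolyP => m; rewrite !coef_subsum.
have [mh|mh] := boolP (m \in supp h); last first.
  by rewrite mpoly.memN_msupp_eq0 // !if_same.
have E S : (rdeg S m == min_rdeg S h) = (m \in supp (weight_face S h)).
  by rewrite mem_supp_face mh.
rewrite !E; congr (if _ then _ else _).
by apply/idP/idP => /on_faceP/H/on_faceP.
Qed.

(** The weights attached to the 1-faces have coprime entries, whereas the weights constructed
    by rotation need not have. *)
Definition reduce Q := (Q.1 %/ gcdn Q.1 Q.2, Q.2 %/ gcdn Q.1 Q.2)%N.

Section ReduceLemmas.
Variable Q : nat * nat.
Hypothesis Qpos : positive_weight Q.

Let d_gt0 : (0 < gcdn Q.1 Q.2)%N.
Proof. by rewrite gcdn_gt0; case/andP: Qpos => ->. Qed.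
Let red1 : Q.1 = ((reduce Q).1 * gcdn Q.1 Q.2)%N.
Proof. by rewrite divnK ?dvdn_gcdl. Qed.
Let red2 : Q.2 = ((reduce Q).2 * gcdn Q.1 Q.2)%N.
Proof. by rewrite divnK ?dvdn_gcdr. Qed.

Lemma reduce_pos : positive_weight (reduce Q).
Proof.
case/andP: Qpos => q1 q2; rewrite /positive_weight !divn_gt0 //.
by rewrite (dvdn_leq q1 (dvdn_gcdl _ _)) (dvdn_leq q2 (dvdn_gcdr _ _)).
Qed.

Lemma reduce_coprime : coprime (reduce Q).1 (reduce Q).2.
Proof.
have gen a b d : (0 < d)%N -> gcdn (a * d) (b * d) = d -> coprime a b.
  by move=> d0 /eqP; rewrite -muln_gcdl -[X in _ == X]mul1n eqn_pmul2r.
exact: gen d_gt0 (congr2 gcdn (esym red1) (esym red2)).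
Qed.

Lemma on_face_reduce h m : on_face (reduce Q) h m <-> on_face Q h m.
Proof.
have E m' : rdeg Q m' = (rdeg (reduce Q) m' * gcdn Q.1 Q.2)%N.
  move: (reduce Q) red1 red2 => q E1 E2'.
  by rewrite /rdeg [in RHS]mulnDl; congr (_ + _)%N; rewrite [RHS]mulnAC -?E1 -?E2'.
by split=> -[mh H]; split=> // m' /H; rewrite !E leq_pmul2r.
Qed.

Lemma weight_face_reduce h : weight_face (reduce Q) h = weight_face Q h.
Proof. by apply: weight_face_ext => m; exact: on_face_reduce. Qed.

Lemma newton_weight_reduce h : edge h Q -> newton_weight h (reduce Q).
Proof.
move=> eQ; left; split; [exact: reduce_pos|exact: reduce_coprime|].
exists (face_of h Q); first exact: one_face_of.
by rewrite weight_face_reduce set_face_face_of.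
Qed.

End ReduceLemmas.

Lemma newton_weight_edge h Q : h != 0 -> newton_weight h Q -> (exists F, one_face h F) ->
  positive_weight Q /\ edge h Q.
Proof.
move=> h0 [[Qpos _ [F oF E]]|[Hn _]] Hex //; split=> //.
have [m [m' [mh m'h Fm Fm' ne]]] := one_face_two h0 oF.
exists m, m'; split=> //; apply/on_faceP; rewrite E mem_supp_subsum ?mh ?m'h /=;
  exact/mem_set.
Qed.

Lemma ratio_le P Q : positive_weight P -> positive_weight Q ->
  (Defs.ratio P <= Defs.ratio Q) = ~~ flatter Q P.
Proof.
move=> /andP[_ P2] /andP[_ Q2].
rewrite /Defs.ratio ler_pdivrMr ?ltr0n // mulrAC ler_pdivlMr ?ltr0n // -!natrM ler_nat.
by rewrite /flatter -leqNgt.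
Qed.

Lemma edge_boundary h Q : positive_weight Q -> edge h Q ->
  ~ exists x, newton_boundary h = [set x].
Proof.
move=> Qpos eQ [x Hx]; have [cF [y [z [Fy Fz /eqP]]]] := one_face_of Qpos eQ; apply.
have Hsub t : face_of h Q t -> t = x.
  move=> Ft; have : newton_boundary h t by exists (face_of h Q).
  by rewrite Hx.
by rewrite (Hsub _ Fy) (Hsub _ Fz).
Qed.

(** The support has a componentwise smallest exponent, so the Newton boundary is a point. *)
Definition corner h m0 := m0 \in supp h /\ forall m, m \in supp h ->
  ((mexp m0).1 <= (mexp m).1)%N /\ ((mexp m0).2 <= (mexp m).2)%N.

Lemma corner_vertex h m0 P : positive_weight P -> corner h m0 -> vertex_at h P m0.
Proof.
move=> Ppos [m0h H]; have f0 : on_face P h m0.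
  by split=> // m /H[H1 H2]; rewrite /rdeg leq_add ?leq_mul2l ?H1 ?H2 ?orbT.
split=> // m fm; have := on_face_rdeg fm; rewrite -(on_face_rdeg f0) /rdeg.
have [] := H _ fm.1; case/andP: Ppos.
by case: (mexp m) => a b; case: (mexp m0) => a0 b0 /= *; congr (_, _); nia.
Qed.

Lemma corner_boundary h m0 : corner h m0 -> newton_boundary h = [set exp_point R m0].
Proof.
move=> Hc; have [m0h H] := Hc; have h0 := supp_neq0 m0h.
apply/seteqP; split=> [x [F cF]|_ ->]; last first.
  exists (face_of h (1, 1)%N); first exact: compact_face_of.
  by rewrite (face_of_vertex (corner_vertex _ Hc)).
have [w [w1 w2] ->] := compact_face_pos cF.
have m0le m : m \in supp h -> lin w (exp_point R m0) <= lin w (exp_point R m).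
  by move=> /H[H1 H2]; rewrite !lin_exp lerD // ler_wpM2l ?ler_nat // ltW.
rewrite (supporting_face_unique w1 w2 m0h) //; first by apply/supporting_faceP.
move=> m mh /(supporting_faceP w1 w2 mh)/(_ _ m0h); rewrite !lin_exp.
have [H1 H2] := H _ mh; move: H1 H2; rewrite -!(ler_nat R) => H1 H2 H3.
have /eqP : (mexp m).1%:R = (mexp m0).1%:R :> R by apply/eqP; rewrite eq_le H1 andbT; nra.
have /eqP : (mexp m).2%:R = (mexp m0).2%:R :> R by apply/eqP; rewrite eq_le H2 andbT; nra.
rewrite !eqr_nat => /eqP E2' /eqP E1.
by rewrite [mexp m]surjective_pairing [mexp m0]surjective_pairing E1 E2'.
Qed.

Lemma no_critical_zeroP h (D : set (R[i]^o * R[i]^o)) u v : no_critical_zero h D -> D (u, v) ->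
  mixed_eval h u v = 0 -> ~ singular_set h (u, v).
Proof.
move=> Hn Dz h0 Hs; have : (singular_set h `&` (zero_set h `&` D)) (u, v) by [].
by rewrite Hn.
Qed.

Lemma crit_face P h u v : u_semiholomorphic h -> (0 < P.2)%N -> v != 0 ->
  mixed_eval (weight_face P h) u v = 0 ->
  mixed_eval (d_u (weight_face P h)) u v = 0 ->
  singular_set (weight_face P h) (u, v).
Proof.
move=> hh P2 v0; apply: (@crit_homog _ P (min_rdeg P h)) => //.
  exact: semihol_subsum.
by move=> m; rewrite mem_supp_face => /andP[_ /eqP].
Qed.

End Reduce.

Section Coefficients.
Variable R : realType.
Implicit Types (h : mixed R) (m : mpoly.multinom 4) (u v : R[i]).

Definition vmon v m : R[i] := v ^+ m iv * v^c ^+ m ivb.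

Lemma coef_upoly h v j : u_semiholomorphic h ->
  (upoly h v)`_j = \sum_(m <- supp h | m iu == j) coef m h * vmon v m.
Proof.
move=> hh; rewrite /upoly /mpoly.mmap coef_sum [RHS]big_mkcond; apply: eq_big_seq => m mh.
rewrite /mpoly.mmap1 prod_mixed_vars /tnth /= (hh _ mh) expr0 mulr1.
rewrite -!polyC_exp -polyCM coefCM coefMC coefXn eq_sym /vmon.
by case: eqP => _; rewrite ?mul1r // mul0r mulr0.
Qed.

Lemma ev_du_u0 h v : u_semiholomorphic h ->
  mixed_eval (d_u h) 0 v = \sum_(m <- supp h | m iu == 1%N) coef m h * vmon v m.
Proof.
move=> hh; rewrite -(horner_upoly _ _ (semihol_deriv hh)) -deriv_upoly //.
by rewrite horner_coef0 coef_deriv mulr1n coef_upoly.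
Qed.

(** The exponents of [u ^ a * v] and [u ^ a * v^c], the only monomials of degree one in [v]
    and [v^c] together. *)
Definition mv (a : nat) : mpoly.multinom 4 := mpoly.Multinom [tuple a; 0; 1; 0]%N.
Definition mvb (a : nat) : mpoly.multinom 4 := mpoly.Multinom [tuple a; 0; 0; 1]%N.

Lemma mvE a : [/\ mv a iu = a, mv a iub = 0%N, mv a iv = 1%N & mv a ivb = 0%N].
Proof. by split; rewrite /mpoly.fun_of_multinom. Qed.
Lemma mvbE a : [/\ mvb a iu = a, mvb a iub = 0%N, mvb a iv = 0%N & mvb a ivb = 1%N].
Proof. by split; rewrite /mpoly.fun_of_multinom. Qed.

Lemma mexp_mv a : mexp (mv a) = (a, 1%N).
Proof. by have [E1 E2 E3 E4] := mvE a; rewrite /mexp E1 E2 E3 E4 addn0. Qed.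
Lemma mexp_mvb a : mexp (mvb a) = (a, 1%N).
Proof. by have [E1 E2 E3 E4] := mvbE a; rewrite /mexp E1 E2 E3 E4 addn0. Qed.

Lemma mexp1 h m : u_semiholomorphic h -> m \in supp h -> (mexp m).2 = 1%N ->
  m = mv (mexp m).1 \/ m = mvb (mexp m).1.
Proof.
move=> hh mh E; have m0 := hh _ mh.
case Ei : (m iv) => [|k]; [right|left]; apply: meqP.
  have [-> -> -> ->] := mvbE (mexp m).1; rewrite /mexp /= m0 addn0; split=> //.
  by move: E; rewrite /mexp /= Ei.
have [-> -> -> ->] := mvE (mexp m).1; rewrite /mexp /= m0 addn0.
by move: E; rewrite /mexp /= Ei => -[/eqP]; rewrite addn_eq0 => /andP[/eqP -> /eqP ->].
Qed.

Lemma ev_part1 h a u v : u_semiholomorphic h ->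
  mixed_eval (part h (a, 1%N)) u v =
  u ^+ a * (coef (mv a) h * v + coef (mvb a) h * v^c).
Proof.
move=> hh; have -> : part h (a, 1%N) = coef (mv a) h *: mpoly.mpolyX _ (mv a) +
    coef (mvb a) h *: mpoly.mpolyX _ (mvb a).
  apply/mpoly.mpolyP => m; rewrite [LHS]coef_subsum mpoly.mcoeffD !mpoly.mcoeffZ !mpoly.mcoeffX.
  have nmv : mv a != mvb a.
    apply/eqP => /(congr1 (fun m : mpoly.multinom 4 => m iv)).
    by have [_ _ -> _] := mvE a; have [_ _ -> _] := mvbE a.
  have [<-|n1] := eqVneq (mv a) m.
    by rewrite mexp_mv eqxx eq_sym (negbTE nmv) mulr1 mulr0 addr0.
  have [<-|n2] := eqVneq (mvb a) m.
    by rewrite mexp_mvb eqxx mulr0 mulr1 add0r.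
  rewrite !mulr0 addr0; case: eqP => // E.
  apply: mpoly.memN_msupp_eq0; apply/negP => mh.
  have := mexp1 hh mh; rewrite E => /(_ erefl)[] mE.
    by rewrite mE eqxx in n1.
  by rewrite mE eqxx in n2.
rewrite evD !evZ !mevalXE /mon.
have [-> -> -> ->] := mvE a; have [-> -> -> ->] := mvbE a.
by rewrite !expr0 !expr1; ring.
Qed.

(** On the axis [v = 0] only the monomials of degree one in [v] contribute to
    the derivatives in [v]. *)
Lemma ev_dv_v0 h u : u_semiholomorphic h ->
  mixed_eval (d_v h) u 0 = \sum_(m <- supp h | m == mv (m iu)) coef m h * u ^+ m iu.
Proof.
move=> hh.
have -> : d_v h = \sum_(m <- supp h) coef m h *: mpoly.mderiv iv (mpoly.mpolyX _ m).
  rewrite /d_v {1}[h]mpoly.mpolyE raddf_sum; apply: eq_bigr => m _.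
  exact: mpoly.mderivZ.
rewrite /mixed_eval raddf_sum [RHS]big_mkcond; apply: eq_big_seq => m mh /=.
rewrite mpoly.mevalZ mpoly.mderivX mpoly.mevalZ -/(mixed_eval _ u 0) mevalXE.
rewrite /mon conjc0 -(exprD (0 : R[i])) !mpoly.mnmBE !mpoly.mnm1E /=.
rewrite !subn0 (hh _ mh) expr0 mulr1.
case: eqP => [E|NE].
  have [_ _ E3 E4] := mvE (m iu); rewrite -E in E3 E4.
  by rewrite E3 E4 subnn expr0 mulr1 mul1r.
have [E3|N3] := eqVneq (m iv) 0%N; first by rewrite E3 mul0r mulr0.
have /negbTE NZ : (m iv - 1 + m ivb != 0)%N.
  apply/negP => E; case: NE; apply: meqP.
  by have [-> -> -> ->] := mvE (m iu); rewrite (hh _ mh); split=> //; lia.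
by rewrite expr0n NZ !mulr0.
Qed.

Lemma ev_dvb_v0 h u : u_semiholomorphic h ->
  mixed_eval (d_vb h) u 0 = \sum_(m <- supp h | m == mvb (m iu)) coef m h * u ^+ m iu.
Proof.
move=> hh.
have -> : d_vb h = \sum_(m <- supp h) coef m h *: mpoly.mderiv ivb (mpoly.mpolyX _ m).
  rewrite /d_vb {1}[h]mpoly.mpolyE raddf_sum; apply: eq_bigr => m _.
  exact: mpoly.mderivZ.
rewrite /mixed_eval raddf_sum [RHS]big_mkcond; apply: eq_big_seq => m mh /=.
rewrite mpoly.mevalZ mpoly.mderivX mpoly.mevalZ -/(mixed_eval _ u 0) mevalXE.
rewrite /mon conjc0 -(exprD (0 : R[i])) !mpoly.mnmBE !mpoly.mnm1E /=.
rewrite !subn0 (hh _ mh) expr0 mulr1.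
case: eqP => [E|NE].
  have [_ _ E3 E4] := mvbE (m iu); rewrite -E in E3 E4.
  by rewrite E3 E4 subnn expr0 mulr1 mul1r.
have [E3|N3] := eqVneq (m ivb) 0%N; first by rewrite E3 mul0r mulr0.
have /negbTE NZ : (m iv + (m ivb - 1) != 0)%N.
  apply/negP => E; case: NE; apply: meqP.
  by have [-> -> -> ->] := mvbE (m iu); rewrite (hh _ mh); split=> //; lia.
by rewrite expr0n NZ !mulr0.
Qed.

End Coefficients.

Lemma eq_big_seq_cond (T : eqType) (V : nmodType) (s : seq T) (P Q : pred T) (F G : T -> V) :
  (forall x, x \in s -> P x = Q x) -> (forall x, x \in s -> P x -> F x = G x) ->
  \sum_(x <- s | P x) F x = \sum_(x <- s | Q x) G x.
Proof.
move=> PQ FG; rewrite big_mkcond [RHS]big_mkcond; apply: eq_big_seq => x xs /=.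
by rewrite -(PQ _ xs); case: ifP => // /(FG _ xs).
Qed.

Section InnerNondegenerate.
Variables (R : realType) (g : mixed R).
Hypothesis g_semihol : u_semiholomorphic g.
Hypothesis g_ind : inner_nondegenerate g.
Implicit Types (m : mpoly.multinom 4) (u v : R[i]) (P Q : nat * nat).

Let g0 : g != 0. Proof. by case: g_ind. Qed.

Let face_semihol P : u_semiholomorphic (weight_face P g).
Proof. exact: semihol_subsum. Qed.

Lemma corner_regular m0 u v : corner g m0 -> (u != 0) || (v != 0) ->
  mixed_eval (part g (mexp m0)) u v = 0 -> ~ singular_set (part g (mexp m0)) (u, v).
Proof.
move=> Hc uv; case: g_ind => _ H _.
have := H (ex_intro _ _ (corner_boundary Hc)).
rewrite (corner_boundary Hc) set_face_point => Hn.
apply: (no_critical_zeroP Hn) => -[u0 v0].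
by rewrite u0 v0 eqxx in uv.
Qed.

(** A multiple root in [u] would be critical by Euler's identity. *)
Lemma edge_simple Q u v : positive_weight Q -> edge g Q -> u != 0 -> v != 0 ->
  mixed_eval (weight_face Q g) u v = 0 -> mixed_eval (d_u (weight_face Q g)) u v <> 0.
Proof.
move=> Qpos eQ u0 v0 gz gu; case: g_ind => _ _ /(_ (edge_boundary Qpos eQ))[_ _ H _].
have := H _ (one_face_of Qpos eQ); rewrite set_face_face_of // => Hn.
apply: (no_critical_zeroP Hn (conj u0 v0 : torus (u, v)) gz).
by apply: crit_face => //; case/andP: Qpos.
Qed.

Lemma first_edge_regular Q m0 u v : positive_weight Q -> edge g Q -> on_face Q g m0 ->
  (forall m, m \in supp g -> ((mexp m0).1 <= (mexp m).1)%N) -> v != 0 ->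
  mixed_eval (weight_face Q g) u v = 0 -> ~ singular_set (weight_face Q g) (u, v).
Proof.
move=> Qpos eQ f0 Hm v0 gz; case: g_ind => _ _ /(_ (edge_boundary Qpos eQ))[H _ _ _].
have fQ : first_weight g (reduce Q).
  split=> [|Q' nQ']; first exact: newton_weight_reduce.
  have [Q'pos [m1 [m2 [f1 f2 ne]]]] := newton_weight_edge g0 nQ'
    (ex_intro _ _ (one_face_of Qpos eQ)).
  rewrite ratio_le ?reduce_pos //; apply/negP => fl; apply: ne.
  have f0' := (on_face_reduce Qpos g m0).2 f0; have rpos := reduce_pos Qpos.
  by rewrite (steeper_face Q'pos rpos fl f0' Hm f1) (steeper_face Q'pos rpos fl f0' Hm f2).
have := H _ fQ; rewrite weight_face_reduce // => Hn.
by apply: (no_critical_zeroP Hn).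
Qed.

Lemma last_edge_regular Q m0 u v : positive_weight Q -> edge g Q -> on_face Q g m0 ->
  (forall m, m \in supp g -> ((mexp m0).2 <= (mexp m).2)%N) -> u != 0 ->
  mixed_eval (weight_face Q g) u v = 0 -> ~ singular_set (weight_face Q g) (u, v).
Proof.
move=> Qpos eQ f0 Hm v0 gz; case: g_ind => _ _ /(_ (edge_boundary Qpos eQ))[_ H _ _].
have fQ : last_weight g (reduce Q).
  split=> [|Q' nQ']; first exact: newton_weight_reduce.
  have [Q'pos [m1 [m2 [f1 f2 ne]]]] := newton_weight_edge g0 nQ'
    (ex_intro _ _ (one_face_of Qpos eQ)).
  rewrite ratio_le ?reduce_pos //; apply/negP => fl; apply: ne.
  have f0' := (on_face_reduce Qpos g m0).2 f0; have rpos := reduce_pos Qpos.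
  by rewrite (flatter_face Q'pos rpos fl f0' Hm f1) (flatter_face Q'pos rpos fl f0' Hm f2).
have := H _ fQ; rewrite weight_face_reduce // => Hn.
by apply: (no_critical_zeroP Hn).
Qed.

(** The edge at a leftmost vertex carries the first weight, whose condition also covers
    the zeros with [u = 0]. *)
Lemma first_edge_simple Q m0 u v : positive_weight Q -> edge g Q -> on_face Q g m0 ->
  (forall m, m \in supp g -> ((mexp m0).1 <= (mexp m).1)%N) -> v != 0 ->
  mixed_eval (weight_face Q g) u v = 0 -> mixed_eval (d_u (weight_face Q g)) u v <> 0.
Proof.
move=> Qpos eQ f0 Hm v0 gz gu; apply: (first_edge_regular Qpos eQ f0 Hm v0 gz).
by apply: crit_face => //; case/andP: Qpos.
Qed.

(** At a single exponent [(a, b)] the part of [g] is [u ^ a * c (v)], and [c (v) = 0] kills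
    its [u]-derivative as well. *)
Lemma part_critical P m0 u v : vertex_at g P m0 -> u != 0 -> v != 0 ->
  mixed_eval (part g (mexp m0)) u v = 0 ->
  mixed_eval (d_u (part g (mexp m0))) u v = 0 /\ singular_set (part g (mexp m0)) (u, v).
Proof.
move=> [Ppos f0 Hu] u0 v0 gz.
have E : mixed_eval (d_u (part g (mexp m0))) u v = 0.
  have := euler iu (part g (mexp m0)) u v; rewrite /tnth /= => Eu.
  apply/eqP; rewrite -(mulrI_eq0 _ (mulfI u0)) /d_u Eu.
  have -> : \sum_(m <- supp (part g (mexp m0)))
      coef m (part g (mexp m0)) * (m iu)%:R * mon u v m =
      (mexp m0).1%:R * mixed_eval (part g (mexp m0)) u v.
    rewrite evE mulr_sumr; apply: eq_big_seq => m.
    rewrite mem_supp_subsum => /andP[mg /eqP <-].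
    by rewrite /mexp /= (g_semihol mg) addn0 -mulrA mulrCA.
  by rewrite gz mulr0.
split=> //; rewrite -(face_part f0 Hu) in gz E *.
by apply: crit_face => //; case/andP: Ppos.
Qed.

Lemma face_v0_eq0 Q m0 u : on_face Q g m0 ->
  (forall m, m \in supp g -> (0 < (mexp m).2)%N) -> mixed_eval (weight_face Q g) u 0 = 0.
Proof.
move=> f0 H; rewrite ev_subsum big1_seq // => m /andP[_ /H b0].
by rewrite mon_v0 ?mulr0 // -lt0n.
Qed.

Lemma du_v0_eq0 (h : mixed R) u : (forall m, m \in supp h -> (0 < (mexp m).2)%N) ->
  mixed_eval (d_u h) u 0 = 0.
Proof.
move=> H; rewrite evE big1_seq // => m /andP[_ /supp_deriv/H].
rewrite {1}/mexp /= !mpoly.mnmDE !mpoly.mnm1E /= !addn0 => b0.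
by rewrite mon_v0 ?mulr0 // -lt0n.
Qed.

(** On [v = 0] only the monomials [u ^ a * v] and [u ^ a * v^c] contribute to [s3]. *)
Lemma singular_v0 (h : mixed R) a u : u_semiholomorphic h ->
  (forall m, m \in supp h -> (0 < (mexp m).2)%N) ->
  (forall m, m \in supp h -> (mexp m).2 = 1%N -> (mexp m).1 = a) ->
  coef (mv a) h * (coef (mv a) h)^c = coef (mvb a) h * (coef (mvb a) h)^c ->
  singular_set h (u, 0).
Proof.
move=> hh H H1 E; apply/(singular_setP _ _ hh); split; first exact: du_v0_eq0.
rewrite ev_s3 (ev_dv_v0 _ hh) (ev_dvb_v0 _ hh).
have -> : \sum_(m <- supp h | m == mv (m iu)) coef m h * u ^+ m iu = coef (mv a) h * u ^+ a.
  have [ma|ma] := boolP (mv a \in supp h).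
    rewrite big_mkcond (bigD1_seq (mv a)) ?mpoly.msupp_uniq //=; have [Ea _ _ _] := mvE a.
    rewrite Ea eqxx big1_seq ?addr0 // => m /andP[mm mh]; case: eqP => // mE.
    case/negP: mm; rewrite mE; have := H1 _ mh.
    by rewrite mE mexp_mv => /(_ erefl) /= ->.
  rewrite (mpoly.memN_msupp_eq0 ma) mul0r big1_seq // => m /andP[/eqP mE mh].
  have := H1 _ mh; rewrite mE mexp_mv => /(_ erefl) /= aE.
  by rewrite mE aE (negbTE ma) in mh.
have -> : \sum_(m <- supp h | m == mvb (m iu)) coef m h * u ^+ m iu = coef (mvb a) h * u ^+ a.
  have [ma|ma] := boolP (mvb a \in supp h).
    rewrite big_mkcond (bigD1_seq (mvb a)) ?mpoly.msupp_uniq //=; have [Ea _ _ _] := mvbE a.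
    rewrite Ea eqxx big1_seq ?addr0 // => m /andP[mm mh]; case: eqP => // mE.
    case/negP: mm; rewrite mE; have := H1 _ mh.
    by rewrite mE mexp_mvb => /(_ erefl) /= ->.
  rewrite (mpoly.memN_msupp_eq0 ma) mul0r big1_seq // => m /andP[/eqP mE mh].
  have := H1 _ mh; rewrite mE mexp_mvb => /(_ erefl) /= aE.
  by rewrite mE aE (negbTE ma) in mh.
move: (coef (mv a) h) (coef (mvb a) h) (u ^+ a) E => p q w E.
by rewrite !rmorphM /= !(mulrACA _ w) E subrr.
Qed.

(** Among the lowest exponents, the leftmost one is singled out by a weight whose second
    entry is large. *)
Lemma bottom_vertex : exists m0 P, vertex_at g P m0 /\
  forall m, m \in supp g -> ((mexp m0).2 <= (mexp m).2)%N.
Proof.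
have [m1 m1g] := neq0_supp g0.
have [m2 m2g H2] := min_seq_nat (fun m => (mexp m).2) m1g.
have m2f : m2 \in [seq m <- supp g | (mexp m).2 == (mexp m2).2] by rewrite mem_filter eqxx.
have [m0 + H0] := min_seq_nat (fun m => (mexp m).1) m2f.
rewrite mem_filter => /andP[/eqP E0 m0g].
have Hb m : m \in supp g -> ((mexp m0).2 <= (mexp m).2)%N by rewrite E0; exact: H2.
have Ha m : m \in supp g -> (mexp m).2 = (mexp m0).2 -> ((mexp m0).1 <= (mexp m).1)%N.
  by move=> mg E; apply: H0; rewrite mem_filter mg E E0 eqxx.
exists m0, (1, (mexp m0).1.+1)%N; split=> //.
have key m : m \in supp g -> (rdeg (1, (mexp m0).1.+1)%N m0 <= rdeg (1, (mexp m0).1.+1)%N m)%N /\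
   (rdeg (1, (mexp m0).1.+1)%N m <= rdeg (1, (mexp m0).1.+1)%N m0 -> mexp m = mexp m0)%N.
  move=> mg; have := Hb _ mg; have := Ha _ mg; rewrite /rdeg.
  case: (mexp m) => a b; case: (mexp m0) => a0 b0 /= H1 lb.
  have [bE|bb] := eqVneq b b0.
    by subst b; have := H1 erefl; split; [lia|move=> ?; congr (_, _); lia].
  have lt : (b0 < b)%N by lia.
  by split; [nia|move=> ?; exfalso; nia].
split=> //; first by split=> // m /key[].
by move=> m [mg H]; apply: (key _ mg).2; apply: H.
Qed.

(** A zero of the coefficient [c (v)] of a vertex [(a, b)] with [0 < a] is a critical zero
    of the vertex, for all [u != 0]. This contradicts the condition on non-extreme vertices if
    there are edges on both sides. At the lowest vertex it makes the last edge function
    singular at [(u, 0)], at the leftmost one it makes the first edge function singular at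
    [(0, v)], and without any edge it contradicts the condition on [g_Gamma]. *)
Lemma vertex_coef_neq0 P m0 u v : vertex_at g P m0 -> (0 < (mexp m0).1)%N ->
  u != 0 -> v != 0 -> mixed_eval (part g (mexp m0)) u v <> 0.
Proof.
move=> V a0 u0 v0 gz; have [Ppos f0 Hu] := V.
have [duz sing] := part_critical V u0 v0 gz.
have [[m1 m1g lt1]|NL] := pselect (exists2 m1, m1 \in supp g & ((mexp m1).1 < (mexp m0).1)%N);
have [[m2 m2g lt2]|NR] := pselect (exists2 m2, m2 \in supp g & ((mexp m2).2 < (mexp m0).2)%N).
- have [Q1 [n1 [Q1pos f01 fn1 ltn1 _]]] := rotate_left Ppos f0 m1g lt1.
  have [Q2 [n2 [Q2pos f02 fn2 ltn2 _]]] := rotate_right Ppos f0 m2g lt2.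
  have e1 : edge g Q1 by exists m0, n1; split=> // E; rewrite E ltnn in ltn1.
  have e2 : edge g Q2 by exists m0, n2; split=> // E; rewrite E ltnn in ltn2.
  case: g_ind => _ _ /(_ (edge_boundary Q1pos e1))[_ _ _ H].
  have vx : non_extreme_vertex g (exp_point R m0).
    split; first by rewrite /vertex -(face_of_vertex V); exact: compact_face_of.
    exists (face_of g Q1), (face_of g Q2); split.
    - exact: one_face_of.
    - exact: one_face_of.
      (* On a common edge, [m0] would lie between [n1] and [n2], and could not be the unique
         minimum for [P]. *)
    - move=> FE; have f12 : on_face Q1 g n2.
        apply/(supporting_face_on_face Q1pos fn2.1); rewrite -/(face_of g Q1) FE.
        exact/(supporting_face_on_face Q2pos fn2.1).
      have := on_face_rdeg f12; have := on_face_rdeg fn1; rewrite -(on_face_rdeg f01).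
      have p1 : (rdeg P m0 < rdeg P n1)%N.
        rewrite ltn_neqAle (f0.2 _ fn1.1) andbT; apply/eqP => E.
        by rewrite (Hu _ (on_face_eq f0 fn1.1 (esym E))) ltnn in ltn1.
      have p2 : (rdeg P m0 < rdeg P n2)%N.
        rewrite ltn_neqAle (f0.2 _ fn2.1) andbT; apply/eqP => E.
        by rewrite (Hu _ (on_face_eq f0 fn2.1 (esym E))) ltnn in ltn2.
      move: p1 p2 ltn1 ltn2 Q1pos Ppos; rewrite /rdeg /positive_weight.
      case: (mexp m0) => a b; case: (mexp n1) => c d; case: (mexp n2) => x y /=.
      case: (P) => p q; case: (Q1) => r s /= p1 p2 l1 l2 /andP[r0 s0] /andP[p0 q0] E1 E2.
      have [i iE] : exists i, a = (c + i)%N by exists (a - c)%N; lia.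
      have [j jE] : exists j, b = (y + j)%N by exists (b - y)%N; lia.
      have db : (b <= d)%N by nia.
      have ax : (a <= x)%N by nia.
      have [k kE] : exists k, d = (b + k)%N by exists (d - b)%N; lia.
      have [l lE] : exists l, x = (a + l)%N by exists (x - a)%N; lia.
      subst d x; subst a b; have h1 : (r * i = s * k)%N by nia.
      have h2 : (r * l = s * j)%N by nia.
      have h3 : (p * i < q * k)%N by nia.
      have h4 : (q * j < p * l)%N by nia.
      have k0 : (0 < k)%N by nia.
      have : (p * s * k < q * r * k)%N.
        have : (p * i * r < q * k * r)%N by rewrite ltn_pmul2r.
        by nia.
      rewrite ltn_pmul2r // => h5.
      have l0 : (0 < l)%N by nia.
      have : (q * r * l < p * s * l)%N.
        have : (q * j * s < p * l * s)%N by rewrite ltn_pmul2r.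
        by nia.
      by rewrite ltn_pmul2r //; lia.
    - exact/(supporting_face_on_face Q1pos f0.1).
    - exact/(supporting_face_on_face Q2pos f0.1).
  have := H _ vx; rewrite set_face_point => Hn.
  exact: (no_critical_zeroP Hn (conj u0 v0 : torus (u, v)) gz).
- have Hb m : m \in supp g -> ((mexp m0).2 <= (mexp m).2)%N.
    by move=> mg; rewrite leqNgt; apply/negP => lt; apply: NR; exists m.
  have [Q1 [n1 [Q1pos f01 fn1 ltn1 _]]] := rotate_left Ppos f0 m1g lt1.
  have e1 : edge g Q1 by exists m0, n1; split=> // E; rewrite E ltnn in ltn1.
  have [b0|b0] := posnP (mexp m0).2.
    move: gz; rewrite evE (bigD1_seq m0) ?mpoly.msupp_uniq ?mem_supp_subsum ?f0.1 ?eqxx //=.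
    rewrite big1_seq ?addr0 => [/eqP|m /andP[mm]].
      rewrite mulf_eq0 mpoly.mcoeff_eq0 mem_supp_subsum f0.1 eqxx /=.
      have := b0; rewrite /mexp /= => /eqP; rewrite addn_eq0 => /andP[/eqP Ev /eqP Evb].
      by rewrite /mon Ev Evb (g_semihol f0.1) !expr0 !mulr1 expf_eq0 (negbTE u0) andbF.
    rewrite mem_supp_subsum => /andP[mg /eqP E]; case/eqP: mm; apply: meqP.
    move: E b0; rewrite /mexp /= (g_semihol mg) (g_semihol f0.1) !addn0 => -[Ea Eb].
    by move/eqP; rewrite -Eb addn_eq0 => /andP[/eqP c1 /eqP c2]; split=> //; lia.
  have Hpos m : m \in supp g -> (0 < (mexp m).2)%N by move/Hb; exact: leq_trans.
  have Hpos' m : m \in supp (weight_face Q1 g) -> (0 < (mexp m).2)%N.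
    by rewrite mem_supp_subsum => /andP[/Hpos].
  apply: (last_edge_regular Q1pos e1 f01 Hb u0 (face_v0_eq0 u f01 Hpos)).
  have face1 m : m \in supp (weight_face Q1 g) -> (mexp m).2 = (mexp m0).2 ->
      mexp m = mexp m0.
    rewrite mem_supp_face => /andP[_ /eqP]; rewrite -(on_face_rdeg f01) /rdeg.
    case: (mexp m) => a b; case: (mexp m0) => a' b' /= E bE; subst b.
    by congr (_, _); case/andP: Q1pos => q1 _; nia.
  refine (@singular_v0 (weight_face Q1 g) (mexp m0).1 u (@face_semihol Q1) Hpos' _ _).
    move=> m mh E; rewrite (face1 _ mh) //.
    by have := Hb _ ((on_faceP Q1 g m).2 mh).1; lia.
  have cf n : mexp n = ((mexp m0).1, 1%N) -> coef n (weight_face Q1 g) =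
      if (mexp m0).2 == 1%N then coef n g else 0.
    move=> nE; rewrite coef_subsum -(on_face_rdeg f01) /rdeg nE.
    case/andP: Q1pos => _ q2; case: (mexp m0) => a b.
    by rewrite eqn_add2l eqn_pmul2l // eq_sym.
  rewrite (cf _ (mexp_mv _)) (cf _ (mexp_mvb _)).
  have [b1|_] := eqVneq (mexp m0).2 1%N; last by rewrite !mul0r.
  have mE : mexp m0 = ((mexp m0).1, 1%N) by rewrite -b1 -surjective_pairing.
  have := gz; rewrite mE (ev_part1 _ _ _ g_semihol) -mE => /eqP.
  rewrite mulf_eq0 expf_eq0 (negbTE u0) andbF /=.
  rewrite addr_eq0 => /eqP E.
  have {}E := congr1 (fun z => z * z^c) E.
  have vv : v * v^c != 0 by rewrite mul_conj_eq0.
  apply: (mulIf vv); move: E; rewrite rmorphN !rmorphM /= conjcK => E.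
  transitivity (coef (mv (mexp m0).1) g * v * ((coef (mv (mexp m0).1) g)^c * v^c)).
    by ring.
  by rewrite E; ring.
- have Ha m : m \in supp g -> ((mexp m0).1 <= (mexp m).1)%N.
    by move=> mg; rewrite leqNgt; apply/negP => lt; apply: NL; exists m.
  have [Q2 [n2 [Q2pos f02 fn2 ltn2 _]]] := rotate_right Ppos f0 m2g lt2.
  have e2 : edge g Q2 by exists m0, n2; split=> // E; rewrite E ltnn in ltn2.
  have gz2 : mixed_eval (weight_face Q2 g) 0 v = 0.
    rewrite ev_subsum big1_seq // => m /andP[_ /Ha a1].
    by rewrite mon_u0 ?mulr0 // -lt0n (leq_trans a0).
  apply: (first_edge_simple Q2pos e2 f02 Ha v0 gz2).
  rewrite ev_du_u0 //.
  have [a1|a1] := eqVneq (mexp m0).1 1%N; last first.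
    rewrite big1_seq // => m /andP[/eqP m1 /(on_faceP Q2 g m).2[mg _]].
    have := Ha _ mg; have -> : (mexp m).1 = 1%N by rewrite /mexp /= m1 (g_semihol mg).
    by lia.
  have face1 m : m \in supp (weight_face Q2 g) -> (mexp m).1 = (mexp m0).1 ->
      mexp m = mexp m0.
    rewrite mem_supp_face => /andP[_ /eqP]; rewrite -(on_face_rdeg f02) /rdeg.
    case: (mexp m) => a b; case: (mexp m0) => a' b' /= E bE; subst a.
    by congr (_, _); case/andP: Q2pos => _ q2; nia.
  rewrite (big_supp_subsum g (fun m => rdeg Q2 m == min_rdeg Q2 g) (fun m => m iu == 1%N)
    (vmon v)).
  set S := \sum_(_ <- _ | _) _.
  suff : u * S = mixed_eval (part g (mexp m0)) u v.
    by rewrite gz => /eqP; rewrite mulf_eq0 (negbTE u0) => /eqP.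
  rewrite /S mulr_sumr ev_subsum.
  apply: eq_big_seq_cond => m mg.
    rewrite -(on_face_rdeg f02); apply/andP/eqP => [[/eqP E /eqP m1]|E].
      apply: face1; last by rewrite a1 /mexp /= m1 (g_semihol mg).
      by rewrite mem_supp_face mg E (on_face_rdeg f02) eqxx.
    rewrite /rdeg E eqxx; split=> //; apply/eqP; transitivity (mexp m).1.
      by rewrite /mexp /= (g_semihol mg) addn0.
    by rewrite E.
  move=> /andP[_ /eqP m1]; rewrite /mon /vmon m1 (g_semihol mg) expr1 expr0 mulr1.
  by rewrite mulrCA.
- apply: (corner_regular (m0 := m0)) gz sing; last by rewrite u0.
  split=> [|m mg]; first exact: f0.1.
  split; rewrite leqNgt; apply/negP => lt.
    by apply: NL; exists m.
  by apply: NR; exists m.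
Qed.

End InnerNondegenerate.

Section InnerNondegenerate2.
Variables (R : realType) (g : mixed R).
Hypothesis g_semihol : u_semiholomorphic g.
Hypothesis g_ind : inner_nondegenerate g.
Implicit Types (m : mpoly.multinom 4) (u v : R[i]) (P Q : nat * nat).

(** Otherwise the vertex would be a corner of the whole support, and the zero of its
    coefficient a critical zero of [g_Gamma]. *)
Lemma lower_exists P m0 u v : vertex_at g P m0 -> (mexp m0).1 = 0%N -> v != 0 ->
  mixed_eval (part g (mexp m0)) u v = 0 ->
  exists2 m1, m1 \in supp g & ((mexp m1).2 < (mexp m0).2)%N.
Proof.
move=> V a0 v0; rewrite (ev_part0 _ _ 1) // => gz; apply: contrapT => Hn.
have Hc : corner g m0.
  split=> [|m mg]; first by have [_ []] := V.
  rewrite a0 leqNgt; split=> //; rewrite leqNgt; apply/negP => lt.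
  by apply: Hn; exists m.
have [_] := part_critical g_semihol V (oner_neq0 _) v0 gz.
by apply: corner_regular gz => //; rewrite oner_neq0.
Qed.

(** The lowest vertex is [(a, b)] with [0 < b]. If the two coefficients had the same modulus
    (in particular if [1 < b], when both are zero), the last edge function, or [g_Gamma] if
    there is no edge, would be singular at [(1, 0)]. *)
Lemma bottom_coefs : set_v0 g = 0 -> exists a,
  (forall j, (j < a)%N -> coef (mv j) g = 0 /\ coef (mvb j) g = 0) /\
  coef (mv a) g * (coef (mv a) g)^c <> coef (mvb a) g * (coef (mvb a) g)^c.
Proof.
move=> gv0; have Hpos m : m \in supp g -> (0 < (mexp m).2)%N.
  move=> mg; rewrite lt0n; apply/negP => b0.
  have : m \in supp (set_v0 g) by rewrite set_v0E mem_supp_subsum mg.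
  by rewrite gv0 mpoly.msupp0.
have [m0 [P [[Ppos f0 Hu] Hb]]] := bottom_vertex g_ind.
have low m : m \in supp g -> (mexp m).2 = (mexp m0).2 -> ((mexp m0).1 <= (mexp m).1)%N.
  move=> mg E; have := f0.2 _ mg; rewrite /rdeg E leq_add2r leq_pmul2l //.
  by case/andP: Ppos.
have b1 n j : n \in supp g -> mexp n = (j, 1%N) -> (mexp m0).2 = 1%N.
  by move=> ng nE; have := Hb _ ng; have := Hpos _ f0.1; rewrite nE /=; lia.
have zero n j : (j < (mexp m0).1)%N -> mexp n = (j, 1%N) -> coef n g = 0.
  move=> ja nE; apply: mpoly.memN_msupp_eq0; apply/negP => ng.
  have H := low _ ng; rewrite nE in H.
  by have := H (esym (b1 _ _ ng nE)); rewrite leqNgt ja.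
exists (mexp m0).1; split=> [j ja|E].
  by split; [apply: zero ja (mexp_mv _)|apply: zero ja (mexp_mvb _)].
have sing h : u_semiholomorphic h -> (forall m, m \in supp h -> (0 < (mexp m).2)%N) ->
    (forall m, m \in supp h -> (mexp m).2 = (mexp m0).2 -> mexp m = mexp m0) ->
    (forall m, m \in supp h -> ((mexp m0).2 <= (mexp m).2)%N) ->
    (forall n, mexp n = ((mexp m0).1, 1%N) ->
      coef n h = if (mexp m0).2 == 1%N then coef n g else 0) -> singular_set h (1, 0).
  move=> hh hpos hu hb hc; refine (@singular_v0 _ h (mexp m0).1 1 hh hpos _ _).
    by move=> m mh E1; rewrite (hu _ mh) //; have := hb _ mh; have := Hpos _ f0.1; lia.
  rewrite (hc _ (mexp_mv _)) (hc _ (mexp_mvb _)).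
  by case: eqP => _ //; rewrite !mul0r.
have [[m1 m1g lt1]|NL] := pselect (exists2 m1, m1 \in supp g & ((mexp m1).1 < (mexp m0).1)%N).
  have [Q1 [n1 [Q1pos f01 fn1 ltn1 _]]] := rotate_left Ppos f0 m1g lt1.
  have e1 : edge g Q1 by exists m0, n1; split=> // E'; rewrite E' ltnn in ltn1.
  apply: (last_edge_regular g_ind Q1pos e1 f01 Hb (oner_neq0 _) (face_v0_eq0 1 f01 Hpos)).
  apply: sing.
  - exact: semihol_subsum.
  - by move=> m; rewrite mem_supp_subsum => /andP[/Hpos].
  - move=> m; rewrite mem_supp_face => /andP[_ /eqP]; rewrite -(on_face_rdeg f01) /rdeg.
    case: (mexp m) => a b; case: (mexp m0) => a' b' /= E' bE; subst b.
    by congr (_, _); case/andP: Q1pos => q1 _; nia.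
  - by move=> m; rewrite mem_supp_subsum => /andP[/Hb].
  - move=> n nE; rewrite coef_subsum -(on_face_rdeg f01) /rdeg nE.
    case/andP: Q1pos => _ q2; case: (mexp m0) => a b.
    by rewrite eqn_add2l eqn_pmul2l // eq_sym.
have Hc : corner g m0.
  split=> [|m mg]; first exact: f0.1.
  by split; [rewrite leqNgt; apply/negP => lt; apply: NL; exists m|exact: Hb].
apply: (corner_regular g_ind Hc (u := 1) (v := 0)); first by rewrite oner_neq0.
  rewrite ev_subsum big1_seq // => m /andP[_ /Hpos]; rewrite lt0n => bn.
  by rewrite mon_v0 ?mulr0.
apply: sing.
- exact: semihol_subsum.
- by move=> m; rewrite mem_supp_subsum => /andP[/Hpos].
- by move=> m; rewrite mem_supp_subsum => /andP[_ /eqP].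
- by move=> m; rewrite mem_supp_subsum => /andP[/Hb].
- move=> n nE; rewrite coef_subsum nE [mexp m0]surjective_pairing /= eq_sym.
  by rewrite -pair_eqE /= eqxx.
Qed.

End InnerNondegenerate2.

(** * The roots of a face function as functions of the argument of [v] *)

Section RootFamily.
Variable R : realType.
Local Notation C := R[i].
Local Notation Co := (R[i]^o).
Implicit Types (h : mixed R) (m : mpoly.multinom 4) (u v : C) (P Q : nat * nat).

(** [scal P h r u v / u ^ a] as a polynomial in [u], either for [a = 0], or for [r = 0] when [a]
    is at most the [u]-exponents of the face. *)
Definition spoly P h a (r : R) v : {poly C} := \sum_(m <- supp h)
  (coef m h * (r%:C ^+ (rdeg P m - min_rdeg P h) * vmon v m)) *: 'X^(m iu - a).

Lemma horner_spoly P h r u v : u_semiholomorphic h ->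
  (spoly P h 0 r v).[u] = scal P h r u v.
Proof.
move=> hh; rewrite /spoly horner_sum; apply: eq_big_seq => m mh.
rewrite hornerZ hornerXn subn0 /mon /vmon (hh _ mh) expr0 mulr1.
move: (coef m h) (r%:C ^+ _) (u ^+ _) (v ^+ _) (v^c ^+ _) => a b c d e; ring.
Qed.

Lemma coef_spoly P h a r v j : (spoly P h a r v)`_j = \sum_(m <- supp h)
  (coef m h * (r%:C ^+ (rdeg P m - min_rdeg P h) * vmon v m)) * (j == m iu - a)%N%:R.
Proof. by rewrite /spoly coef_sum; apply: eq_bigr => m _; rewrite coefZ coefXn. Qed.

Lemma size_spoly P h a r v : (size (spoly P h a r v) <= (\sum_(m <- supp h) m iu).+1)%N.
Proof.
apply/leq_sizeP => j lej; rewrite coef_spoly big1_seq // => m /andP[_ mh].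
have : (m iu <= \sum_(m <- supp h) m iu)%N by rewrite (bigD1_seq m) ?mpoly.msupp_uniq //= leq_addr.
by move=> le_m; case: eqP => [E|_]; rewrite ?mulr0 //; exfalso; lia.
Qed.

Lemma cvg_coef_spoly (T : Type) (F : set_system T) {FF : Filter F} P h a
  (r : T -> R) (v : T -> Co) (r0 : R) (v0 : Co) j : r @ F --> r0 -> v @ F --> v0 ->
  (fun t => (spoly P h a (r t) (v t))`_j : Co) @ F --> ((spoly P h a r0 v0)`_j : Co).
Proof.
move=> Hr Hv; rewrite coef_spoly; under eq_fun do rewrite coef_spoly.
apply: (cvg_big_sum (f := fun m t => coef m h * ((r t)%:C ^+ (rdeg P m - min_rdeg P h) *
   vmon (v t) m) * (j == m iu - a)%N%:R)) => m _.
exact: (cvgM (cvgM (cvg_cst (coef m h : Co)) (cvgM (cvg_exp (cvg_real_complex Hr))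
  (cvgM (cvg_exp Hv) (cvg_exp (cvg_conj Hv))))) (cvg_cst (_ : Co))).
Qed.

Lemma coef_spoly0 P h a v j : (forall m, on_face P h m -> (a <= m iu)%N) ->
  (spoly P h a 0 v)`_j =
  \sum_(m <- supp h | (rdeg P m == min_rdeg P h) && (m iu == a + j)%N) coef m h * vmon v m.
Proof.
move=> Ha; rewrite coef_spoly [RHS]big_mkcond; apply: eq_big_seq => m mh /=.
have -> : 0%:C ^+ (rdeg P m - min_rdeg P h) = (rdeg P m == min_rdeg P h)%:R :> C.
  by rewrite expr0n subn_eq0 eqn_leq min_rdeg_le // andbT.
case: eqP => [E|_] /=; last by rewrite mul0r mulr0 mul0r.
have fm : on_face P h m by apply/on_faceP; rewrite mem_supp_face mh E eqxx.
rewrite mul1r; have := Ha _ fm => am.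
have -> : (j == m iu - a)%N = (m iu == a + j)%N by apply/eqP/eqP; lia.
by case: eqP => _; rewrite ?mulr1 // mulr0.
Qed.

Lemma upoly_face P h a v : u_semiholomorphic h -> (forall m, on_face P h m -> (a <= m iu)%N) ->
  upoly (weight_face P h) v = 'X^a * spoly P h a 0 v.
Proof.
move=> hh Ha; apply/polyP => j; rewrite coefXnM coef_upoly; last exact: semihol_subsum.
rewrite (big_supp_subsum h (fun m => rdeg P m == min_rdeg P h) (fun m => m iu == j) (vmon v)).
case: ltnP => [ja|aj]; last by rewrite coef_spoly0 // subnKC.
rewrite big1_seq // => m /andP[/andP[/eqP E /eqP mj] mh].
have : (a <= m iu)%N by apply: Ha; apply/on_faceP; rewrite mem_supp_face mh E eqxx.
by rewrite mj leqNgt ja.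
Qed.

End RootFamily.

Section EdgeBranch.
Variables (R : realType) (g : mixed R).
Local Notation Co := (R[i]^o).
Hypothesis g_semihol : u_semiholomorphic g.
Hypothesis g_ind : inner_nondegenerate g.
Implicit Types (m : mpoly.multinom 4) (u v : R[i]) (P Q : nat * nat).

Lemma edge_root_simple Q u v : positive_weight Q -> edge g Q -> v != 0 ->
  u != 0 \/ (exists2 m0, on_face Q g m0 & (mexp m0).1 = 0%N) ->
  mixed_eval (weight_face Q g) u v = 0 -> mixed_eval (d_u (weight_face Q g)) u v <> 0.
Proof.
move=> Qpos eQ v0 [u0|[m0 f0 a0]]; first exact: edge_simple.
by apply: (first_edge_simple g_semihol g_ind Qpos eQ f0 _ v0) => m _; rewrite a0.
Qed.

(** Neither the leading coefficient nor, unless the edge reaches the axis, the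
    trailing coefficient of the face function of an edge vanishes, and its
    nonzero roots are simple: no root is lost when [t] varies. *)
Lemma edge_branch Q t0 w0 : positive_weight Q -> edge g Q ->
  w0 != 0 \/ (exists2 m0, on_face Q g m0 & (mexp m0).1 = 0%N) ->
  mixed_eval (weight_face Q g) w0 (expi t0) = 0 ->
  exists U : R -> Co, [/\ continuous U, U t0 = w0 &
    forall t, mixed_eval (weight_face Q g) (U t) (expi t) = 0].
Proof.
move=> Qpos eQ Hw0 gw0; have [n [n' [fn fn' ne]]] := eQ.
have iuE m : m \in supp g -> (mexp m).1 = m iu by move=> mg; rewrite /mexp /= (g_semihol mg) addn0.
have [m1 [P1 [f1 H1 V1]]] := left_endpoint Qpos fn.
have [m2 [P2 [f2 H2 V2]]] := right_endpoint Qpos fn.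
pose a := (mexp m1).1; pose d := ((mexp m2).1 - a)%N.
have a_le m : on_face Q g m -> (a <= m iu)%N by move=> fm; rewrite -(iuE _ fm.1); exact: H1.
have dE : (mexp m2).1 = (a + d)%N by rewrite subnKC // H1.
have endpoint v m' : on_face Q g m' -> \sum_(m <- supp g |
    (rdeg Q m == min_rdeg Q g) && (m iu == (mexp m').1)) coef m g * vmon v m =
    mixed_eval (part g (mexp m')) 1 v.
  move=> f'; rewrite ev_subsum; apply: eq_big_seq_cond => m mg.
    rewrite -(on_face_rdeg f') -(iuE _ mg) /rdeg; case/andP: Qpos => q1 q2.
    case: (mexp m) => x y; case: (mexp m') => z w /=; rewrite -pair_eqE /=.
    apply/andP/andP => -[/eqP E1 /eqP E2]; split; apply/eqP; nia.
  by move=> _; rewrite /mon (g_semihol mg) !expr1n mul1r mul1r.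
have d0 : (0 < (mexp m2).1)%N.
  rewrite dE addn_gt0; apply/orP; have [a0|] := posnP a; last by left.
  right; rewrite lt0n; apply/eqP => d0; apply: ne.
  have e0 m : on_face Q g m -> (mexp m).1 = 0%N by move=> /H2; rewrite dE a0 d0; lia.
  have := on_face_rdeg fn; rewrite -(on_face_rdeg fn') /rdeg (e0 _ fn) (e0 _ fn').
  rewrite !muln0 !add0n => /eqP; case/andP: Qpos => _ q2; rewrite eqn_pmul2l // => /eqP E.
  by rewrite [mexp n]surjective_pairing [mexp n']surjective_pairing (e0 _ fn) (e0 _ fn') E.
pose p t := spoly Q g a 0 (expi t).
have lead t : (p t)`_d != 0.
  rewrite /p coef_spoly0 // -dE endpoint //; apply/eqP.
  exact: (vertex_coef_neq0 g_semihol g_ind V2 d0 (oner_neq0 _) (expi_neq0 t)).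
have size_p t : size (p t) = d.+1.
  apply/eqP; rewrite eqn_leq; apply/andP; split; last first.
    by rewrite ltnNge; apply/negP => /leq_sizeP/(_ _ (leqnn d))/eqP; apply/negP.
  apply/leq_sizeP => j dj; rewrite /p coef_spoly0 // big1_seq // => m /andP[/andP[/eqP E /eqP mj] mg].
  have := H2 m; rewrite iuE // mj dE leq_add2l leqNgt dj => H; exfalso.
  by have : false by apply: H; apply/on_faceP; rewrite mem_supp_face mg E eqxx.
have coef_p j : continuous (fun t => (p t)`_j : Co).
  by move=> t; apply: cvg_coef_spoly; [exact: cvg_cst|exact: continuous_expi].
have evp t u : mixed_eval (weight_face Q g) u (expi t) = u ^+ a * (p t).[u].
  by rewrite -horner_upoly ?(upoly_face _ _ a_le) ?hornerM ?hornerXn //; exact: semihol_subsum.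
have p0 t : (0 < a)%N -> (p t).[0] != 0.
  move=> a0; rewrite horner_coef0 /p coef_spoly0 // addn0 endpoint //; apply/eqP.
  exact: (vertex_coef_neq0 g_semihol g_ind V1 a0 (oner_neq0 _) (expi_neq0 t)).
have simple_p t w : (p t).[w] = 0 -> (p t)^`().[w] != 0.
  move=> pw; apply/eqP => dpw.
  have gz : mixed_eval (weight_face Q g) w (expi t) = 0 by rewrite evp pw mulr0.
  apply: (@edge_root_simple Q w (expi t)) gz _ => //; first exact: expi_neq0.
    have [a0|a0] := posnP a; first by right; exists m1.
    by left; apply/eqP => w0'; move/eqP: (p0 t a0); apply; rewrite -[RHS]pw w0'.
  rewrite -(horner_upoly _ _ (semihol_deriv (semihol_subsum g_semihol))).
  rewrite -deriv_upoly; last exact: semihol_subsum.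
  by rewrite (upoly_face _ g_semihol a_le) derivM hornerD !hornerM pw dpw !mulr0 addr0.
have pw0 : (p t0).[w0] = 0.
  have := gw0; rewrite evp => /eqP; rewrite mulf_eq0 => /orP[|/eqP//].
  rewrite expf_eq0 => /andP[a0 /eqP w00]; case: Hw0; first by rewrite w00 eqxx.
  by move=> [m0 /H1]; rewrite -/a => + E; rewrite E leqNgt a0.
have [U [cU Ut HU]] := global_branch size_p coef_p simple_p pw0.
by exists U; split=> // t; rewrite evp HU mulr0.
Qed.

End EdgeBranch.

(** * Sign changes produce singular points *)

Section Accumulation.
Variable R : realType.
Local Notation C := R[i].
Local Notation Co := (R[i]^o).
Implicit Types (g k : mixed R) (P Q : nat * nat).

Definition zeros_cluster g k := forall e : C, 0 < e -> exists u v : C,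
  [/\ (u != 0) || (v != 0), `|u| < e, `|v| < e, mixed_eval g u v = 0 & mixed_eval k u v = 0].

Lemma sign_change_zero (F : R -> R) t0 d t1 t2 :
  (forall t, `|t - t0| < d -> {for t, continuous F}) ->
  `|t1 - t0| < d -> `|t2 - t0| < d -> F t1 < 0 -> 0 < F t2 ->
  exists2 t, `|t - t0| < d & F t = 0.
Proof.
move=> cF d1 d2 F1 F2.
have btw x y t : `|x - t0| < d -> `|y - t0| < d -> t \in `[x, y] -> `|t - t0| < d.
  rewrite in_itv /= !ltr_norml => /andP[a1 a2] /andP[b1 b2] /andP[c1 c2].
  by apply/andP; split; lra.
have [le12|/ltW le21] := lerP t1 t2.
  have [||t tI Ft] := @IVT R F t1 t2 0 le12.
  - apply: continuous_in_subspaceT => t; rewrite inE => tI; apply: cF; exact: btw d1 d2 tI.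
  - by rewrite (min_l (ltW (lt_trans F1 F2))) (max_r (ltW (lt_trans F1 F2))) !ltW.
  by exists t => //; exact: btw d1 d2 tI.
have [||t tI Ft] := @IVT R F t2 t1 0 le21.
- apply: continuous_in_subspaceT => t; rewrite inE => tI; apply: cF; exact: btw d2 d1 tI.
- by rewrite (min_r (ltW (lt_trans F1 F2))) (max_l (ltW (lt_trans F1 F2))) !ltW.
by exists t => //; exact: btw d2 d1 tI.
Qed.

Lemma not_extremum (F : R -> R) t0 d : F t0 = 0 -> ~ local_extremum F t0 -> 0 < d ->
  exists t1 t2, [/\ `|t1 - t0| < d, `|t2 - t0| < d, F t1 < 0 & 0 < F t2].
Proof.
move=> F0 next d0.
have ball_d : \forall t \near t0, `|t - t0| < d.
  by apply/nbhs_ballP; exists d => //= t; rewrite -ball_normE /= distrC.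
have [t1 t1d F1] : exists2 t, `|t - t0| < d & F t < 0.
  apply: contrapT => Hn; apply: next; left; apply: filterS ball_d => t td.
  by rewrite F0 leNgt; apply/negP => Ft; apply: Hn; exists t.
have [t2 t2d F2] : exists2 t, `|t - t0| < d & 0 < F t.
  apply: contrapT => Hn; apply: next; right; apply: filterS ball_d => t td.
  by rewrite F0 leNgt; apply/negP => Ft; apply: Hn; exists t.
by exists t1, t2.
Qed.

(** Intermediate value theorem on a family of zeros of [g] that shrinks to the origin with
    [r]: for each small [r], the real-valued [k] changes sign between [t1] and [t2]. *)
Lemma cluster_box g k Q (W1 W2 : R * R -> Co) (M : C) t0 d t1 t2 :
  positive_weight Q -> (forall u v, complex.Im (mixed_eval k u v) = 0) ->
  0 < d -> 0 < M -> `|t1 - t0| < d -> `|t2 - t0| < d ->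
  (forall r t, `|r| < d -> `|t - t0| < d ->
    [/\ {for (r, t), continuous W1}, {for (r, t), continuous W2},
        `|W1 (r, t) : C| <= M, `|W2 (r, t) : C| <= M &
      0 < r -> ((W1 (r, t) != 0) || (W2 (r, t) != 0)) /\
        mixed_eval g (r%:C ^+ Q.1 * W1 (r, t)) (r%:C ^+ Q.2 * W2 (r, t)) = 0]) ->
  (\forall r \near 0^'+,
    complex.Re (mixed_eval k (r%:C ^+ Q.1 * W1 (r, t1)) (r%:C ^+ Q.2 * W2 (r, t1))) < 0) ->
  (\forall r \near 0^'+,
    0 < complex.Re (mixed_eval k (r%:C ^+ Q.1 * W1 (r, t2)) (r%:C ^+ Q.2 * W2 (r, t2)))) ->
  zeros_cluster g k.
Proof.
move=> /andP[q1 q2] kR d0 M0 d1 d2 HW K1 K2 e e0.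
have small q : (0 < q)%N -> \forall r \near 0^'+, `|(r%:C ^+ q : C)| * M < e.
  move=> q0; have c0 : (fun r : R => r%:C ^+ q : Co) @ 0^'+ --> ((0 : R)%:C ^+ q : Co).
    exact: (cvg_exp (cvg_real_complex (cvg_at_right_filter (f := id) cvg_id))).
  have eM : 0 < e / M by rewrite divr_gt0.
  have : \forall r \near 0^'+, `|(r%:C ^+ q : C) - ((0 : R)%:C ^+ q : C)| < e / M.
    exact: cvgC_dist c0 eM.
  apply: filterS => r.
  have -> : (0 : R)%:C ^+ q = 0 :> C by rewrite expr0n eqn0Ngt q0.
  by rewrite subr0 ltr_pdivlMr.
have [r [r0 rd s1 s2 [k1 k2]]] : exists r : R, [/\ 0 < r, r < d, `|(r%:C ^+ Q.1 : C)| * M < e,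
    `|(r%:C ^+ Q.2 : C)| * M < e &
    complex.Re (mixed_eval k (r%:C ^+ Q.1 * W1 (r, t1)) (r%:C ^+ Q.2 * W2 (r, t1))) < 0 /\
    0 < complex.Re (mixed_eval k (r%:C ^+ Q.1 * W1 (r, t2)) (r%:C ^+ Q.2 * W2 (r, t2)))].
  apply: (@filter_ex _ (0 : R)^'+); near=> r; split.
  - by near: r; exact: nbhs_right_gt.
  - by near: r; exact: nbhs_right_lt.
  - by near: r; exact: small.
  - by near: r; exact: small.
  - by split; near: r.
have rd' : `|r| < d by rewrite gtr0_norm.
have sl (W : R * R -> Co) t : {for (r, t), continuous W} -> (fun s => W (r, s)) @ t --> W (r, t).
  move=> cW; apply: (@cvg_comp _ _ _ (fun s => (r, s)) W (nbhs t) (nbhs (r, t))) => //.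
  exact: (cvg_pair (f := fun=> r) (g := id) (cvg_cst r) cvg_id).
pose F t := complex.Re (mixed_eval k (r%:C ^+ Q.1 * W1 (r, t)) (r%:C ^+ Q.2 * W2 (r, t))).
have [t td Ft] : exists2 t, `|t - t0| < d & F t = 0.
  apply: (@sign_change_zero F t0 d t1 t2) => // t td.
  have [c1 c2 _ _ _] := HW r t rd' td.
  apply: cvg_Re; apply: cvg_ev.
    exact: (cvgM (cvg_cst (r%:C ^+ Q.1 : Co)) (sl _ _ c1)).
  exact: (cvgM (cvg_cst (r%:C ^+ Q.2 : Co)) (sl _ _ c2)).
have [_ _ b1 b2 /(_ r0)[W0 gz]] := HW r t rd' td.
exists (r%:C ^+ Q.1 * W1 (r, t)), (r%:C ^+ Q.2 * W2 (r, t)).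
have rn0 q : r%:C ^+ q != 0 :> C.
  by rewrite expf_neq0 //; apply: contraTneq r0 => /complexI ->; rewrite ltxx.
split.
- by rewrite !mulf_eq0 !negb_or !rn0.
- by rewrite normrM; apply: le_lt_trans s1; rewrite ler_wpM2l.
- by rewrite normrM; apply: le_lt_trans s2; rewrite ler_wpM2l.
- exact: gz.
- by rewrite [LHS]complexE kR -/(F t) Ft mulr0 addr0.
Unshelve. all: by end_near. Qed.

Lemma Re_real_mul (x : R) (z : C) : complex.Re (x%:C * z) = x * complex.Re z.
Proof. by case: z => a b /=; rewrite mul0r subr0. Qed.

Lemma Re_scal_sign k Q (r : R) (u v : C) : 0 < r ->
  complex.Re (mixed_eval k (r%:C ^+ Q.1 * u) (r%:C ^+ Q.2 * v)) =
  r ^+ min_rdeg Q k * complex.Re (scal Q k r u v).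
Proof. by move=> r0; rewrite scalE -rmorphXn Re_real_mul. Qed.

(** The rescaled polynomials [scal Q g r] tend to the face function of [g], and their roots
    near the simple root [U t0] form a branch [W] over a neighbourhood of [(0, t0)] in the
    plane of the [(r, t)]. A zero of the face function of [k] that is not a local extremum
    has points of both signs nearby, and the signs persist for small [r]. *)
Lemma cluster_branch g k Q t0 (U : R -> Co) : u_semiholomorphic g ->
  (forall u v, complex.Im (mixed_eval k u v) = 0) -> positive_weight Q ->
  continuous U -> (forall t, mixed_eval (weight_face Q g) (U t) (expi t) = 0) ->
  mixed_eval (d_u (weight_face Q g)) (U t0) (expi t0) <> 0 ->
  mixed_eval (weight_face Q k) (U t0) (expi t0) = 0 ->
  ~ local_extremum (fun t => complex.Re (mixed_eval (weight_face Q k) (U t) (expi t))) t0 ->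
  zeros_cluster g k.
Proof.
move=> gh kR Qpos cU HU dU k0 next.
pose p (z : R * R) := spoly Q g 0 z.1 (expi z.2).
have size_p z : (size (p z) <= (\sum_(m <- supp g) m iu).+1)%N by exact: size_spoly.
have cfst (z : R * R) : fst @ z --> z.1 by exact: cvg_fst.
have csnd (z : R * R) : snd @ z --> z.2 by exact: cvg_snd.
have cexpi (z : R * R) : (fun x : R * R => expi x.2 : Co) @ z --> (expi z.2 : Co).
  exact: (@continuous_comp _ _ _ snd (@expi R : R -> Co) z (csnd z) (@continuous_expi R _)).
have coef_p j : continuous (fun z => (p z)`_j : Co).
  move=> z; apply: cvg_coef_spoly; [exact: cfst|exact: cexpi].
have pE z u : (p z).[u] = scal Q g z.1 u (expi z.2) by exact: horner_spoly.
have r0 : (p (0, t0)).[U t0] = 0 by rewrite pE scal0 HU.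
have dr0 : (p (0, t0))^`().[U t0] != 0.
  have fh := semihol_subsum (S := fun m => rdeg Q m == min_rdeg Q g) gh.
  have := upoly_face (expi t0) gh (a := 0%N) (P := Q) (fun m _ => leq0n _).
  rewrite expr0 mul1r => pu; rewrite /p -pu deriv_upoly // horner_upoly; last exact: semihol_deriv.
  exact/eqP.
have [A [W [r [[Ao As Ws r_gt0] HW Wu]]]] := local_branch size_p coef_p r0 dr0.
have Wc : {for (0, t0), continuous W} by have [] := HW _ As.
have near_A : \forall z \near ((0, t0) : R * R), A z /\ `|(W z : C) - U t0| < 1.
  apply: filterI; first exact: open_nbhs_nbhs.
  have : \forall z \near ((0, t0) : R * R), `|(W z : C) - (W (0, t0) : C)| < 1.
    exact: cvgC_dist Wc ltr01.
  by apply: filterS => z; rewrite Ws.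
have [d1 /= d1_gt0 Hd1] := (nbhs_ballP _ _).1 near_A.
have near_U : \forall t \near t0, `|(U t : C) - U t0| < r by exact: (cvgC_dist (cU t0) r_gt0).
have [d2 /= d2_gt0 Hd2] := (nbhs_ballP _ _).1 near_U.
pose d := Num.min d1 d2.
have d_gt0 : 0 < d by rewrite lt_min d1_gt0.
have box s t : `|s| < d -> `|t - t0| < d -> A (s, t) /\ `|(W (s, t) : C) - U t0| < 1.
  rewrite !lt_min => /andP[sd _] /andP[td _]; apply: Hd1; split.
    by rewrite -ball_normE /= sub0r normrN.
  by rewrite -ball_normE /= distrC.
have n0 : `|0 : R| < d by rewrite normr0.
have WU t : `|t - t0| < d -> W (0, t) = U t.
  move=> td; have [At _] := box 0 t n0 td.
  apply/esym/(Wu _ _ At); last by rewrite pE scal0 HU.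
  by apply: Hd2; rewrite -ball_normE /= distrC; move: td; rewrite lt_min => /andP[].
pose F t := complex.Re (mixed_eval (weight_face Q k) (U t) (expi t)).
have F0 : F t0 = 0 by rewrite /F k0.
have [t1 [t2 [t1d t2d F1 F2]]] := not_extremum F0 next d_gt0.
pose W2 (z : R * R) : Co := expi z.2.
have lim t : `|t - t0| < d ->
    (fun s : R => complex.Re (scal Q k s (W (s, t)) (expi t))) @ 0^'+ --> F t.
  move=> td; have [At _] := box 0 t n0 td; have [_ cW] := HW _ At.
  rewrite /F -(WU _ td) -scal0; apply: cvg_at_right_filter.
  apply: cvg_Re; apply: cvg_scal; [exact: cvg_id| |exact: cvg_cst].
  apply: (@cvg_comp _ _ _ (fun s => (s, t)) W (nbhs 0) (nbhs (0, t))) => //.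
  exact: (cvg_pair (f := id) (g := fun=> t) cvg_id (cvg_cst t)).
have M0 : 0 < `|U t0 : C| + 1 by rewrite ltr_wpDl.
refine (@cluster_box g k Q W W2 (`|U t0 : C| + 1) t0 d t1 t2 Qpos kR d_gt0 M0 t1d t2d _ _ _).
- move=> s t sd td; have [At Wd] := box s t sd td; have [pz cW] := HW _ At; split.
  + exact: cW.
  + exact: cexpi.
  + rewrite -[W (s, t) : C](subrK (U t0 : C)) addrC.
    apply: le_trans (ler_normD _ _) _; rewrite lerD2l; exact: ltW.
  + have -> : `|W2 (s, t) : C| = 1.
      by apply/eqP; rewrite -(@eqrXn2 _ 2) // sqr_normc expi_norm expr1n.
    by rewrite lerDr.
  + move=> s0; split; first by rewrite expi_neq0 orbT.
    by rewrite scalE -[s]/((s, t).1) -/(W2 (s,t)) -pE pz mulr0.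
- have := lim _ t1d => /(cvgr_lt (F t1)) /(_ 0 F1) H.
  near=> s; have s0 : 0 < s by near: s; exact: nbhs_right_gt.
  rewrite Re_scal_sign // pmulr_rlt0 ?exprn_gt0 //.
  by near: s.
- have := lim _ t2d => /(cvgr_gt (F t2)) /(_ 0 F2) H.
  near=> s; have s0 : 0 < s by near: s; exact: nbhs_right_gt.
  rewrite Re_scal_sign // pmulr_rgt0 ?exprn_gt0 //.
  by near: s.
Unshelve. all: by end_near. Qed.

End Accumulation.

(** * Degenerate weights produce singular points *)

Section FaceLemmas.
Variable R : realType.
Implicit Types (h k : mixed R) (m : mpoly.multinom 4) (u v : R[i]) (P Q : nat * nat).

(** By radial homogeneity, zeros of face functions may be sought with [|v| = 1], which is
    where the slices of the statement live. *)
Lemma normalize_v P u v : positive_weight P -> v != 0 -> exists (r : R) t,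
  [/\ 0 < r, r%:C ^+ P.2 * v = expi t &
  forall h, mixed_eval (weight_face P h) u v = 0 ->
    mixed_eval (weight_face P h) (r%:C ^+ P.1 * u) (expi t) = 0].
Proof.
move=> /andP[_ p2] v0.
have [n nE n0] : exists2 n : R, `|v| = n%:C & 0 < n.
  have : 0 < `|v| by rewrite normr_gt0.
  by case: (`|v|) => n1 n2; rewrite ltcE /= => /andP[/eqP -> n1_gt0]; exists n1.
pose r := n^-1 `^ (P.2%:R^-1).
have r0 : 0 < r by rewrite powR_gt0 // invr_gt0.
have rP : r ^+ P.2 = n^-1.
  rewrite -powR_mulrn ?ltW // -powRrM mulVf ?powRr1 ?invr_ge0 ?ltW //.
  by rewrite pnatr_eq0 -lt0n.
have [t tE] : exists t, r%:C ^+ P.2 * v = expi t.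
  apply: expiP; rewrite normrM nE -rmorphXn rP normc_def /= expr0n addr0 sqrtr_sqr.
  rewrite ger0_norm ?invr_ge0 ?ltW // -rmorphM /= mulVf //; exact: lt0r_neq0.
by exists r, t; split=> // h h0; rewrite -tE face_scale h0 mulr0.
Qed.

Lemma ev_part_supp (S : pred (mpoly.multinom 4)) h e u v :
  (forall m, mexp m = e -> S m) -> mixed_eval (part (subsum h S) e) u v = mixed_eval (part h e) u v.
Proof.
move=> HS; rewrite !ev_subsum (big_supp_subsum h S (fun m => mexp m == e) (mon u v)).
by apply: eq_bigl => m; case: eqP => [/HS ->|]; rewrite ?andbF.
Qed.

(** The support of [h(0, v)] lies on one axis: its face is a point, whatever the weight. *)
Lemma set_u0_vertex P h m0 : positive_weight P -> m0 \in supp h -> (mexp m0).1 = 0%N ->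
  (forall m, m \in supp h -> (mexp m).1 = 0%N -> ((mexp m0).2 <= (mexp m).2)%N) ->
  forall u v, mixed_eval (weight_face P (set_u0 h)) u v = mixed_eval (part h (mexp m0)) u v.
Proof.
move=> /andP[_ p2] m0h a0 Hb u v.
have m0s : m0 \in supp (set_u0 h) by rewrite set_u0E mem_supp_subsum m0h; apply/eqP.
have f0 : on_face P (set_u0 h) m0.
  split=> // m; rewrite set_u0E mem_supp_subsum => /andP[mh /eqP a].
  by rewrite /rdeg a0 a !muln0 !add0n leq_pmul2l // Hb.
rewrite (face_part f0) => [|m fm].
  by rewrite set_u0E; apply: ev_part_supp => m ->; apply/eqP.
have := on_face_rdeg fm; rewrite -(on_face_rdeg f0).
have := fm.1; rewrite set_u0E mem_supp_subsum => /andP[mh /eqP a].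
rewrite /rdeg a0 a !muln0 !add0n => /eqP; rewrite eqn_pmul2l // => /eqP E.
by rewrite [mexp m]surjective_pairing [mexp m0]surjective_pairing a a0 E.
Qed.

Lemma face_axis_witness Q h v0 : mixed_eval (weight_face Q h) 0 v0 != 0 ->
  exists2 m0, on_face Q h m0 & (mexp m0).1 = 0%N.
Proof.
move=> N0; apply: contrapT => Hn; case/negP: N0; apply/eqP; rewrite evE big1_seq // => m.
move=> /andP[_ /on_faceP Hm]; have [a0|a0] := eqVneq (mexp m).1 0%N.
  by case: Hn; exists m.
by rewrite mon_u0 ?mulr0.
Qed.

Lemma face_set_u0 Q P h v0 : positive_weight Q -> positive_weight P ->
  mixed_eval (weight_face Q h) 0 v0 != 0 ->
  forall u v, mixed_eval (weight_face P (set_u0 h)) u v = mixed_eval (weight_face Q h) 0 v.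
Proof.
move=> /andP[q1 q2] Ppos /face_axis_witness[m0 f0 a0] u v.
rewrite (face_axis_ev0 _ q2 f0 a0) (set_u0_vertex Ppos f0.1 a0) => [|m mh a].
  exact: ev_part0.
by have := f0.2 _ mh; rewrite /rdeg a0 a !muln0 !add0n leq_pmul2l.
Qed.

Lemma mexp0P m : mexp m = (0, 0)%N -> m = @mpoly.mnm0 4.
Proof.
rewrite /mexp => -[/eqP + /eqP]; rewrite !addn_eq0.
move=> /andP[/eqP a /eqP b] /andP[/eqP c /eqP d].
by apply: meqP; rewrite a b c d !mpoly.mnm0E.
Qed.

Lemma mexp0 : mexp (@mpoly.mnm0 4) = (0, 0)%N.
Proof. by rewrite /mexp !mpoly.mnm0E. Qed.

Lemma big_const_term h (F : mpoly.multinom 4 -> R[i]) : F (@mpoly.mnm0 4) = 1 ->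
  (forall m, mexp m <> (0, 0)%N -> F m = 0) ->
  \sum_(m <- supp h) coef m h * F m = coef (@mpoly.mnm0 4) h.
Proof.
move=> F1 F0; have [m0h|m0h] := boolP (@mpoly.mnm0 4 \in supp h).
  rewrite (bigD1_seq _ m0h) ?mpoly.msupp_uniq //= F1 mulr1 big1 ?addr0 // => m /eqP ne.
  by rewrite F0 ?mulr0 // => /mexp0P.
rewrite (mpoly.memN_msupp_eq0 m0h) big1_seq // => m /andP[_ mh].
by rewrite F0 ?mulr0 // => /mexp0P mE; rewrite mE (negbTE m0h) in mh.
Qed.

Lemma mon_const u v : mon u v (@mpoly.mnm0 4) = 1.
Proof. by rewrite /mon !mpoly.mnm0E !expr0 !mulr1. Qed.

Lemma ev_origin h : mixed_eval h 0 0 = coef (@mpoly.mnm0 4) h.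
Proof.
rewrite evE; apply: big_const_term => [|m ne]; first exact: mon_const.
have [a0|a0] := eqVneq (mexp m).1 0%N; last by rewrite mon_u0.
have [b0|b0] := eqVneq (mexp m).2 0%N; last by rewrite mon_v0.
by case: ne; rewrite [mexp m]surjective_pairing a0 b0.
Qed.

(** The exponent of a nonzero constant term is a corner of the support. *)
Lemma face_const P h u v : positive_weight P ->
  mixed_eval (weight_face P h) u v = 0 -> mixed_eval h 0 0 = 0.
Proof.
move=> Ppos h0; rewrite ev_origin; apply/eqP; rewrite mpoly.mcoeff_eq0; apply/negP => m0h.
have Hc : corner h (@mpoly.mnm0 4) by split=> // m _; rewrite mexp0.
have [_ f0 Hu] := corner_vertex Ppos Hc.
move: h0; rewrite (face_part f0 Hu) mexp0 ev_subsum big_mkcond.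
rewrite (eq_bigr (fun m => coef m h * (if mexp m == (0, 0)%N then mon u v m else 0))).
  rewrite big_const_term ?mexp0 ?eqxx ?mon_const //.
    by move/eqP; apply/negP; rewrite -mpoly.mcoeff_msupp.
  by move=> m /eqP/negbTE ->.
by move=> m _; case: ifP; rewrite ?mulr0.
Qed.

End FaceLemmas.

(** Below, [g] and [k] stand for [f_u] and [s3 f]; [v_axis] covers the case in
    which [f] starts with a linear term in [v], [v^c] that no hypothesis on extrema reaches. *)
Section Core.
Variables (R : realType) (f g k : mixed R).
Local Notation Co := (R[i]^o).
Implicit Types (m : mpoly.multinom 4) (u v : R[i]) (P Q : nat * nat).

Definition shift m := mpoly.mnm_add m (mpoly.mnm1 iu).

Hypothesis f_neq0 : f != 0.
Hypothesis f_origin : mixed_eval f 0 0 = 0.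
Hypothesis g_semihol : u_semiholomorphic g.
Hypothesis supp_shift : forall m, m \in supp g -> shift m \in supp f.
Hypothesis supp_unshift : forall m, m \in supp f -> (mexp m).1 != 0%N ->
  exists2 m', m' \in supp g & m = shift m'.
Hypothesis g_ind : inner_nondegenerate g.
Hypothesis k_real : forall u v, complex.Im (mixed_eval k u v) = 0.
Hypothesis k_extrema : forall P, newton_weight f P -> forall U : R -> Co, continuous U ->
  (forall t, mixed_eval (weight_face P g) (U t) (expi t) = 0) -> forall t0,
  local_extremum (fun t => complex.Re (mixed_eval (weight_face P k) (U t) (expi t))) t0 ->
  mixed_eval (weight_face P k) (U t0) (expi t0) != 0.
Hypothesis v_axis : set_v0 g = 0 -> (exists2 m, m \in supp f & mexp m = (0, 1)%N) ->
  mixed_eval k 0 0 = 0 -> zeros_cluster g k.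

Lemma mexp_shift m : mexp (shift m) = ((mexp m).1.+1, (mexp m).2).
Proof.
rewrite /mexp !mpoly.mnmDE !mpoly.mnm1E /= !addn0 addn1 addSn //.
Qed.

Lemma rdeg_shift Q m : rdeg Q (shift m) = (Q.1 + rdeg Q m)%N.
Proof. by rewrite /rdeg mexp_shift /=; lia. Qed.

(** [Q] is the weight of an edge of [f_u]. If it also is one of [f], the hypothesis on
    extrema applies to the branch of roots through [w0]. Otherwise the [Q]-face of [f] is a
    point of the axis [e.1 = 0], because taking [f_u] only loses monomials on that axis. If
    the support of [f] has lower points, the next edge of [f] has a flatter weight [Q1] for
    which [u = 0] is a root; at this root the face function of [k] is not identically zero, as
    it would have an extremum with value zero, hence it equals that for [Q] by [face_axis], and
    the hypothesis on extrema for [Q1] concludes. If there are no lower points, [f] has no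
    monomial free of [v], and its lowest vertex is [v] or [v^c]. *)
Lemma core Q w0 t0 : positive_weight Q -> edge g Q ->
  w0 != 0 \/ (exists2 m0, on_face Q g m0 & (mexp m0).1 = 0%N) ->
  mixed_eval (weight_face Q g) w0 (expi t0) = 0 ->
  mixed_eval (weight_face Q k) w0 (expi t0) = 0 -> zeros_cluster g k.
Proof.
move=> Qpos eQ Hw0 gw0 kw0; have /andP[q1 q2] := Qpos.
have [U [cU Ut0 HU]] := edge_branch g_semihol g_ind Qpos eQ Hw0 gw0.
have dU := edge_root_simple g_semihol g_ind Qpos eQ (expi_neq0 t0) Hw0 gw0.
rewrite -Ut0 in dU kw0.
have concl := cluster_branch g_semihol k_real Qpos cU HU dU kw0.
move=> {dU}.
have [eF|neF] := pselect (edge f Q).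
  apply: concl => ext; have nw := newton_weight_reduce Qpos eF.
  have := k_extrema nw cU; rewrite !weight_face_reduce // => /(_ HU _ ext).
  by rewrite kw0 eqxx.
have [n [n' [fn fn' ne]]] := eQ.
have axis m : on_face Q f m -> (mexp m).1 = 0%N.
  move=> fm; apply/eqP/negPn/negP => a0; apply: neF.
  have [m' m'g mE] := supp_unshift fm.1 a0; subst m.
  have fm' : on_face Q g m'.
    split; first exact: m'g.
    by move=> x /supp_shift/fm.2; rewrite !rdeg_shift leq_add2l.
  have up x : on_face Q g x -> on_face Q f (shift x).
    move=> fx; apply: on_face_eq fm (supp_shift fx.1) _.
    by rewrite !rdeg_shift (on_face_rdeg fx) (on_face_rdeg fm').
  exists (shift n), (shift n'); split; [exact: up|exact: up|].
  rewrite !mexp_shift => E; apply: ne; move: E.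
  by case: (mexp n) (mexp n') => x y [z w] [-> ->].
have [m0 f0] := on_face_ex Q f_neq0; have a0 := axis _ f0.
have [[m1 m1f lt1]|NR] := pselect (exists2 m1, m1 \in supp f & ((mexp m1).2 < (mexp m0).2)%N).
  have [Q1 [m2 [Q1pos f01 fm2 lt2 le]]] := rotate_right Qpos f0 m1f lt1.
  have /andP[r1 r2] := Q1pos.
  have fl : flatter Q1 Q.
    rewrite /flatter ltn_neqAle le andbT; apply/eqP => E.
    have E1 : rdeg Q1 m2 = rdeg Q1 m0 by rewrite (on_face_rdeg fm2) (on_face_rdeg f01).
    have a2 : (mexp m2).1 = 0%N.
      apply: axis; apply: on_face_eq f0 fm2.1 _; move: E1; rewrite /rdeg a0.
      case: (mexp m2) => x y; case: (mexp m0) => z w /=; rewrite !muln0 !add0n => E1.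
      apply/eqP; rewrite -(eqn_pmul2l r2); apply/eqP; nia.
    move: E1 lt2; rewrite /rdeg a0 a2 !muln0 !add0n => /eqP.
    by rewrite eqn_pmul2l // => /eqP ->; rewrite ltnn.
  have eF1 : edge f Q1 by exists m0, m2; split=> // E; rewrite E ltnn in lt2.
  have [n1 [fn1 a1]] : exists n1, on_face Q g n1 /\ (0 < (mexp n1).1)%N.
    have [an|an] := posnP (mexp n).1; last by exists n.
    have [an'|an'] := posnP (mexp n').1; last by exists n'.
    case: ne; have := on_face_rdeg fn; rewrite -(on_face_rdeg fn') /rdeg an an' !muln0 !add0n.
    move=> /eqP; rewrite eqn_pmul2l // => /eqP E.
    by rewrite [mexp n]surjective_pairing [mexp n']surjective_pairing an an' E.
  have zero t : mixed_eval (weight_face Q1 g) 0 (expi t) = 0.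
    rewrite evE big1_seq // => m /andP[_ /on_faceP fm].
    by rewrite mon_u0 ?mulr0 // -lt0n (leq_trans a1) // (flatter_ge r2 fl fn1 fm).
  have cst0 : continuous (fun _ : R => 0 : Co) by move=> t; exact: cvg_cst.
  have nw := newton_weight_reduce Q1pos eF1.
  have := k_extrema nw cst0; rewrite !weight_face_reduce // => /(_ zero) Hext.
  have [s Ns] : exists s, mixed_eval (weight_face Q1 k) 0 (expi s) != 0.
    apply: contrapT => Hn.
    have z s : mixed_eval (weight_face Q1 k) 0 (expi s) = 0.
      by apply/eqP/negPn/negP => ?; apply: Hn; exists s.
    have := Hext t0; rewrite z eqxx => H0.
    by have : false by apply: H0; left; apply: filterE => t; rewrite !z.
  have kE := face_axis Q1pos q2 fl Ns.
  apply: concl; under eq_fun do rewrite kE.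
  by move=> /Hext; rewrite -(kE (U t0)) kw0 eqxx.
have Hb m : m \in supp f -> ((mexp m0).2 <= (mexp m).2)%N.
  by move=> mf; rewrite leqNgt; apply/negP => lt; apply: NR; exists m.
have b0 : (0 < (mexp m0).2)%N.
  rewrite lt0n; apply/eqP => b0.
  have m0E : m0 = @mpoly.mnm0 4.
    by apply: mexp0P; rewrite [mexp m0]surjective_pairing a0 b0.
  by have := f0.1; rewrite m0E mpoly.mcoeff_msupp -ev_origin f_origin eqxx.
have gv0 : set_v0 g = 0.
  apply/mpoly.mpolyP => m; rewrite mpoly.mcoeff0 set_v0E coef_subsum.
  case: eqP => // bm; apply: mpoly.memN_msupp_eq0; apply/negP => /supp_shift/Hb.
  rewrite mexp_shift => H; have {H} : ((mexp m0).2 <= (mexp m).2)%N := H.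
  by rewrite bm leqNgt b0.
apply: (v_axis gv0); last exact: face_const Qpos kw0.
exists m0; first exact: f0.1.
have [a [_ ab]] := bottom_coefs g_semihol g_ind gv0.
have [n0 n0g n0b] : exists2 n0, n0 \in supp g & (mexp n0).2 = 1%N.
  have [mg|mg] := boolP (mv a \in supp g); first by exists (mv a); rewrite ?mexp_mv.
  have [mg'|mg'] := boolP (mvb a \in supp g); first by exists (mvb a); rewrite ?mexp_mvb.
  by case: ab; rewrite (mpoly.memN_msupp_eq0 mg) (mpoly.memN_msupp_eq0 mg') !mul0r.
have := Hb _ (supp_shift n0g); rewrite mexp_shift => H.
have {H} b1 : ((mexp m0).2 <= (mexp n0).2)%N := H; rewrite n0b in b1.
rewrite [mexp m0]surjective_pairing a0; congr (_, _).
by apply/eqP; rewrite eqn_leq b1 b0.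
Qed.

(** When the coefficient of a vertex on the axis [e.1 = 0] vanishes at [expi t0], the edge
    below the vertex has the root [u = 0] there, to which [core] applies. *)
Lemma case_vertex P m0 u t0 : vertex_at g P m0 -> (mexp m0).1 = 0%N ->
  mixed_eval (part g (mexp m0)) u (expi t0) = 0 ->
  (forall Q, positive_weight Q -> flatter Q P ->
    mixed_eval (weight_face Q k) 0 (expi t0) = 0) -> zeros_cluster g k.
Proof.
move=> V a0 gz kz; have [Ppos f0 Hu] := V.
have [m1 m1g lt1] := lower_exists g_semihol g_ind V a0 (expi_neq0 t0) gz.
have [Q [m2 [Qpos f02 fm2 lt2 le]]] := rotate_right Ppos f0 m1g lt1.
have /andP[q1 q2] := Qpos; have /andP[p1 p2] := Ppos.
have fl : flatter Q P.
  rewrite /flatter ltn_neqAle le andbT; apply/eqP => E.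
  have E1 : rdeg Q m2 = rdeg Q m0 by rewrite (on_face_rdeg fm2) (on_face_rdeg f02).
  have : mexp m2 = mexp m0.
    apply: Hu; apply: on_face_eq f0 fm2.1 _; move: E1; rewrite /rdeg a0.
    case: (mexp m2) => x y; case: (mexp m0) => z w /=; rewrite !muln0 !add0n => E1.
    apply/eqP; rewrite -(eqn_pmul2l q2); apply/eqP; nia.
  by move=> E2; rewrite E2 ltnn in lt2.
apply: (@core Q 0 t0) => //.
- by exists m0, m2; split=> // E; rewrite E ltnn in lt2.
- by right; exists m0.
- by rewrite (face_axis_ev0 _ q2 f02 a0) (ev_part0 _ _ u).
- exact: kz.
Qed.

(** By [vertex_coef_neq0], a zero of a vertex can only occur on the axis [e.1 = 0]. If the
    face function of [k] for a flatter weight did not vanish at [u = 0], it would be that for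
    [P], by [face_axis]. *)
Lemma case_torus P u v : positive_weight P -> u != 0 -> v != 0 ->
  mixed_eval (weight_face P g) u v = 0 -> mixed_eval (weight_face P k) u v = 0 ->
  zeros_cluster g k.
Proof.
move=> Ppos u0 v0 gz kz; have [r [t [r0 _ H]]] := normalize_v u Ppos v0.
have {}gz := H _ gz; have {}kz := H _ kz.
have w0 : r%:C ^+ P.1 * u != 0.
  rewrite mulf_neq0 // expf_neq0 //; apply: contraTneq r0 => /complexI ->.
  by rewrite ltxx.
move: (r%:C ^+ P.1 * u) w0 gz kz => w w0 gz kz {H}.
have [eP|neP] := pselect (edge g P); first by apply: (core Ppos eP _ gz kz); left.
have g0 : g != 0 by case: g_ind.
have [m0 f0] := on_face_ex P g0.
have V : vertex_at g P m0.
  by split=> // m fm; apply: contrapT => ne; apply: neP; exists m, m0.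
have gp : mixed_eval (part g (mexp m0)) w (expi t) = 0.
  by rewrite -(face_part f0) //; case: V.
have a0 : (mexp m0).1 = 0%N.
  apply/eqP; rewrite -leqn0 leqNgt; apply/negP => a0.
  exact: (vertex_coef_neq0 g_semihol g_ind V a0 w0 (expi_neq0 t) gp).
apply: (case_vertex V a0 gp) => Q Qpos fl; apply/eqP/negPn/negP => N0.
have p2 : (0 < P.2)%N by case/andP: Ppos.
by have /eqP := face_axis Qpos p2 fl N0 w (expi t); rewrite kz eq_sym (negbTE N0).
Qed.

(** If [f_u] vanishes on [u = 0], then [u = 0] is a root for every weight of [f], and the
    curve of the intermediate value theorem stays on the axis. Otherwise [f_u (0, v)] is
    the leftmost vertex of [f_u] up to higher order terms, and [case_vertex] applies. *)
Lemma case_u_axis P u v : positive_weight P -> v != 0 ->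
  mixed_eval (weight_face P (set_u0 g)) u v = 0 ->
  mixed_eval (weight_face P (set_u0 k)) u v = 0 -> zeros_cluster g k.
Proof.
move=> Ppos v0 gz kz; have [r [t [r0 _ H]]] := normalize_v u Ppos v0.
have {}gz := H _ gz; have {}kz := H _ kz.
move: (r%:C ^+ P.1 * u) gz kz => w gz kz {H}.
have kQ Q : positive_weight Q -> mixed_eval (weight_face Q k) 0 (expi t) = 0.
  move=> Qpos; apply/eqP/negPn/negP => N0.
  by have /eqP := face_set_u0 Qpos Ppos N0 w (expi t); rewrite kz eq_sym (negbTE N0).
have [gu0|gu0] := eqVneq (set_u0 g) 0.
  have zero Q s : mixed_eval (weight_face Q g) 0 s = 0.
    rewrite ev_subsum big1_seq // => m /andP[_ mg]; rewrite mon_u0 ?mulr0 //.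
    apply/negP => am; have : m \in supp (set_u0 g) by rewrite set_u0E mem_supp_subsum mg.
    by rewrite gu0 mpoly.msupp0.
  have zerog s : mixed_eval g 0 s = 0 by rewrite -(ev_set_u0 _ 0) gu0 ev0.
  have [Q [Qpos nw]] : exists Q, positive_weight Q /\ newton_weight f Q.
    have [[F oF]|nF] := pselect (exists F, one_face f F); last first.
      by exists (1, 1)%N; split=> //; right.
    have [Q Qpos eQ] := one_face_edge f_neq0 oF.
    by exists (reduce Q); split; [exact: reduce_pos|exact: newton_weight_reduce].
  have cst0 : continuous (fun _ : R => 0 : Co) by move=> s; exact: cvg_cst.
  have Hext := k_extrema nw cst0 (fun s => zero Q (expi s)) (t0 := t).
  pose F s := complex.Re (mixed_eval (weight_face Q k) 0 (expi s)).
  have F0 : F t = 0 by rewrite /F kQ.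
  have [|t1 [t2 [d1 d2 F1 F2]]] := not_extremum F0 _ ltr01.
    by move=> /Hext; rewrite kQ // eqxx.
  have lim s : (fun r : R => complex.Re (scal Q k r 0 (expi s))) @ 0^'+ --> F s.
    rewrite /F -scal0; apply: cvg_at_right_filter.
    by apply: cvg_Re; apply: cvg_scal; [exact: cvg_id|exact: cvg_cst|exact: cvg_cst].
  refine (@cluster_box _ g k Q (fun=> 0) (fun z => expi z.2) 1 t 1 t1 t2 Qpos k_real
    ltr01 ltr01 d1 d2 _ _ _).
  - move=> x s xd sd; split.
    + exact: cvg_cst.
    + exact: (@continuous_comp _ _ _ snd (@expi R : R -> Co) (x, s) cvg_snd (@continuous_expi R _)).
    + by rewrite normr0.
    + by rewrite -(@ler_pXn2r _ 2) ?nnegrE // sqr_normc expi_norm expr1n.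
    + by move=> x0; rewrite expi_neq0 orbT mulr0 zerog.
  - have := lim t1 => /(cvgr_lt (F t1)) /(_ 0 F1) H.
    near=> x; have x0 : 0 < x by near: x; exact: nbhs_right_gt.
    rewrite Re_scal_sign // pmulr_rlt0 ?exprn_gt0 //.
    by near: x.
  - have := lim t2 => /(cvgr_gt (F t2)) /(_ 0 F2) H.
    near=> x; have x0 : 0 < x by near: x; exact: nbhs_right_gt.
    rewrite Re_scal_sign // pmulr_rgt0 ?exprn_gt0 //.
    by near: x.
have [m0 f0] := on_face_ex P gu0; have := f0.1.
rewrite set_u0E mem_supp_subsum => /andP[m0g /eqP a0]; have /andP[_ p2] := Ppos.
have Hb m : m \in supp g -> (mexp m).1 = 0%N -> ((mexp m0).2 <= (mexp m).2)%N.
  move=> mg am; have : m \in supp (set_u0 g) by rewrite set_u0E mem_supp_subsum mg am.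
  by move=> /(f0.2); rewrite /rdeg a0 am !muln0 !add0n leq_pmul2l.
rewrite (set_u0_vertex Ppos m0g a0 Hb) in gz.
(* The weight of [u] is so large that [m0] precedes all exponents off the axis. *)
pose P' := ((mexp m0).2.+1, 1)%N.
have key m : m \in supp g -> (rdeg P' m0 <= rdeg P' m)%N /\
    (rdeg P' m <= rdeg P' m0 -> mexp m = mexp m0)%N.
  move=> mg; have := Hb _ mg; rewrite /P' /rdeg; move: a0.
  case: (mexp m) => x y; case: (mexp m0) => z b /= -> H.
  have [x0|x0] := posnP x; last by split=> [|?]; [nia|exfalso; nia].
  by subst x; have := H erefl; split; [lia|move=> ?; congr (_, _); lia].
have V : vertex_at g P' m0.
  split=> //; first by split=> // m /key[].
  by move=> m [mg Hm]; apply: (key _ mg).2; apply: Hm.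
by apply: (case_vertex V a0 gz) => Q Qpos _; exact: kQ.
Unshelve. all: by end_near. Qed.

End Core.

(** * The axis v = 0 *)

Section VAxis.
Variables (R : realType) (f : mixed R).
Local Notation C := R[i].
Local Notation Co := (R[i]^o).
Hypothesis f_semihol : u_semiholomorphic f.
Hypothesis g_ind : inner_nondegenerate (d_u f).
Implicit Types (m : mpoly.multinom 4) (u v : C).

Let g_semihol : u_semiholomorphic (d_u f). Proof. exact: semihol_deriv. Qed.

(** For [mu = mv] this is [f_v (u, 0)] as a polynomial in [u], for [mu = mvb] it is
    [f_vb (u, 0)]. *)
Definition restriction (mu : nat -> mpoly.multinom 4) : {poly C} :=
  \sum_(m <- supp f | m == mu (m iu)) coef m f *: 'X^(m iu).

Lemma coef_restriction (mu : nat -> mpoly.multinom 4) j : (forall j, mu j iu = j) -> (restriction mu)`_j = coef (mu j) f.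
Proof.
move=> muE; rewrite /restriction coef_sum.
under eq_bigr do rewrite coefZ coefXn.
have [mf|mf] := boolP (mu j \in supp f).
  rewrite big_mkcond (bigD1_seq _ mf) ?mpoly.msupp_uniq //= !muE !eqxx mulr1.
  rewrite big1 ?addr0 // => m mj; case: eqP => // mE; case: eqP => [E|_]; rewrite ?mulr0 //.
  by move: mj; rewrite mE -E eqxx.
rewrite (mpoly.memN_msupp_eq0 mf) big1_seq // => m /andP[/eqP mE mh].
by case: eqP => [E|_]; rewrite ?mulr0 //; move: mf; rewrite E -mE mh.
Qed.

Lemma horner_restriction (mu : nat -> mpoly.multinom 4) u : (restriction mu).[u] =
  \sum_(m <- supp f | m == mu (m iu)) coef m f * u ^+ m iu.
Proof. by rewrite /restriction horner_sum; apply: eq_bigr => m _; rewrite hornerZ hornerXn. Qed.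

Let pA := restriction mv.
Let pB := restriction mvb.

Lemma iu_mv j : mv j iu = j. Proof. by have [] := mvE j. Qed.
Lemma iu_mvb j : mvb j iu = j. Proof. by have [] := mvbE j. Qed.

Lemma ev_s3_v0 u : mixed_eval (s3 f) u 0 = pA.[u] * (pA.[u])^c - pB.[u] * (pB.[u])^c.
Proof. by rewrite ev_s3 (ev_dv_v0 _ f_semihol) (ev_dvb_v0 _ f_semihol) !horner_restriction. Qed.

Lemma lower_poly (p : {poly C}) n u : (0 < n)%N -> (forall j, (0 < j < n)%N -> p`_j = 0) ->
  p.[u] = p`_0 + (drop_poly n p).[u] * u ^+ n.
Proof.
move=> n0 H; rewrite -{1}(poly_take_drop n p) hornerD hornerM hornerXn; congr (_ + _).
have -> : take_poly n p = (p`_0)%:P.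
  apply/polyP => j; rewrite coef_take_poly coefC; case: j => [|j]; first by rewrite n0.
  by case: ltnP => // jn; rewrite H.
by rewrite hornerC.
Qed.

Lemma cvg_horner_cst (T : Type) (F : set_system T) {FF : Filter F} (p : {poly C})
  (a : T -> Co) (a0 : Co) : a @ F --> a0 -> (fun t => p.[a t] : Co) @ F --> (p.[a0] : Co).
Proof.
apply: (@cvg_horner _ _ _ _ (size p) (fun=> p) p) => // j; exact: cvg_cst.
Qed.

(** Up to positive factors, [f_u] has the same coefficients at the exponents lowered by one. *)
Lemma first_coefs : set_v0 (d_u f) = 0 -> exists n, [/\ (0 < n)%N,
  forall j, (0 < j < n)%N -> pA`_j = 0, forall j, (0 < j < n)%N -> pB`_j = 0 &
  pA`_n * (pA`_n)^c <> pB`_n * (pB`_n)^c].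
Proof.
move=> gv0; have [a [Ha Hab]] := bottom_coefs g_semihol g_ind gv0.
have add_mv j : mpoly.mnm_add (mv j) (mpoly.mnm1 iu) = mv j.+1.
  have [e1 e2 e3 e4] := mvE j; have [e1' e2' e3' e4'] := mvE j.+1.
  by apply: meqP; rewrite e1' e2' e3' e4' !mpoly.mnmDE !mpoly.mnm1E e1 e2 e3 e4 /= addn1.
have add_mvb j : mpoly.mnm_add (mvb j) (mpoly.mnm1 iu) = mvb j.+1.
  have [e1 e2 e3 e4] := mvbE j; have [e1' e2' e3' e4'] := mvbE j.+1.
  by apply: meqP; rewrite e1' e2' e3' e4' !mpoly.mnmDE !mpoly.mnm1E e1 e2 e3 e4 /= addn1.
have cA j : coef (mv j) (d_u f) = pA`_j.+1 *+ j.+1.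
  by rewrite mpoly.mcoeff_deriv add_mv iu_mv (coef_restriction _ iu_mv).
have cB j : coef (mvb j) (d_u f) = pB`_j.+1 *+ j.+1.
  by rewrite mpoly.mcoeff_deriv add_mvb iu_mvb (coef_restriction _ iu_mvb).
have mulrC2 (x y : C) s : x * x^c = y * y^c -> x *+ s * (x *+ s)^c = y *+ s * (y *+ s)^c.
  by move=> xy; rewrite -[x *+ s]mulr_natr -[y *+ s]mulr_natr !rmorphM mulrACA xy mulrACA.
have mulrn0 (z : C) j : z *+ j.+1 = 0 -> z = 0.
  by rewrite -mulr_natr => /eqP; rewrite mulf_eq0 pnatr_eq0 orbF => /eqP.
exists a.+1; split=> //.
- by case=> // j /andP[_ ja]; apply: (mulrn0 _ j); rewrite -cA; exact: (Ha j ja).1.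
- by case=> // j /andP[_ ja]; apply: (mulrn0 _ j); rewrite -cB; exact: (Ha j ja).2.
move=> E; apply: Hab.
rewrite (cA a).
rewrite (cB a).
exact: (mulrC2 _ _ _ E).
Qed.

(** Let [a] and [b] be the constant coefficients of [f_v (u, 0)] and [f_vb (u, 0)]. They have
    the same modulus and are not zero, while the next coefficients [c], [d], of [u ^ n], have
    different moduli. So [s3 f] on the axis is [2 * Re (gamma * u ^ n)] up to higher order
    terms, where [gamma = a^c * c - b^c * d] is not zero, and it changes sign on small circles. *)
Lemma v_axis_zeros_cluster : set_v0 (d_u f) = 0 -> (exists2 m, m \in supp f & mexp m = (0, 1)%N) ->
  mixed_eval (s3 f) 0 0 = 0 -> zeros_cluster (d_u f) (s3 f).
Proof.
move=> gv0 [m0 m0f e0]; have [n [n0 HA HB nAB]] := first_coefs gv0.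
rewrite ev_s3_v0 !horner_coef0 => /eqP; rewrite subr_eq0 => /eqP cAB.
have c0 : pA`_0 != 0 \/ pB`_0 != 0.
  rewrite (coef_restriction _ iu_mv) (coef_restriction _ iu_mvb) -!mpoly.mcoeff_msupp.
  by have [] := mexp1 f_semihol m0f (congr1 snd e0); rewrite e0 => <-; [left|right].
pose gam := (pA`_0)^c * pA`_n - (pB`_0)^c * pB`_n.
have gam0 : gam != 0.
  apply/eqP => /eqP; rewrite subr_eq0 => /eqP E; apply: nAB.
  have a0 : pA`_0 * (pA`_0)^c != 0.
    by case: c0 => c0; [|rewrite cAB]; rewrite mul_conj_eq0.
  apply: (mulfI a0).
  move: (pA`_0) (pB`_0) (pA`_n) (pB`_n) E cAB {a0 c0 HA HB} => x y z w E cAB.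
  have E' : x * z^c = y * w^c by rewrite -[x]conjcK -[y]conjcK -!rmorphM E.
  transitivity (x^c * z * (x * z^c)); first by ring.
  by rewrite E E' cAB; ring.
pose qA := drop_poly n pA; pose qB := drop_poly n pB.
(* [Phi z r] is [s3 f (r * z, 0) / r ^ n]. *)
pose Phi (z : C) (r : R) : C :=
  (pA`_0)^c * (z ^+ n * qA.[r%:C * z]) + pA`_0 * (z ^+ n * qA.[r%:C * z])^c -
  ((pB`_0)^c * (z ^+ n * qB.[r%:C * z]) + pB`_0 * (z ^+ n * qB.[r%:C * z])^c) +
  r%:C ^+ n * ((z ^+ n * qA.[r%:C * z]) * (z ^+ n * qA.[r%:C * z])^c -
               (z ^+ n * qB.[r%:C * z]) * (z ^+ n * qB.[r%:C * z])^c).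
have PhiE z (r : R) : mixed_eval (s3 f) (r%:C * z) 0 = r%:C ^+ n * Phi z r.
  rewrite ev_s3_v0 (lower_poly _ n0 HA) (lower_poly _ n0 HB) -/qA -/qB exprMn /Phi.
  have rc : (r%:C ^+ n)^c = r%:C ^+ n by rewrite rmorphXn; congr (_ ^+ _); exact: conjc_real.
  have cm (x y : C) : (x + y * (r%:C ^+ n * z ^+ n))^c = x^c + r%:C ^+ n * (z ^+ n * y)^c.
    by rewrite rmorphD !rmorphM /= rc; move: (x^c) (y^c) ((z ^+ n)^c) => *; ring.
  rewrite !cm; move: (qA.[_]) (qB.[_]) (r%:C ^+ n) (z ^+ n) (pA`_0) (pB`_0) cAB {cm rc}.
  move=> x y w s c d cd.
  have -> : (c + x * (w * s)) * (c^c + w * (s * x)^c) -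
    (d + y * (w * s)) * (d^c + w * (s * y)^c) =
    c * c^c - d * d^c + w * (c^c * (s * x) + c * (s * x)^c -
     (d^c * (s * y) + d * (s * y)^c) + w * (s * x * (s * x)^c - s * y * (s * y)^c)) by ring.
  by rewrite cd subrr add0r.
have PhiC z : (fun r : R => complex.Re (Phi z r)) @ 0^'+ -->
    complex.Re (gam * z ^+ n + (gam * z ^+ n)^c).
  have -> : gam * z ^+ n + (gam * z ^+ n)^c = Phi z 0.
    rewrite /Phi mul0r expr0n eqn0Ngt n0 mul0r addr0 !horner_coef0 !coef_drop_poly !add0n.
    rewrite /gam !rmorphM rmorphB !rmorphM /= !conjcK; ring.
  apply: cvg_at_right_filter; apply: cvg_Re.
  have cz : (fun r : R => r%:C * z : Co) @ (0 : R) --> ((0 : R)%:C * z : Co).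
    exact: (cvgM (cvg_real_complex cvg_id) (cvg_cst (z : Co))).
  have ca (q : {poly C}) : (fun r : R => z ^+ n * q.[r%:C * z] : Co) @ (0 : R) -->
      (z ^+ n * q.[(0 : R)%:C * z] : Co).
    exact: (cvgM (cvg_cst (z ^+ n : Co)) (cvg_horner_cst (p := q) cz)).
  have cc (c : C) q : (fun r : R => c^c * (z ^+ n * q.[r%:C * z]) + c * (z ^+ n * q.[r%:C * z])^c : Co)
      @ (0 : R) --> (c^c * (z ^+ n * q.[(0 : R)%:C * z]) + c * (z ^+ n * q.[(0 : R)%:C * z])^c : Co).
    exact: (cvgD (cvgM (cvg_cst (c^c : Co)) (ca q)) (cvgM (cvg_cst (c : Co)) (cvg_conj (ca q)))).
  exact: (cvgD (cvgB (cc _ _) (cc _ _)) (cvgM (cvg_exp (cvg_real_complex cvg_id))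
    (cvgB (cvgM (ca qA) (cvg_conj (ca qA))) (cvgM (ca qB) (cvg_conj (ca qB)))))).
(* As [t] varies, [gam * expi t ^ n] takes all arguments. *)
have dir (s : C) : `|s| = 1 -> exists t, gam * expi t ^+ n = s * `|gam|.
  move=> s1; pose z := n.-root (s * `|gam| / gam).
  have zn : z ^+ n = s * `|gam| / gam by rewrite rootCK.
  have [t tE] : exists t, z = expi t.
    apply: expiP; apply/eqP; rewrite -(@pexpr_eq1 _ _ n) // -normrX zn.
    by rewrite !normrM s1 mul1r normr_id normfV mulfV // normr_eq0.
  by exists t; rewrite -tE zn mulrC divfK.
have norm1 : `|- 1 : C| = 1 by rewrite normrN normr1.
have [t1 t1E] := dir _ norm1; have [t2 t2E] := dir _ (normr1 C).
have [x xE x0] : exists2 x : R, `|gam| = x%:C & 0 < x.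
  have : 0 < `|gam| by rewrite normr_gt0.
  by case: (`|gam|) => x1 x2; rewrite ltcE /= => /andP[/eqP -> ?]; exists x1.
have lim1 := PhiC (expi t1); have lim2 := PhiC (expi t2).
rewrite t1E mulN1r xE -rmorphN in lim1; rewrite t2E mul1r xE in lim2.
have cr (y : R) : (y%:C)^c = y%:C by exact: conjc_real.
rewrite cr -rmorphD in lim1; rewrite cr -rmorphD in lim2.
have kR u v : complex.Im (mixed_eval (s3 f) u v) = 0 by exact: Im_ev_s3.
pose d := `|t2 - t1| + 1.
have d0 : 0 < d by rewrite ltr_wpDl.
have dt1 : `|t1 - t1| < d by rewrite subrr normr0.
have dt2 : `|t2 - t1| < d by rewrite ltrDl.
refine (@cluster_box _ (d_u f) (s3 f) (1, 1)%N (fun z => expi z.2) (fun=> 0) 1 t1 d t1 t2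
  isT kR d0 ltr01 dt1 dt2 _ _ _).
- move=> r s _ _; split.
  + exact: (@continuous_comp _ _ _ snd (@expi R : R -> Co) (r, s) cvg_snd (@continuous_expi R _)).
  + exact: cvg_cst.
  + by rewrite -(@ler_pXn2r _ 2) ?nnegrE // sqr_normc expi_norm expr1n.
  + by rewrite normr0.
  + move=> _; rewrite expi_neq0; split=> //.
    rewrite mulr0 -(ev_set_v0 _ _ 0) gv0; exact: ev0.
- have := lim1 => /(cvgr_lt (complex.Re (- x + - x)%:C)) H.
  have {}H := H 0 (_ : - x + - x < 0); have {}H := H ltac:(lra).
  near=> r; have r0 : 0 < r by near: r; exact: nbhs_right_gt.
  rewrite mulr0 expr1 PhiE -rmorphXn Re_real_mul pmulr_rlt0 ?exprn_gt0 //.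
  by near: r.
- have := lim2 => /(cvgr_gt (complex.Re (x + x)%:C)) H.
  have {}H := H 0 (_ : 0 < x + x); have {}H := H ltac:(lra).
  near=> r; have r0 : 0 < r by near: r; exact: nbhs_right_gt.
  rewrite mulr0 expr1 PhiE -rmorphXn Re_real_mul pmulr_rgt0 ?exprn_gt0 //.
  by near: r.
Unshelve. all: by end_near. Qed.

(** On the axis [v = 0] the face function is a multiple of a power of [u]. *)
Lemma face_set_v0_neq0 P h u v : u_semiholomorphic h -> positive_weight P -> u != 0 ->
  set_v0 h != 0 -> mixed_eval (weight_face P (set_v0 h)) u v != 0.
Proof.
move=> hh /andP[p1 _] u0 h0; have [m0 f0] := on_face_ex P h0.
have axis m : on_face P (set_v0 h) m -> [/\ m iub = 0, m iv = 0 & m ivb = 0]%N.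
  move=> [+ _]; rewrite set_v0E mem_supp_subsum /= addn_eq0 => /andP[/hh -> /andP[/eqP -> /eqP ->]].
  by [].
have uniq_m m : on_face P (set_v0 h) m -> m = m0.
  move=> fm; have [a1 a2 a3] := axis _ fm; have [b1 b2 b3] := axis _ f0.
  apply: meqP; split; rewrite ?a1 ?a2 ?a3 //.
  have := on_face_rdeg fm; rewrite -(on_face_rdeg f0) /rdeg /= a1 a2 a3 b1 b2 b3.
  by rewrite !addn0 !muln0 !addn0 => /eqP; rewrite eqn_pmul2l // => /eqP.
rewrite evE (bigD1_seq m0) ?mpoly.msupp_uniq //=; last exact/on_faceP.
rewrite big1_seq ?addr0 => [|m /andP[ne /on_faceP/uniq_m mE]]; last by rewrite mE eqxx in ne.
have [b1 b2 b3] := axis _ f0; rewrite /mon b1 b2 b3 !expr0 !mulr1 mulf_neq0 ?expf_neq0 //.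
by rewrite -mpoly.mcoeff_msupp; exact/on_faceP.
Qed.

(** On the axis [v = 0], [h] is then of order at least [n] in [u]. *)
Definition axis_order n (h : mixed R) :=
  forall m, m \in supp h -> (mexp m).2 = 0%N -> (n <= (mexp m).1)%N.

Lemma axis_order_sqr n h : axis_order n h -> axis_order n.*2 (h * mixed_conj h).
Proof.
move=> Hn m /supp_mulP[m1 [m2 [mh1]]]; rewrite mem_supp_conj => mh2 -> b0.
have [b1 b2] : (mexp m1).2 = 0%N /\ (mexp (mswap m2)).2 = 0%N.
  by move: b0; rewrite mexp_mswap /mexp /= !mpoly.mnmDE; lia.
have := Hn _ mh1 b1; have := Hn _ mh2 b2; rewrite mexp_mswap.
by rewrite /mexp /= !mpoly.mnmDE -addnn; lia.
Qed.

Lemma axis_orderB n h1 h2 : axis_order n h1 -> axis_order n h2 -> axis_order n (h1 - h2).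
Proof.
by move=> H1 H2 m /mpoly.msuppB_le; rewrite mem_cat => /orP[]; [exact: H1|exact: H2].
Qed.

Lemma axis_order_deriv n i (mu : nat -> mpoly.multinom 4) :
  (forall m, m iub = 0%N -> (mexp m).2 = 0%N -> mpoly.mnm_add m (mpoly.mnm1 i) = mu (m iu)) ->
  (forall j, (j < n)%N -> coef (mu j) f = 0) -> axis_order n (mpoly.mderiv i f).
Proof.
move=> muE H0 m mf b0; rewrite leqNgt; apply/negP => lt.
have m0 : m iub = 0%N by exact: (semihol_deriv f_semihol mf).
have := supp_deriv mf; rewrite (muE m m0 b0) mpoly.mcoeff_msupp H0 ?eqxx //.
by move: lt; rewrite /mexp /= m0 addn0.
Qed.

Lemma axis_order_s3 n : (forall j, (j < n)%N -> pA`_j = 0) -> (forall j, (j < n)%N -> pB`_j = 0) ->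
  axis_order n.*2 (s3 f).
Proof.
move=> HA HB; refine (@axis_orderB _ _ _ (axis_order_sqr _) (axis_order_sqr _)).
- apply: (@axis_order_deriv n iv mv) => [m m0|j jn].
    rewrite /mexp /= => /eqP; rewrite addn_eq0 => /andP[/eqP c /eqP d].
    have [e1 e2 e3 e4] := mvE (m iu); apply: meqP.
    by rewrite !mpoly.mnmDE !mpoly.mnm1E e1 e2 e3 e4 m0 c d /= addn0.
  by rewrite -(coef_restriction _ iu_mv); exact: HA.
- apply: (@axis_order_deriv n ivb mvb) => [m m0|j jn].
    rewrite /mexp /= => /eqP; rewrite addn_eq0 => /andP[/eqP c /eqP d].
    have [e1 e2 e3 e4] := mvbE (m iu); apply: meqP.
    by rewrite !mpoly.mnmDE !mpoly.mnm1E e1 e2 e3 e4 m0 c d /= addn0.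
  by rewrite -(coef_restriction _ iu_mvb); exact: HB.
Qed.

(** When the constant coefficients vanish, [k] on the axis is
    [(|c| ^ 2 - |d| ^ 2) * |u| ^ (2 * n)] up to higher order terms. Comparing with the
    rescaling of [k (u, 0)] as [r] tends to [0] shows that the face function does not vanish. *)
Lemma axis_leading n k P u v : (0 < n)%N ->
  (forall j, (j < n)%N -> pA`_j = 0) -> (forall j, (j < n)%N -> pB`_j = 0) ->
  pA`_n * (pA`_n)^c <> pB`_n * (pB`_n)^c ->
  (forall z, mixed_eval k z 0 = pA.[z] * (pA.[z])^c - pB.[z] * (pB.[z])^c) ->
  axis_order n.*2 k -> (0 < P.1)%N -> u != 0 ->
  mixed_eval (weight_face P (set_v0 k)) u v <> 0.
Proof.
move=> n0 HA HB nAB kE ok p1 u0 face0.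
pose qA := drop_poly n pA; pose qB := drop_poly n pB.
pose N (q : {poly C}) (r : R) : C := q.[r%:C ^+ P.1 * u] * (q.[r%:C ^+ P.1 * u])^c.
pose L r : C := u ^+ n * (u ^+ n)^c * (N qA r - N qB r).
pose d := min_rdeg P (set_v0 k); pose e := (d - P.1 * n.*2)%N.
pose S r : C := r%:C ^+ e * scal P (set_v0 k) r u v.
have LS r : 0 < r -> L r = S r.
  move=> r0; have w0 : r%:C ^+ (P.1 * n.*2) != 0 :> C.
    by rewrite expf_neq0 //; apply: contraTneq r0 => /complexI ->; rewrite ltxx.
  apply: (mulfI w0).
  transitivity (mixed_eval k (r%:C ^+ P.1 * u) 0).
    have H0 (p : {poly C}) : (forall j, (j < n)%N -> p`_j = 0) -> forall z,
        p.[z] = (drop_poly n p).[z] * z ^+ n.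
      by move=> H z; rewrite (lower_poly z n0) ?H ?add0r // => j /andP[_ /H].
    rewrite kE (H0 _ HA) (H0 _ HB) -/qA -/qB /L /N.
    have rc : (r%:C ^+ P.1)^c = r%:C ^+ P.1 by rewrite rmorphXn; congr (_ ^+ _); exact: conjc_real.
    have -> : r%:C ^+ (P.1 * n.*2) = (r%:C ^+ P.1) ^+ n * (r%:C ^+ P.1) ^+ n :> C.
      by rewrite -!exprM -exprD -mulnDr addnn.
    have cm (x : C) : (x * (r%:C ^+ P.1 * u) ^+ n)^c = x^c * ((r%:C ^+ P.1) ^+ n * (u ^+ n)^c).
      have cX (y : C) j : (y ^+ j)^c = y^c ^+ j by exact: rmorphXn.
      have cM (y z : C) : (y * z)^c = y^c * z^c by exact: rmorphM.
      by rewrite exprMn !cM !cX -cX rc.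
    rewrite !cm exprMn.
    move: (qA.[_]) (qB.[_]) ((r%:C ^+ P.1) ^+ n) (u ^+ n) => x y w z; ring.
  rewrite -(ev_set_v0 k _ (r%:C ^+ P.2 * v)) scalE -/d /S.
  have [k0|k0] := eqVneq (set_v0 k) 0.
    by rewrite /scal k0 mpoly.msupp0 big_nil !mulr0.
  rewrite [RHS]mulrA -exprD subnKC // /d.
  have [m mk <-] := min_rdeg_attained P k0; move: mk.
  rewrite set_v0E mem_supp_subsum => /andP[mk /eqP b0].
  by rewrite /rdeg b0 muln0 addn0 leq_mul2l ok ?orbT.
have cz : (fun r : R => r%:C ^+ P.1 * u : Co) @ (0 : R) --> ((0 : R)%:C ^+ P.1 * u : Co).
  exact: (cvgM (cvg_exp (cvg_real_complex cvg_id)) (cvg_cst (u : Co))).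
have cN q : (fun r : R => N q r : Co) @ (0 : R) --> (N q 0 : Co).
  exact: (cvgM (cvg_horner_cst (p := q) cz) (cvg_conj (cvg_horner_cst (p := q) cz))).
have cS : (fun r : R => S r : Co) @ (0 : R) --> (S 0 : Co).
  exact: (cvgM (cvg_exp (cvg_real_complex cvg_id))
    (cvg_scal cvg_id (cvg_cst (u : Co)) (cvg_cst (v : Co)))).
have cD : (fun r : R => L r - S r : Co) @ 0^'+ --> (L 0 - S 0 : Co).
  apply: cvg_at_right_filter.
  exact: (cvgB (cvgM (cvg_cst (u ^+ n * (u ^+ n)^c : Co)) (cvgB (cN qA) (cN qB))) cS).
have D0 : L 0 - S 0 != 0.
  rewrite /S scal0 face0 mulr0 subr0 /L /N expr0n eqn0Ngt p1 mul0r !horner_coef0.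
  rewrite !coef_drop_poly !add0n mulf_neq0 ?mul_conj_eq0 ?expf_neq0 //.
  by rewrite subr_eq0; exact/eqP.
have near_D : \forall r \near 0^'+, (L r - S r : C) != 0 by exact: cvgC_neq0 cD D0.
have [r [r0 /eqP]] : exists r : R, 0 < r /\ (L r - S r : C) != 0.
  apply: (@filter_ex _ (0 : R)^'+); near=> r; split; last by near: r.
  by near: r; exact: nbhs_right_gt.
by apply; rewrite LS // subrr.
Unshelve. all: by end_near. Qed.

Lemma face_set_v0_const P h u v : positive_weight P ->
  mixed_eval (weight_face P (set_v0 h)) u v = 0 -> mixed_eval h 0 0 = 0.
Proof. by move=> Ppos /(face_const Ppos); rewrite ev_set_v0. Qed.

(** If [f_v (0, 0)] and [f_vb (0, 0)] are not both zero, they have the same modulus, because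
    a nonzero constant term would be the face of [s3 f]. *)
Lemma v_axis_face P u v : positive_weight P -> u != 0 ->
  mixed_eval (weight_face P (set_v0 (d_u f))) u v = 0 ->
  mixed_eval (weight_face P (set_v0 (s3 f))) u v = 0 -> zeros_cluster (d_u f) (s3 f).
Proof.
move=> Ppos u0 gz kz; have [gv0|gv0] := eqVneq (set_v0 (d_u f)) 0; last first.
  refine (False_ind _ (elimN eqP (face_set_v0_neq0 v g_semihol Ppos u0 gv0) gz)).
have k0 := face_set_v0_const Ppos kz.
have [n [n0 HA HB nAB]] := first_coefs gv0.
have [m0f|m0f] := boolP (mv 0 \in supp f).
  by apply: (v_axis_zeros_cluster gv0 _ k0); exists (mv 0); rewrite ?mexp_mv.
have [m1f|m1f] := boolP (mvb 0 \in supp f).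
  by apply: (v_axis_zeros_cluster gv0 _ k0); exists (mvb 0); rewrite ?mexp_mvb.
have HA' j : (j < n)%N -> pA`_j = 0.
  case: j => [|j] jn; last exact: HA.
  by rewrite (coef_restriction _ iu_mv) (mpoly.memN_msupp_eq0 m0f).
have HB' j : (j < n)%N -> pB`_j = 0.
  case: j => [|j] jn; last exact: HB.
  by rewrite (coef_restriction _ iu_mvb) (mpoly.memN_msupp_eq0 m1f).
have p1 : (0 < P.1)%N by case/andP: Ppos.
refine (False_ind _ (axis_leading n0 HA' HB' nAB ev_s3_v0 (axis_order_s3 HA' HB') p1 u0 kz)).
Qed.

End VAxis.

(** * From singular points near the origin to a degenerate weight *)

Section Ultrafilters.
Context {R : realType} {T : Type} {G : set_system T} {UG : UltraFilter G}.
Implicit Types s t w : T -> R.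

Lemma ultra_not (A : T -> Prop) : ~ (\forall z \near G, A z) -> \forall z \near G, ~ A z.
Proof. by move=> nA; have [|] := in_ultra_setVsetC [set z | A z] UG. Qed.

Lemma ultra_bounded s a b : (\forall z \near G, a <= s z <= b) ->
  exists2 l, s @ G --> l & a <= l <= b.
Proof.
move=> sab; have [|l [lab cl]] := @segment_compact R a b (s @ G) _.
  by apply: filterS sab => z; rewrite /= in_itv.
exists l; last by move: lab; rewrite /= in_itv.
move=> B Bl; have [//|nB] := in_ultra_setVsetC (s @^-1` B) UG.
by have [y [nBy By]] := cl (~` B) B nB Bl.
Qed.

Lemma ultra_unit (s : T -> R[i]^o) : (\forall z \near G, `|(s z : R[i])| = 1) ->
  exists2 l : R[i]^o, s @ G --> l & (l : R[i]) != 0.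
Proof.
move=> s1.
have sq z : `|(s z : R[i])| = 1 -> complex.Re (s z) ^+ 2 + complex.Im (s z) ^+ 2 = 1.
  move=> sz; have : (s z : R[i]) * (s z)^c = 1 by rewrite -sqr_normc sz expr1n.
  by rewrite conjc_mul => -[].
have [a sa _] : exists2 a, (fun z => complex.Re (s z)) @ G --> a & -1 <= a <= 1.
  by apply: ultra_bounded; apply: filterS s1 => z /sq ?; nra.
have [b sb _] : exists2 b, (fun z => complex.Im (s z)) @ G --> b & -1 <= b <= 1.
  by apply: ultra_bounded; apply: filterS s1 => z /sq ?; nra.
have sl : s @ G --> (a +i* b : R[i]^o).
  have -> : s = (fun z => complex.Re (s z) +i* complex.Im (s z) : R[i]^o).
    by apply/funext => z; case: (s z).
  exact: cvg_complex.
exists (a +i* b) => //; apply/eqP => l0; rewrite l0 in sl.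
have : \forall z \near G, `|(s z : R[i]) - (0 : R[i])| < 1 by exact: cvgC_dist sl ltr01.
move=> H; have [z [z1]] := filter_ex (filterI s1 H).
by rewrite subr0 z1 ltxx.
Qed.

(** [s = o(t)] along [G], in a form that needs no division. *)
Definition little s t := forall e, 0 < e -> \forall z \near G, s z < e * t z.

Lemma little_trichotomy s t : (\forall z \near G, 0 < s z) -> (\forall z \near G, 0 < t z) ->
  [\/ little s t, little t s |
    exists2 c, 0 < c <= 1 & \forall z \near G, c * t z <= s z /\ c * s z <= t z].
Proof.
move=> s0 t0; have [|/existsNP[e1 /not_implyP[e1_gt0 /ultra_not H1]]] := pselect (little s t).
  by constructor 1.
have [|/existsNP[e2 /not_implyP[e2_gt0 /ultra_not H2]]] := pselect (little t s).
  by constructor 2.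
constructor 3; exists (Num.min 1 (Num.min e1 e2)).
  by rewrite !lt_min ltr01 e1_gt0 e2_gt0 ge_min lexx.
near=> z; have sz : 0 < s z by near: z.
have tz : 0 < t z by near: z.
have /negP : ~ s z < e1 * t z by near: z.
have /negP : ~ t z < e2 * s z by near: z.
rewrite -!leNgt => h2 h1; split.
  by apply: le_trans h1; rewrite ler_pM2r // !ge_min lexx !orbT.
by apply: le_trans h2; rewrite ler_pM2r // !ge_min lexx !orbT.
Unshelve. all: by end_near. Qed.

Lemma littleM s t w s' t' : (\forall z \near G, 0 < w z) -> little s t ->
  (forall z, s' z = s z * w z) -> (forall z, t' z = t z * w z) -> little s' t'.
Proof.
move=> w0 st s'E t'E e e0; near=> z.
have wz : 0 < w z by near: z.
have sz : s z < e * t z by near: z; exact: st.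
by rewrite s'E t'E mulrA ltr_pM2r.
Unshelve. all: by end_near. Qed.

Section Monomials.
Variables x y : T -> R.
Hypothesis x01 : \forall z \near G, 0 < x z < 1.
Hypothesis y01 : \forall z \near G, 0 < y z < 1.
Hypothesis x_small : forall e : R, 0 < e -> \forall z \near G, x z < e.
Hypothesis y_small : forall e : R, 0 < e -> \forall z \near G, y z < e.
Hypothesis unbalanced : forall Q, positive_weight Q ->
  little (fun z => x z ^+ Q.2) (fun z => y z ^+ Q.1) \/
  little (fun z => y z ^+ Q.1) (fun z => x z ^+ Q.2).

Lemma separate (a b : R) (l1 l2 u1 u2 : nat) : 0 < a < 1 -> 0 < b < 1 ->
  a ^+ l2 < b ^+ l1 -> b ^+ u1 < a ^+ u2 -> (l1 * u2 < u1 * l2)%N.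
Proof.
move=> /andP[a0 a1] /andP[b0 b1] L U; rewrite ltnNge; apply/negP => H.
have l2_gt0 : (0 < l2)%N.
  case: l2 L {H} => // L; have bl : b ^+ l1 <= 1 by rewrite exprn_ile1 ?ltW.
  by have := lt_le_trans L bl; rewrite expr0 ltxx.
have u2_gt0 : (0 < u2)%N.
  case: u2 H U => //; rewrite muln0 leqn0 muln_eq0 => /orP[/eqP ->|/eqP l0]; last by rewrite l0 in l2_gt0.
  by rewrite !expr0 ltxx.
have L' : a ^+ (l2 * u2) < b ^+ (l1 * u2).
  by rewrite !exprM ltr_pXn2r // nnegrE exprn_ge0 ?ltW.
have U' : b ^+ (u1 * l2) < a ^+ (u2 * l2).
  by rewrite !exprM ltr_pXn2r // nnegrE exprn_ge0 ?ltW.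
have B : b ^+ (l1 * u2) <= b ^+ (u1 * l2).
  by rewrite ler_wiXn2l ?ltW.
by have := lt_trans (lt_le_trans L' B) U'; rewrite mulnC ltxx.
Qed.

(** The weights for which [x ^ q2] is the smaller monomial have smaller ratios than those for
    which [y ^ q1] is; [P] is the mediant of the two nearest ones with bounded entries. *)
Lemma separating_weight D : exists2 P, positive_weight P & forall Q,
  (Q.1 <= D)%N -> (Q.2 <= D)%N ->
  ((\forall z \near G, x z ^+ Q.2 < y z ^+ Q.1) -> flatter Q P) /\
  ((\forall z \near G, y z ^+ Q.1 < x z ^+ Q.2) -> flatter P Q).
Proof.
pose Low (Q : nat * nat) := \forall z \near G, x z ^+ Q.2 < y z ^+ Q.1.
pose Up (Q : nat * nat) := \forall z \near G, y z ^+ Q.1 < x z ^+ Q.2.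
have sep L U : Low L -> Up U -> (L.1 * U.2 < U.1 * L.2)%N.
  move=> HL HU; have [z [zx [zy [zL zU]]]] := filter_ex (filterI x01 (filterI y01 (filterI HL HU))).
  exact: separate zx zy zL zU.
have low01 : Low (0, 1)%N by apply: filterS x01 => z /andP[_]; rewrite expr1 expr0.
have up10 : Up (1, 0)%N by apply: filterS y01 => z /andP[_]; rewrite expr1 expr0.
have [grid [g01 g10 in_grid]] : exists grid : seq (nat * nat), [/\ (0, 1)%N \in grid,
    (1, 0)%N \in grid & forall Q, (Q.1 <= D)%N -> (Q.2 <= D)%N -> Q \in grid].
  have [s sD] : exists s : seq nat, forall i, (i <= D)%N -> i \in s.
    by exists (iota 0 D.+1) => i; rewrite mem_iota add0n ltnS.
  exists ((0, 1)%N :: (1, 0)%N :: allpairs pair s s).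
  split=> [||[i j] /sD is_ /sD js]; rewrite !in_cons ?eqxx ?orbT //.
  by rewrite allpairs_f ?orbT.
pose Ls := [seq Q <- grid | `[< Low Q >]]; pose Us := [seq Q <- grid | `[< Up Q >]].
have [|L LLs maxL] := @seq_argmax _ Ls (fun Q => Defs.ratio Q) (0, 1)%N.
  by rewrite mem_filter g01 andbT; exact/asboolP.
have [|U UUs maxU] := @seq_argmax _ Us (fun Q => Defs.ratio (Q.2, Q.1)) (1, 0)%N.
  by rewrite mem_filter g10 andbT; exact/asboolP.
have HL : Low L by move: LLs; rewrite mem_filter => /andP[/asboolP].
have HU : Up U by move: UUs; rewrite mem_filter => /andP[/asboolP].
have LU := sep _ _ HL HU.
have low2 Q : Low Q -> (0 < Q.2)%N by move=> /sep/(_ up10); rewrite muln0 mul1n.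
have up1 Q : Up Q -> (0 < Q.1)%N by move=> HQ; have := sep _ _ low01 HQ; rewrite mul0n muln1.
have l2 := low2 _ HL; have u1 := up1 _ HU.
have crossR (a b c d : nat) : (0 < b)%N -> (0 < d)%N ->
    a%:R / b%:R <= c%:R / d%:R :> rat -> (a * d <= c * b)%N.
  move=> b0 d0; rewrite ler_pdivrMr ?ltr0n // mulrAC ler_pdivlMr ?ltr0n // -!natrM.
  by rewrite ler_nat.
exists (L.1 + U.1, L.2 + U.2)%N => [|Q q1 q2]; first by rewrite /positive_weight /=; lia.
have Qg := in_grid Q q1 q2; split=> HQ; rewrite /flatter /=.
  have q2_gt0 := low2 _ HQ.
  have QL : (Q.1 * L.2 <= L.1 * Q.2)%N.
    by apply: crossR => //; apply: maxL; rewrite mem_filter Qg andbT; exact/asboolP.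
  rewrite -(ltn_pmul2r l2).
  have : (Q.1 * L.2 * (L.2 + U.2) <= L.1 * Q.2 * (L.2 + U.2))%N by rewrite leq_mul2r QL orbT.
  have : (L.1 * U.2 * Q.2 < U.1 * L.2 * Q.2)%N by rewrite ltn_pmul2r.
  move: (L.1) (L.2) (U.1) (U.2) (Q.1) (Q.2) => *; lia.
have q1_gt0 := up1 _ HQ.
have QU : (Q.2 * U.1 <= U.2 * Q.1)%N.
  by apply: crossR => //; apply: (maxU Q); rewrite mem_filter Qg andbT; exact/asboolP.
rewrite -(ltn_pmul2r u1).
have : (Q.2 * U.1 * (L.1 + U.1) <= U.2 * Q.1 * (L.1 + U.1))%N by rewrite leq_mul2r QU orbT.
have : (L.1 * U.2 * Q.1 < U.1 * L.2 * Q.1)%N by rewrite ltn_pmul2r.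
move: (L.1) (L.2) (U.1) (U.2) (Q.1) (Q.2) => *; lia.
Qed.

Let X (e : nat * nat) z := x z ^+ e.1 * y z ^+ e.2.

Let little_add e i j : (0 < i + j)%N -> little (X (e.1 + i, e.2 + j)%N) (X e).
Proof.
move=> ij; apply: (@littleM (fun z => x z ^+ i * y z ^+ j) (fun=> 1) (X e)).
- apply: filterS2 x01 y01 => z /andP[x0 _] /andP[y0 _].
  by rewrite /X mulr_gt0 ?exprn_gt0.
- move=> e0 e0_gt0; near=> z; rewrite mulr1.
  have /andP[x0 x1] : 0 < x z < 1 by near: z.
  have /andP[y0 y1] : 0 < y z < 1 by near: z.
  have xe : x z < e0 by near: z; exact: x_small.
  have ye : y z < e0 by near: z; exact: y_small.
  have le1 (w : R) k : 0 < w -> w < 1 -> w ^+ k <= 1 by move=> w0 w1; rewrite exprn_ile1 ?ltW.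
  case: i ij => [|i] ij; last first.
    have yj : 0 <= y z ^+ j by rewrite exprn_ge0 ?ltW.
    have xi : 0 <= x z ^+ i by rewrite exprn_ge0 ?ltW.
    have xy1 := mulr_ile1 xi yj (le1 _ i x0 x1) (le1 _ j y0 y1).
    by apply: le_lt_trans xe; rewrite exprS -mulrA ler_piMr // ltW.
  case: j ij => // j _; rewrite expr0 mul1r; apply: le_lt_trans ye.
  by rewrite exprS ler_piMr ?le1 // ltW.
- by move=> z; rewrite /X /= !exprD; ring.
- by move=> z; rewrite mul1r.
Unshelve. all: by end_near. Qed.

(** [P] compares any two exponents as [x] and [y] compare the monomials: the difference of
    incomparable exponents is orthogonal to a weight, which [P] separates. *)
Lemma monomial_little D P e e0 : positive_weight P ->
  (forall Q, (Q.1 <= D)%N -> (Q.2 <= D)%N ->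
    ((\forall z \near G, x z ^+ Q.2 < y z ^+ Q.1) -> flatter Q P) /\
    ((\forall z \near G, y z ^+ Q.1 < x z ^+ Q.2) -> flatter P Q)) ->
  (e.1 <= D)%N -> (e.2 <= D)%N -> (e0.1 <= D)%N -> (e0.2 <= D)%N ->
  (pdeg P e0 <= pdeg P e)%N -> e != e0 ->
  (pdeg P e0 < pdeg P e)%N /\ little (X e) (X e0).
Proof.
case: e e0 => a b [a0 b0] /andP[p1 p2] HP /= aD bD a0D b0D.
rewrite /pdeg /= => le ne.
have lt1 s t : little s t -> \forall z \near G, s z < t z.
  by move=> /(_ 1 ltr01); apply: filterS => z; rewrite mul1r.
have X0 c d : \forall z \near G, 0 < X (c, d) z.
  by apply: filterS2 x01 y01 => z /andP[x0 _] /andP[y0 _]; rewrite mulr_gt0 ?exprn_gt0.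
have [la|la] := leqP a0 a; have [lb|lb] := leqP b0 b.
- have ij : (0 < (a - a0) + (b - b0))%N.
    by rewrite lt0n; apply: contraNneq ne => ?; apply/eqP; congr (_, _); lia.
  split; first by move: (P.1) (P.2) p1 p2 => *; nia.
  by have := little_add (a0, b0) ij; rewrite /= !subnKC.
- have a1 : (0 < a - a0)%N.
    by move: (P.1) (P.2) p1 p2 le => *; nia.
  pose Q := (b0 - b, a - a0)%N.
  have [HL HU] := HP Q (leq_trans (leq_subr _ _) b0D) (leq_trans (leq_subr _ _) aD).
  have [|L|U] := unbalanced (Q := Q); first by rewrite /positive_weight /= subn_gt0 lb.
    split; first by have := HL (lt1 _ _ L); rewrite /flatter /=; move: (P.1) (P.2) => *; nia.
    apply: (littleM (X0 a0 b) L) => z; rewrite /X /Q /=.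
      by rewrite mulrA -exprD subnK.
    by rewrite mulrCA -exprD subnK // ltnW.
  by exfalso; have := HU (lt1 _ _ U); rewrite /flatter /=; move: (P.1) (P.2) le => *; nia.
- have b1 : (0 < b - b0)%N.
    by move: (P.1) (P.2) p1 p2 le => *; nia.
  pose Q := (b - b0, a0 - a)%N.
  have [HL HU] := HP Q (leq_trans (leq_subr _ _) bD) (leq_trans (leq_subr _ _) a0D).
  have [|L|U] := unbalanced (Q := Q); first by rewrite /positive_weight /= b1 subn_gt0.
    by exfalso; have := HL (lt1 _ _ L); rewrite /flatter /=; move: (P.1) (P.2) le => *; nia.
  split; first by have := HU (lt1 _ _ U); rewrite /flatter /=; move: (P.1) (P.2) => *; nia.
  apply: (littleM (X0 a b0) U) => z; rewrite /X /Q /=.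
    by rewrite mulrCA -exprD subnK.
  by rewrite mulrA -exprD subnK // ltnW.
- by exfalso; move: (P.1) (P.2) p1 p2 le => *; nia.
Qed.

End Monomials.
End Ultrafilters.

Section LimitFaces.
Context {R : realType} {T : Type} {G : set_system T} {UG : UltraFilter G}.
Local Notation Co := (R[i]^o).
Variables (x y : T -> R) (w1 w2 : T -> Co) (a b : Co).
Hypothesis x01 : \forall z \near G, 0 < x z < 1.
Hypothesis y01 : \forall z \near G, 0 < y z < 1.
Hypothesis x_small : forall e : R, 0 < e -> \forall z \near G, x z < e.
Hypothesis y_small : forall e : R, 0 < e -> \forall z \near G, y z < e.
Hypothesis w1a : w1 @ G --> a.
Hypothesis w2b : w2 @ G --> b.
Implicit Types (h : mixed R) (P : nat * nat).

Definition vanishes h := \forall z \near G,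
  mixed_eval h ((x z)%:C * w1 z) ((y z)%:C * w2 z) = 0.

Lemma limit_eq0 (F : T -> Co) (l : Co) : F @ G --> l -> (\forall z \near G, (F z : R[i]) = 0) ->
  (l : R[i]) = 0.
Proof.
move=> Fl F0; apply/eqP/negPn/negP => l0.
have [z [Fz /eqP]] := filter_ex (filterI F0 (cvgC_neq0 Fl l0)).
by rewrite Fz.
Qed.

Lemma mon_polar (r s : R) (u v : R[i]) m : mon (r%:C * u) (s%:C * v) m =
  (r ^+ (mexp m).1 * s ^+ (mexp m).2)%:C * mon u v m.
Proof.
have cM (p : R) (z : R[i]) : (p%:C * z)^c = p%:C * z^c.
  by rewrite rmorphM; congr (_ * _); exact: conjc_real.
rewrite /mon !cM /mexp /= rmorphM !rmorphXn !exprMn !exprD.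
by do !(move: (_ ^+ _) => ?); ring.
Qed.

Lemma little_cvg0 s t : (\forall z \near G, 0 < s z) -> (\forall z \near G, 0 < t z) ->
  little (G := G) s t -> (fun z => s z / t z) @ G --> (0 : R).
Proof.
move=> s0 t0 st; apply/cvgrPdist_lt => e e0; near=> z.
have sz : 0 < s z by near: z.
have tz : 0 < t z by near: z.
rewrite sub0r normrN gtr0_norm ?divr_gt0 // ltr_pdivrMr //.
by near: z; exact: st.
Unshelve. all: by end_near. Qed.

(** After division by the monomial of [m0], all other monomials tend to [0], and the limit of
    the equation [h = 0] only retains the exponent of [m0]. *)
Lemma unbalanced_face h P m0 : on_face P h m0 ->
  (forall m, m \in supp h -> mexp m != mexp m0 -> (rdeg P m0 < rdeg P m)%N /\
    little (G := G) (fun z => x z ^+ (mexp m).1 * y z ^+ (mexp m).2)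
      (fun z => x z ^+ (mexp m0).1 * y z ^+ (mexp m0).2)) ->
  vanishes h -> mixed_eval (weight_face P h) a b = 0.
Proof.
move=> f0 Hm h0; pose X (e : nat * nat) z := x z ^+ e.1 * y z ^+ e.2.
have X0 e : \forall z \near G, 0 < X e z.
  by apply: filterS2 x01 y01 => z /andP[xz _] /andP[yz _]; rewrite mulr_gt0 ?exprn_gt0.
have -> : weight_face P h = part h (mexp m0).
  apply: (face_part f0) => m fm; apply/eqP/negPn/negP => /(Hm _ fm.1)[+ _].
  by rewrite (on_face_rdeg fm) (on_face_rdeg f0) ltnn.
(* The value of [h], divided by the monomial of [m0]. *)
pose F z : Co := \sum_(m <- supp h) coef m h * ((X (mexp m) z / X (mexp m0) z)%:C * mon (w1 z) (w2 z) m).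
have FE : \forall z \near G, F z = mixed_eval h ((x z)%:C * w1 z) ((y z)%:C * w2 z) / (X (mexp m0) z)%:C.
  have gen (p q : R) (c w : R[i]) : c * ((p / q)%:C * w) = c * (p%:C * w) / q%:C.
    by rewrite rmorphM fmorphV /= -!mulrA; congr (_ * (_ * _)); rewrite mulrC.
  apply: filterS (X0 (mexp m0)) => z _.
  rewrite evE mulr_suml; apply: eq_bigr => m _.
  by rewrite mon_polar; exact: gen.
have cF : F @ G --> (\sum_(m <- supp h) coef m h * ((mexp m == mexp m0)%:R%:C * mon a b m) : Co).
  apply: (@cvg_big_sum _ _ _ _ _ _ (fun m z => coef m h * ((X (mexp m) z / X (mexp m0) z)%:C * mon (w1 z) (w2 z) m))
     (fun m => coef m h * ((mexp m == mexp m0)%:R%:C * mon a b m))) => m mh.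
  refine (cvgM (cvg_cst (coef m h : Co)) (cvgM (cvg_real_complex _) (cvg_mon w1a w2b))).
  have [E|ne] := eqVneq (mexp m) (mexp m0); last first.
    by apply: little_cvg0; [exact: X0|exact: X0|have [] := Hm _ mh ne].
  refine (cvg_trans (near_eq_cvg _) (cvg_cst (1 : R))).
  by apply: filterS (X0 (mexp m0)) => z Xz; rewrite E divff // gt_eqF.
rewrite ev_subsum big_mkcond.
rewrite (eq_bigr (fun m => coef m h * ((mexp m == mexp m0)%:R%:C * mon a b m))); last first.
  by move=> m _; case: eqP => _; rewrite ?mul1r // mul0r mulr0.
apply: limit_eq0 cF _; apply: filterS2 FE h0 => z -> ->.
by rewrite mul0r.
Qed.

(** The rescaled points [(s * w1, w2)], with [s = x / r ^ p1] and [r = y ^ (1 / p2)], stay in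
    a compact part of the torus, so the limit is a zero of the face function there. *)
Lemma balanced_face P c : positive_weight P -> 0 < c <= 1 ->
  (\forall z \near G, c * y z ^+ P.1 <= x z ^+ P.2 /\ c * x z ^+ P.2 <= y z ^+ P.1) ->
  exists2 l : R, l != 0 & forall h, vanishes h -> mixed_eval (weight_face P h) (l%:C * a) b = 0.
Proof.
move=> /andP[p1 p2] /andP[c0 c1] Hc.
pose r z := y z `^ (P.2%:R^-1); pose s z := x z / r z ^+ P.1.
have rP z : 0 < y z -> 0 < r z /\ r z ^+ P.2 = y z.
  move=> yz; rewrite /r powR_gt0 //; split=> //.
  rewrite -powR_mulrn ?powR_ge0 // -powRrM mulVf ?powRr1 ?ltW //.
  by rewrite pnatr_eq0 -lt0n.
have r0 : r @ G --> (0 : R).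
  apply/cvgrPdist_lt => e e0; near=> z.
  have /andP[yz _] : 0 < y z < 1 by near: z.
  have [rz rE] := rP z yz.
  rewrite sub0r normrN gtr0_norm // -(@ltr_pXn2r _ P.2) ?nnegrE ?ltW // rE.
  by near: z; apply: y_small; rewrite exprn_gt0.
have s_bd : \forall z \near G, c <= s z <= c^-1.
  near=> z; have /andP[yz _] : 0 < y z < 1 by near: z.
  have /andP[xz _] : 0 < x z < 1 by near: z.
  have [h1 h2] : c * y z ^+ P.1 <= x z ^+ P.2 /\ c * x z ^+ P.2 <= y z ^+ P.1 by near: z.
  have [rz rE] := rP z yz.
  have sz : 0 < s z by rewrite divr_gt0 ?exprn_gt0.
  have sE : s z ^+ P.2 * y z ^+ P.1 = x z ^+ P.2.
    by rewrite /s expr_div_n -exprM mulnC exprM rE divfK // gt_eqF ?exprn_gt0.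
  have yP : 0 < y z ^+ P.1 by rewrite exprn_gt0.
  have sl : c <= s z ^+ P.2 by move: h1; rewrite -sE ler_pM2r.
  have su : s z ^+ P.2 <= c^-1.
    by move: h2; rewrite -sE mulrA -[leRHS]mul1r ler_pM2r // -ler_pdivlMl // mulr1.
  have c1' : 1 <= c^-1 by rewrite invf_ge1.
  have [s1|s1] := lerP 1 (s z).
    rewrite (le_trans c1 s1) (le_trans _ su) //.
    by rewrite ler_eXnr.
  rewrite (le_trans (ltW s1) c1') andbT (le_trans sl) //.
  by rewrite ler_iXnr // ltW.
have [l sl /andP[lc _]] := ultra_bounded s_bd.
exists l => [|h h0]; first by rewrite gt_eqF // (lt_le_trans c0).
have cs : (fun z => (s z)%:C * w1 z : Co) @ G --> (l%:C * a : Co).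
  exact: (cvgM (cvg_real_complex sl) w1a).
rewrite -scal0; apply: limit_eq0 (cvg_scal r0 cs w2b) _.
near=> z; have /andP[yz _] : 0 < y z < 1 by near: z.
have [rz rE] := rP z yz.
have hz : mixed_eval h ((x z)%:C * w1 z) ((y z)%:C * w2 z) = 0 by near: z.
have rn0 q : (r z)%:C ^+ q != 0 :> R[i].
  by rewrite expf_neq0 //; apply: contraTneq rz => /complexI ->; rewrite ltxx.
have e1 : (r z)%:C ^+ P.1 * ((s z)%:C * w1 z) = (x z)%:C * w1 z.
  by rewrite mulrA -rmorphXn -rmorphM; congr (_%:C * _); rewrite /s mulrC divfK // gt_eqF ?exprn_gt0.
have e2 : (r z)%:C ^+ P.2 = (y z)%:C by rewrite -rmorphXn rE.
by apply: (mulfI (rn0 (min_rdeg P h))); rewrite mulr0 -scalE e1 e2.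
Unshelve. all: by end_near. Qed.

End LimitFaces.

Section Degenerate.
Variable R : realType.
Local Notation Co := (R[i]^o).
Implicit Types (g k h : mixed R) (P : nat * nat) (u v : R[i]).

(** For [g = f_u] and [k = s3 f] with [f] semiholomorphic, this is the failure of strong partial
    non-degeneracy. *)
Definition degenerate g k := exists P u v, [/\ positive_weight P, u != 0, v != 0 &
  [\/ mixed_eval (weight_face P (set_u0 g)) u v = 0 /\
      mixed_eval (weight_face P (set_u0 k)) u v = 0,
      mixed_eval (weight_face P (set_v0 g)) u v = 0 /\
      mixed_eval (weight_face P (set_v0 k)) u v = 0 |
      mixed_eval (weight_face P g) u v = 0 /\ mixed_eval (weight_face P k) u v = 0]].

Definition modulus (u : R[i]) : R := complex.Re `|u|.

Lemma modulusE u : `|u| = (modulus u)%:C.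
Proof. by rewrite /modulus normc_def. Qed.

Lemma modulus_gt0 u : u != 0 -> 0 < modulus u.
Proof. by rewrite -normr_gt0 modulusE ltcR. Qed.

Definition dir (u : R[i]) : Co := u / (modulus u)%:C.

Lemma modulus_dir u : u != 0 -> (modulus u)%:C * dir u = u.
Proof.
move=> /modulus_gt0 u0; rewrite /dir mulrC divfK //.
by apply: contraTneq u0 => /complexI ->; rewrite ltxx.
Qed.

Lemma norm_dir u : u != 0 -> `|(dir u : R[i])| = 1.
Proof.
move=> u0; rewrite /dir -modulusE normrM normfV normr_id mulfV // normr_eq0.
exact: u0.
Qed.

Lemma exponent_bound (s : seq (mpoly.multinom 4)) : exists D, forall m, m \in s ->
  ((mexp m).1 <= D)%N /\ ((mexp m).2 <= D)%N.
Proof.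
exists (\max_(m <- s) ((mexp m).1 + (mexp m).2))%N => m ms.
have H := leq_bigmax_seq (F := fun m => (mexp m).1 + (mexp m).2)%N m ms isT.
by split; apply: leq_trans H; rewrite ?leq_addr ?leq_addl.
Qed.

(** Along an ultrafilter of common zeros tending to the origin, either a coordinate vanishes,
    or some weight balances [|u|] and [|v|], or none does. In the first case the missing
    coordinate is replaced by the modulus of the other one, which [set_u0] and [set_v0]
    ignore. In the last case, a weight that orders the exponents of [g] and [k] like the
    sizes of their monomials has a single exponent in each of its two faces. *)
Lemma zeros_cluster_degenerate g k : zeros_cluster g k -> degenerate g k.
Proof.
move=> acc; pose B (e : R) : set (R[i] * R[i]) := [set z | [/\ (z.1 != 0) || (z.2 != 0),
  `|z.1| < e%:C, `|z.2| < e%:C, mixed_eval g z.1 z.2 = 0 & mixed_eval k z.1 z.2 = 0]].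
have FB : ProperFilter (filter_from [set e : R | 0 < e] B).
  apply: filter_from_proper => [|e e0]; last first.
    have [|u [v H]] := acc e%:C; first by rewrite ltcR.
    by exists (u, v).
  apply: filter_from_filter => [|e1 e2 /= e10 e20]; first by exists 1; rewrite /= ltr01.
  exists (Num.min e1 e2); first by rewrite /= lt_min e10.
  move=> z [z0 + + gz kz]; rewrite !modulusE !ltcR !lt_min => /andP[a1 a2] /andP[b1 b2].
  by split; split=> //; rewrite modulusE ltcR.
have [G [UG sub]] := ultraFilterLemma FB.
have nearB e : 0 < e -> \forall z \near G, B e z by move=> e0; apply: sub; exists e.
have gG : \forall z \near G, mixed_eval g z.1 z.2 = 0 by apply: filterS (nearB _ ltr01) => z [].
have kG : \forall z \near G, mixed_eval k z.1 z.2 = 0 by apply: filterS (nearB _ ltr01) => z [].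
have n0 : \forall z \near G, (z.1 != 0) || (z.2 != 0).
  by apply: filterS (nearB _ ltr01) => z [].
pose x (z : R[i] * R[i]) := modulus z.1; pose y (z : R[i] * R[i]) := modulus z.2.
have x_small e : 0 < e -> \forall z \near G, x z < e.
  by move=> /nearB; apply: filterS => z [_ + _ _ _]; rewrite modulusE ltcR.
have y_small e : 0 < e -> \forall z \near G, y z < e.
  by move=> /nearB; apply: filterS => z [_ _ + _ _]; rewrite modulusE ltcR.
have polar (p : R[i] * R[i] -> R[i]) : (forall e, 0 < e -> \forall z \near G, modulus (p z) < e) ->
    (\forall z \near G, p z != 0) ->
    (\forall z \near G, 0 < modulus (p z) < 1) /\
    exists2 l : Co, (fun z => dir (p z)) @ G --> l & (l : R[i]) != 0.
  move=> small p0; split.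
    by apply: filterS2 p0 (small _ ltr01) => z /modulus_gt0 -> ->.
  by apply: ultra_unit; apply: filterS p0 => z; exact: norm_dir.
have unit11 : 0 < (1 : R) <= 1 by rewrite ltr01 lexx.
have real_neq0 (l : R) : l != 0 -> l%:C != 0 by apply: contraNneq => /complexI ->.
have [u0|u0] := in_ultra_setVsetC [set z : R[i] * R[i] | z.1 = 0] UG.
  have v0 : \forall z \near G, z.2 != 0.
    by apply: filterS2 n0 u0 => z + zu; rewrite zu eqxx.
  have [y01 [b yb b0]] := polar snd y_small v0.
  have bal : \forall z \near G, 1 * y z ^+ 1 <= y z ^+ 1 /\ 1 * y z ^+ 1 <= y z ^+ 1.
    by apply: filterE => z; rewrite mul1r.
  have [l l0 H] := @balanced_face _ _ _ _ y y (fun=> 1) (fun z => dir z.2) 1 b y01 y01 y_small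
    (cvg_cst (1 : Co)) yb (1, 1)%N 1 isT unit11 bal.
  have van h : (\forall z \near G, mixed_eval h z.1 z.2 = 0) ->
      vanishes (G := G) y y (fun=> 1) (fun z => dir z.2) (set_u0 h).
    by move=> hG; apply: filterS3 hG u0 v0 => z + /= zu zv; rewrite zu ev_set_u0 modulus_dir.
  exists (1, 1)%N, (l%:C * 1), b; split=> //; first by rewrite mulr1 real_neq0.
  by constructor 1; split; [exact: H (van _ gG)|exact: H (van _ kG)].
have [v0|v0] := in_ultra_setVsetC [set z : R[i] * R[i] | z.2 = 0] UG.
  have u0' : \forall z \near G, z.1 != 0 by apply: filterS u0 => z /eqP.
  have [x01 [a xa a0]] := polar fst x_small u0'.
  have bal : \forall z \near G, 1 * x z ^+ 1 <= x z ^+ 1 /\ 1 * x z ^+ 1 <= x z ^+ 1.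
    by apply: filterE => z; rewrite mul1r.
  have [l l0 H] := @balanced_face _ _ _ _ x x (fun z => dir z.1) (fun=> 1) a 1 x01 x01 x_small
    xa (cvg_cst (1 : Co)) (1, 1)%N 1 isT unit11 bal.
  have van h : (\forall z \near G, mixed_eval h z.1 z.2 = 0) ->
      vanishes (G := G) x x (fun z => dir z.1) (fun=> 1) (set_v0 h).
    by move=> hG; apply: filterS3 hG u0' v0 => z + zu /= zv; rewrite zv ev_set_v0 modulus_dir.
  exists (1, 1)%N, (l%:C * a), 1; split=> //; first by rewrite mulf_neq0 // real_neq0.
  by constructor 2; split; [exact: H (van _ gG)|exact: H (van _ kG)].
have {}u0 : \forall z \near G, z.1 != 0 by apply: filterS u0 => z /eqP.
have {}v0 : \forall z \near G, z.2 != 0 by apply: filterS v0 => z /eqP.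
have [x01 [a xa a0]] := polar fst x_small u0; have [y01 [b yb b0]] := polar snd y_small v0.
have van h : (\forall z \near G, mixed_eval h z.1 z.2 = 0) ->
    vanishes (G := G) x y (fun z => dir z.1) (fun z => dir z.2) h.
  by move=> hG; apply: filterS3 hG u0 v0 => z hz zu zv; rewrite !modulus_dir.
have [[P [c [Ppos c01 bal]]]|unbal] := pselect (exists P c, [/\ positive_weight P, 0 < c <= 1 &
    \forall z \near G, c * y z ^+ P.1 <= x z ^+ P.2 /\ c * x z ^+ P.2 <= y z ^+ P.1]).
  have [l l0 H] := balanced_face x01 y01 y_small xa yb Ppos c01 bal.
  exists P, (l%:C * a), b; split=> //; first by rewrite mulf_neq0 // real_neq0.
  by constructor 3; split; [exact: H (van _ gG)|exact: H (van _ kG)].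
have unb Q : positive_weight Q -> little (G := G) (fun z => x z ^+ Q.2) (fun z => y z ^+ Q.1) \/
    little (G := G) (fun z => y z ^+ Q.1) (fun z => x z ^+ Q.2).
  move=> Qpos; have xQ : \forall z \near G, 0 < x z ^+ Q.2.
    by apply: filterS x01 => z /andP[? _]; rewrite exprn_gt0.
  have yQ : \forall z \near G, 0 < y z ^+ Q.1.
    by apply: filterS y01 => z /andP[? _]; rewrite exprn_gt0.
  have [|//|[c c01 bal]] := little_trichotomy xQ yQ; [by left|by right|].
  by case: unbal; exists Q, c.
have [D HD] := exponent_bound (supp g ++ supp k).
have [P Ppos HP] := separating_weight x01 y01 D.
have face h : {subset supp h <= supp g ++ supp k} -> (\forall z \near G, mixed_eval h z.1 z.2 = 0) ->
    mixed_eval (weight_face P h) a b = 0.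
  move=> sh hG; have [->|h0] := eqVneq h 0; first by rewrite weight_face0 ev0.
  have [m0 f0] := on_face_ex P h0.
  apply: (unbalanced_face x01 y01 xa yb f0) (van _ hG) => m mh ne.
  have [d1 d2] := HD _ (sh _ mh); have [d3 d4] := HD _ (sh _ f0.1).
  exact: (monomial_little x01 y01 x_small y_small unb Ppos HP d1 d2 d3 d4 (f0.2 _ mh) ne).
exists P, a, b; split=> //; constructor 3; split; apply: face => // m mh;
  by rewrite mem_cat mh ?orbT.
Qed.

(** ** The singular set near the origin *)

Lemma zeros_cluster_near g k (U : set (Co * Co)) : zeros_cluster g k -> nbhs ((0, 0) : Co * Co) U ->
  exists u v, [/\ (u != 0) || (v != 0), mixed_eval g u v = 0, mixed_eval k u v = 0 & U (u, v)].
Proof.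
move=> acc /nbhs_ballP[e /= e0 HU]; have [u [v [n0 ue ve gz kz]]] := acc e e0.
by exists u, v; split=> //; apply: HU; split; rewrite /= -ball_normE /= sub0r normrN.
Qed.

Lemma zeros_cluster_origin g k h : zeros_cluster g k ->
  (forall u v, mixed_eval g u v = 0 -> mixed_eval k u v = 0 -> mixed_eval h u v = 0) ->
  mixed_eval h 0 0 = 0.
Proof.
move=> acc Hh; apply/eqP/negPn/negP => N0.
have c : (fun z : Co * Co => mixed_eval h z.1 z.2 : Co) @ ((0, 0) : Co * Co) --> (mixed_eval h 0 0 : Co).
  by apply: cvg_ev; [exact: cvg_fst|exact: cvg_snd].
have H : \forall z \near ((0, 0) : Co * Co), mixed_eval h z.1 z.2 != 0.
  exact: cvgC_neq0 c N0.
have [u [v [_ gz kz /=]]] := zeros_cluster_near acc H.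
by rewrite Hh // eqxx.
Qed.

Lemma isolatedP g k (S : set (Co * Co)) :
  (forall u v, S (u, v) <-> mixed_eval g u v = 0 /\ mixed_eval k u v = 0) ->
  (S (0, 0) -> isolated_at_origin S) <-> ~ zeros_cluster g k.
Proof.
move=> SP; split=> [H acc|nacc S0].
  have S0 : S (0, 0).
    by apply/SP; split; apply: (zeros_cluster_origin acc).
  have [U [Uo U0 US]] := H S0.
  have [u [v [n0 gz kz Uuv]]] := zeros_cluster_near acc (open_nbhs_nbhs (conj Uo U0)).
  have : (U `&` S) (u, v) by split=> //; apply/SP.
  by rewrite US => -[E1 E2]; rewrite E1 E2 eqxx in n0.
move: nacc => /existsNP[e /not_implyP[e0 He]].
exists (interior (ball ((0, 0) : Co * Co) e)); split.
- exact: open_interior.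
- by apply: nbhsx_ballx.
apply/seteqP; split=> [[u v] [/interior_subset [ub vb] /SP[gz kz]]|_ ->]; last first.
  by split=> //; apply: nbhsx_ballx.
apply: contrapT => ne; apply: He; exists u, v.
move: ub vb; rewrite -!ball_normE /= !sub0r !normrN => ub vb; split=> //.
rewrite -negb_and; apply/negP => /andP[/eqP u0 /eqP v0]; apply: ne.
by rewrite u0 v0.
Qed.

End Degenerate.

(** * The equivalence *)

Section Equivalence.
Variables (R : realType) (f : mixed R).
Hypothesis f_semihol : u_semiholomorphic f.
Implicit Types (h k l : mixed R) (P : nat * nat) (u v : R[i]).

Lemma no_common_zeroP h k l : no_common_zero h k l torus <-> forall u v, u != 0 -> v != 0 ->
  mixed_eval h u v = 0 -> mixed_eval k u v = 0 -> mixed_eval l u v = 0 -> False.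
Proof.
split=> [E u v u0 v0 hz kz lz|H].
  have : (zero_set h `&` zero_set k `&` zero_set l `&` torus) (u, v) by [].
  by rewrite E.
by apply/seteqP; split=> // -[u v] [[[hz kz] lz] [u0 v0]]; exact: H hz kz lz.
Qed.

Lemma face_mul_eq0 P h k l u v : l = h * k ->
  mixed_eval (weight_face P h) u v = 0 -> mixed_eval (weight_face P l) u v = 0.
Proof. by move=> -> h0; rewrite weight_faceM evM h0 mul0r. Qed.

Lemma nondegenerateP :
  strongly_partially_nondegenerate f <-> ~ degenerate (d_u f) (s3 f).
Proof.
have E1 := s1_semihol f_semihol; have E2 := s2_semihol f_semihol.
split=> [H [P [u [v [Ppos u0 v0 D]]]]|nd P Ppos].
  have [H1 H2 H3] := H P Ppos; case: D => -[gz kz].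
  - refine ((no_common_zeroP _ _ _).1 H1 u v u0 v0 _ _ kz).
      exact: (face_mul_eq0 (etrans (congr1 (@set_u0 R) E1) (set_u0M _ _)) gz).
    exact: (face_mul_eq0 (etrans (congr1 (@set_u0 R) E2) (set_u0M _ _)) gz).
  - refine ((no_common_zeroP _ _ _).1 H2 u v u0 v0 _ _ kz).
      exact: (face_mul_eq0 (etrans (congr1 (@set_v0 R) E1) (set_v0M _ _)) gz).
    exact: (face_mul_eq0 (etrans (congr1 (@set_v0 R) E2) (set_v0M _ _)) gz).
  - refine ((no_common_zeroP _ _ _).1 H3 u v u0 v0 _ _ kz).
      exact: (face_mul_eq0 E1 gz).
    exact: (face_mul_eq0 E2 gz).
split; apply/no_common_zeroP => u v u0 v0 _ z2 z3; refine (nd _); exists P, u, v; split=> //.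
- refine (Or31 _ _ (conj (face_set_u0_s2_eq0 f_semihol z2) z3)).
- refine (Or32 _ _ (conj (face_set_v0_s2_eq0 f_semihol z2) z3)).
- refine (Or33 _ _ (conj (face_s2_eq0 f_semihol z2) z3)).
Qed.

Hypothesis f_neq0 : f != 0.
Hypothesis f_origin : mixed_eval f 0 0 = 0.
Hypothesis g_ind : inner_nondegenerate (d_u f).
Hypothesis f_extrema : forall P, newton_weight f P -> nonzero_at_extrema f P.

Lemma degenerate_zeros_cluster : degenerate (d_u f) (s3 f) -> zeros_cluster (d_u f) (s3 f).
Proof.
have g_semihol : u_semiholomorphic (d_u f) by exact: semihol_deriv.
have shiftf m : m \in mpoly.msupp (d_u f) -> shift m \in mpoly.msupp f by exact: supp_deriv.
have unshift m : m \in mpoly.msupp f -> (mexp m).1 != 0%N ->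
    exists2 m', m' \in mpoly.msupp (d_u f) & m = shift m'.
  by move=> mf; rewrite /= (f_semihol mf) addn0; exact: supp_deriv_char.
have kR u v : complex.Im (mixed_eval (s3 f) u v) = 0 by exact: Im_ev_s3.
have ext P : newton_weight f P -> forall U : R -> R[i]^o, continuous U ->
    (forall t, mixed_eval (weight_face P (d_u f)) (U t) (expi t) = 0) -> forall t0,
    local_extremum (fun t => complex.Re (mixed_eval (weight_face P (s3 f)) (U t) (expi t))) t0 ->
    mixed_eval (weight_face P (s3 f)) (U t0) (expi t0) != 0.
  by move=> nw U cU HU; exact: (f_extrema nw (conj cU HU)).
have vax := v_axis_zeros_cluster f_semihol g_ind.
case=> P [u [v [Ppos u0 v0 [] [gz kz]]]].
- exact: (case_u_axis f_neq0 f_origin g_semihol shiftf unshift g_ind kR ext vax Ppos v0 gz kz).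
- exact: (v_axis_face f_semihol g_ind Ppos u0 gz kz).
- exact: (case_torus f_neq0 f_origin g_semihol shiftf unshift g_ind kR ext vax Ppos u0 v0 gz kz).
Qed.

End Equivalence.

Theorem proposition4p2 (R : realType) (f : mixed R)
    (f_neq0 : f != 0) (f_origin : mixed_eval f 0 0 = 0)
    (f_semihol : u_semiholomorphic f)
    (S_i : inner_nondegenerate (d_u f))
    (S_ii : forall P, newton_weight f P -> nonzero_at_extrema f P) :
  (singular_set f (0, 0) -> isolated_at_origin (singular_set f)) <->
  strongly_partially_nondegenerate f.
Proof.
have E1 := isolatedP (fun u v => singular_setP u v f_semihol).
have E2 := nondegenerateP f_semihol.
split=> [/E1 nacc|/E2 nd].
  by apply/E2 => /(degenerate_zeros_cluster f_semihol f_neq0 f_origin S_i S_ii).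
by apply/E1 => /zeros_cluster_degenerate.
Qed.
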